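(* Let $G$ be a near-bipartite brick other than $K_4$, with $n$ vertices. Then $G$ has at least $\frac{n-6}{2}$ removable edges. Moreover, $G$ has exactly $\frac{n-6}{2}$ removable edges if and only if $G$ is a tri-ladder (equivalently, a near-bipartite tri-ladder).
   Context: Graphs may have multiple edges but no loops. An edge of a graph is admissible if it lies in some perfect matching. A connected graph with at least two vertices is matching covered if every edge is admissible. An edge $e$ of a matching covered graph $G$ is removable if $G-e$ is matching covered. A brick is a 3-connected nonbipartite graph $G$ such that $G-x-y$ has a perfect matching for every two distinct vertices $x,y$. A nonbipartite matching covered graph $G$ is near-bipartite if it has a pair of edges $\{e_1,e_2\}$ such that $G-\{e_1,e_2\}$ is a bipartite matching covered graph. For $X\subseteq V(G)$, $\partial(X)$ is the set of edges with exactly one end in $X$; $G/X$ denotes the graph obtained by contracting $X$ to a single vertex $x$ (deleting edges with both ends in $X$), and $G/\overline{X}$ is defined analogously with $\overline{X}=V(G)\setminus X$ contracted to $\overline{x}$. We then say $G$ is a splicing of $G/X$ and $G/\overline{X}$ at $x$ and $\overline{x}$. $\overline{C_6}$ denotes the complement of the 6-cycle (the triangular prism). A graph $G$ is a tri-ladder if there is a sequence $G_0,G_1,\dots,G_r$ ($r\ge 0$) with $G_0=\overline{C_6}$, $G_r=G$, and for $1\le i\le r$, $G_i$ is a splicing of $G_{i-1}$ and $K_4$ at a vertex of $G_{i-1}$ lying in a triangle of $G_{i-1}$ and a vertex of $K_4$. *)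

(* Defs.v *)
From HB Require Import structures.
From mathcomp Require Import all_boot.

Set Implicit Arguments.
Unset Strict Implicit.
Unset Printing Implicit Defensive.

(* A finite multigraph: a finite vertex type, a finite edge type, and for each
   edge its (unordered) pair of ends, stored as an ordered pair. Looplessness is
   the separate predicate [loopless]. *)
Record mgraph := MGraph {
  vert : finType;
  edge : finType;
  ends : edge -> vert * vert }.

Arguments ends {m}.

Section Basic.
Variable G : mgraph.

Definition loopless : Prop := forall e : edge G, (ends e).1 != (ends e).2.

Definition incident (e : edge G) (v : vert G) : bool :=
  (v == (ends e).1) || (v == (ends e).2).

Definition pm_on (A : {set vert G}) (M : {set edge G}) : bool :=
  [forall e in M, ((ends e).1 \in A) && ((ends e).2 \in A)] &&
  [forall v in A, #|[set e in M | incident e v]| == 1].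

Definition perfect_matching (M : {set edge G}) : bool := pm_on setT M.

Definition has_pm_on (A : {set vert G}) : bool := [exists M, pm_on A M].

Definition admissible (e : edge G) : bool :=
  [exists M, perfect_matching M && (e \in M)].

Definition adjb (u v : vert G) : bool :=
  [exists e : edge G, (ends e == (u, v)) || (ends e == (v, u))].

Definition connected_on (A : {set vert G}) : bool :=
  [forall u in A, forall v in A,
     connect [rel x y : vert G | [&& x \in A, y \in A & adjb x y]] u v].

Definition connectedG : bool := connected_on setT.

Definition matching_covered : bool :=
  [&& 2 <= #|vert G|, connectedG & [forall e : edge G, admissible e]].

Definition bipartite : Prop :=
  exists A : {set vert G}, forall e : edge G, ((ends e).1 \in A) != ((ends e).2 \in A).

Definition three_connected : Prop :=
  4 <= #|vert G| /\
  forall S : {set vert G}, #|S| <= 2 -> connected_on (~: S).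

Definition bicritical : Prop :=
  forall x y : vert G, x != y -> has_pm_on (~: [set x; y]).

Definition brick : Prop := three_connected /\ ~ bipartite /\ bicritical.

Definition in_triangle (u : vert G) : Prop :=
  exists v w : vert G,
    [&& u != v, v != w, u != w, adjb u v, adjb v w & adjb u w].

End Basic.

Definition del_edges (G : mgraph) (D : {set edge G}) : mgraph :=
  @MGraph (vert G) {e : edge G | e \notin D} (fun e => ends (val e)).

Definition removable (G : mgraph) (e : edge G) : bool :=
  matching_covered (del_edges [set e]).

Definition near_bipartite (G : mgraph) : Prop :=
  ~ bipartite G /\ matching_covered G /\
  exists e1 e2 : edge G, e1 != e2 /\
    bipartite (del_edges [set e1; e2]) /\ matching_covered (del_edges [set e1; e2]).

Definition iso_map (G H : mgraph) (f : vert G -> vert H) (g : edge G -> edge H) : Prop :=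
  bijective f /\ bijective g /\
  forall e : edge G,
    ends (g e) = (f (ends e).1, f (ends e).2) \/ ends (g e) = (f (ends e).2, f (ends e).1).

Definition isomorphic (G H : mgraph) : Prop := exists f g, @iso_map G H f g.

(* G / X : contract X to a single vertex (None), deleting edges inside X *)
Definition contract (G : mgraph) (X : {set vert G}) : mgraph :=
  @MGraph (option {v : vert G | v \notin X} : finType)
          {e : edge G | ~~ (((ends e).1 \in X) && ((ends e).2 \in X))}
          (fun e => (insub (ends (val e)).1, insub (ends (val e)).2)).

Definition splicing (H G1 : mgraph) (u : vert G1) (G2 : mgraph) (w : vert G2) : Prop :=
  exists X : {set vert H},
    (exists f g, @iso_map (contract X) G1 f g /\ f None = u) /\
    (exists f g, @iso_map (contract (~: X)) G2 f g /\ f None = w).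

Definition sgraph (n : nat) (r : nat -> nat -> bool) : mgraph :=
  @MGraph 'I_n {p : 'I_n * 'I_n | (p.1 < p.2) && r p.1 p.2} (fun e => val e).

Definition K4 : mgraph := sgraph 4 (fun _ _ => true).

(* complement of the 6-cycle 0-1-2-3-4-5-0 (the triangular prism) *)
Definition C6bar : mgraph :=
  sgraph 6 (fun i j => ~~ ((j - i == 1) || (j - i == 5))).

Inductive triladder : mgraph -> Prop :=
| triladder_base G : isomorphic G C6bar -> triladder G
| triladder_step G0 H (u : vert G0) (w : vert K4) :
    triladder G0 -> in_triangle u -> splicing H u w -> triladder H.

(* Main.v *)
Require Import Defs.
From mathcomp Require Import all_boot.
From mathcomp Require Import zify.

Set Implicit Arguments.
Unset Strict Implicit.
Unset Printing Implicit Defensive.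

(** Write [G - e1 - e2] as a bipartite matching covered graph [H] with colour
    classes [A] and [B], where [e1] lies in [A] and [e2] in [B]; a perfect
    matching contains [e1] iff it contains [e2].  By Hall's theorem,
    bicriticality of [G] is equivalent to three lower bounds on the
    neighbourhoods of subsets of [A] (the record [nbs]).  An edge of [H] is
    nonremovable either because all perfect matchings through [e1] use it, which
    happens at most once per vertex, or because of a tight set.  Uncrossing tight
    sets shows that a vertex outside [e1] and [e2] sees at most two edges of the
    second kind, and that a vertex all of whose edges are nonremovable forms a
    triangle with [e1] or [e2] and is unique on its side.  So all but six vertices
    meet a removable edge, which is the bound.

    In the case of equality, uncrossing produces a rung next to the triangle on
    [e1] (or the graph is the prism).  Contracting this triangle preserves [nbs],
    and a matching leaving the triangle three times can be rerouted through the
    rung; hence the contraction loses exactly that rung from the set of removable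
    edges, and both directions follow by induction. *)

(** * Hall's theorem and perfect matchings *)

(** Passing from a subset of one class to the complement of its neighbourhood interchanges the
    second and third bounds of [nbs], so every statement about [A] and [e1] also holds for the
    opposite class and [e2]. The figure of two edges per vertex comes from [e2] having two ends:
    each tight set at a vertex leaves out a part of the opposite class that contains an end of [e2],
    and these parts are disjoint. The constant 6 is the four ends of [e1] and [e2] plus one
    exceptional vertex per class. The delicate point of the contraction is the second bound: the
    triangle vertex [w] outside [e1] disappears, and a set that sees [w] may lose a neighbour; the
    rung compensates for this. The third edge at [w] becomes the new [e1]. In the converse direction
    a tri-ladder comes without a choice of [e1] and [e2], but every odd cycle contains one of them,
    so the triangle created by the last splicing does. *)

Section Hall.
Variable V : finType.
Implicit Types (r : rel V) (X Y S T : {set V}).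

Definition rimg r X := [set y | [exists x in X, r x y]].

Lemma rimgP r X y : reflect (exists2 x, x \in X & r x y) (y \in rimg r X).
Proof. by rewrite inE; apply: exists_inP. Qed.

Lemma hall r S : (forall X, X \subset S -> #|X| <= #|rimg r X|) ->
  exists2 f : V -> V, {in S &, injective f} & forall x, x \in S -> r x (f x).
Proof.
have [n] := ubnP #|S|; elim: n => // n IH in r S *; rewrite ltnS => leSn hS.
have [->|[x0 x0S]] := set_0Vmem S.
  by exists id => [x y|x]; rewrite inE.
(* A proper nonempty set [X0] with exactly as many neighbours: it is matched inside its image and
   the rest of [S] outside that image, where Hall's condition survives by comparing [X] with its
   union with [X0]. *)
case: (boolP [exists X : {set V},
    [&& X \subset S, X != set0, X != S & #|rimg r X| == #|X|]]).
- case/existsP=> X0 /and4P[sX0 nz0 pX0 /eqP e0].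
  have ltX0 : #|X0| < #|S| by apply: proper_card; rewrite properEneq pX0.
  have gt0 : 0 < #|X0| by rewrite card_gt0.
  have [||f1 inj1 r1] := IH r X0; first by apply: leq_trans ltX0 _.
    by move=> X sX; apply: hS; apply: subset_trans sX sX0.
  pose r' : rel V := fun x y => r x y && (y \notin rimg r X0).
  have cS : #|S :\: X0| = #|S| - #|X0| by rewrite cardsD (setIidPr sX0).
  have [||f2 inj2 r2] := IH r' (S :\: X0); first by rewrite cS; lia.
    move=> X sX.
    have -> : rimg r' X = rimg r (X :|: X0) :\: rimg r X0.
      apply/setP=> y; rewrite in_setD; apply/rimgP/andP.
        case=> x xX /andP[rxy yn]; split=> //.
        by apply/rimgP; exists x => //; rewrite inE xX.
      case=> yn /rimgP[x]; rewrite inE => /orP[xX|xX0] rxy.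
        by exists x => //; rewrite /r' rxy.
      by case/rimgP: yn; exists x.
    have sI : rimg r X0 \subset rimg r (X :|: X0).
      apply/subsetP=> y /rimgP[x xX0 rxy]; apply/rimgP; exists x => //.
      by rewrite inE xX0 orbT.
    rewrite cardsD (setIidPr sI) e0.
    have dXX : [disjoint X & X0].
      rewrite disjoints_subset; apply: subset_trans sX _.
      by rewrite setDE subsetIr.
    have := hS (X :|: X0); rewrite cardsU (disjoint_setI0 dXX) cards0.
    have -> : X :|: X0 \subset S.
      by rewrite subUset sX0 andbT (subset_trans sX) // subsetDl.
    by move/(_ isT); lia.
  exists (fun x => if x \in X0 then f1 x else f2 x).
    have in2 x : x \in S -> x \notin X0 -> x \in S :\: X0 by rewrite inE => -> ->.
    have no x y : x \in X0 -> y \in S -> y \notin X0 -> f1 x <> f2 y.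
      move=> xX yS yX eq; have /andP[_ /negP[]] := r2 _ (in2 _ yS yX).
      by rewrite -eq; apply/rimgP; exists x => //; apply: r1.
    move=> x y xS yS; case: ifPn => xX; case: ifPn => yX eq.
    - by apply: inj1.
    - by case: (no _ _ xX yS yX).
    - by case: (no _ _ yX xS xX).
    - by apply: inj2 => //; apply: in2.
  move=> x xS; case: ifPn => xX; first exact: r1.
  have xD : x \in S :\: X0 by rewrite inE xX.
  by have /andP[] := r2 x xD.
(* Without such a set every proper nonempty subset has a surplus of one, so [x0] may take any
   neighbour [y0]. *)
rewrite negb_exists => /forallP nocrit.
have /card_gt0P[y0 /rimgP[x1]] : 0 < #|rimg r [set x0]|.
  by apply: leq_trans (hS _ _); rewrite ?cards1 // sub1set.
rewrite inE => /eqP-> rxy0.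
pose r' : rel V := fun x y => r x y && (y != y0).
have [||f inj rf] := IH r' (S :\ x0).
- by rewrite (cardsD1 x0 S) x0S in leSn; lia.
- move=> X sX.
  have -> : rimg r' X = rimg r X :\ y0.
    apply/setP=> y; rewrite in_setD1; apply/rimgP/andP.
      by case=> x xX /andP[rxy yn]; split=> //; apply/rimgP; exists x.
    by case=> yn /rimgP[x xX rxy]; exists x => //; rewrite /r' rxy.
  have sXS : X \subset S by rewrite (subset_trans sX) // subsetDl.
  have := nocrit X; have := hS X sXS; rewrite sXS /= (cardsD1 y0 (rimg r X)).
  have -> : X != S.
    by apply/eqP=> eX; move/subsetP: sX => /(_ x0); rewrite eX !inE eqxx x0S => /(_ isT).
  by have [->|nz] := eqVneq X set0; rewrite ?cards0 //=; case: (y0 \in _); lia.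
exists (fun x => if x == x0 then y0 else f x).
  move=> x y xS yS; have [->|nx] := eqVneq x x0; have [->|ny] := eqVneq y x0 => //.
  - by move=> eq; have := rf y; rewrite !inE ny yS -eq /r' eqxx andbF => /(_ isT).
  - by move=> eq; have := rf x; rewrite !inE nx xS eq /r' eqxx andbF => /(_ isT).
  - by move=> eq; apply: inj; rewrite // !inE ?nx ?ny.
move=> x xS; case: eqVneq => [->//|nx].
have xD : x \in S :\ x0 by rewrite !inE nx.
by have /andP[] := rf x xD.
Qed.

End Hall.

Section Graph.
Variable G : mgraph.
Implicit Types (g e f : edge G) (x y v : vert G) (X Y S T : {set vert G}).
Implicit Types (M D : {set edge G}).

Definition joins g x y := (ends g == (x, y)) || (ends g == (y, x)).

Definition vs g := [set (ends g).1; (ends g).2].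

Lemma incidentE g v : incident g v = (v \in vs g).
Proof. by rewrite !inE. Qed.

Lemma joinsC g x y : joins g x y = joins g y x.
Proof. by rewrite /joins orbC. Qed.

Lemma joins_vs g x y : joins g x y -> vs g = [set x; y].
Proof. by rewrite /vs; case/orP=> /eqP->//=; rewrite setUC. Qed.

Lemma joins_ends g : joins g (ends g).1 (ends g).2.
Proof. by rewrite /joins -surjective_pairing eqxx. Qed.

Lemma joins_l g x y : joins g x y -> x \in vs g.
Proof. by move/joins_vs->; rewrite !inE eqxx. Qed.

Lemma joins_r g x y : joins g x y -> y \in vs g.
Proof. by move/joins_vs->; rewrite !inE eqxx orbT. Qed.

Lemma vs_joins g x : x \in vs g -> exists y, joins g x y.
Proof.
rewrite !inE => /orP[]/eqP->; first by exists (ends g).2; apply: joins_ends.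
by exists (ends g).1; rewrite joinsC joins_ends.
Qed.

Lemma joins_inj g x x' y : joins g x y -> joins g x' y -> x = x'.
Proof.
by case/orP=> /eqP e1; case/orP=> /eqP; rewrite e1; case=> // -> ->.
Qed.

Lemma joins_injr g x y y' : joins g x y -> joins g x y' -> y = y'.
Proof. by rewrite joinsC [joins g x y']joinsC; apply: joins_inj. Qed.

Lemma adjbP x y : reflect (exists g, joins g x y) (adjb x y).
Proof. exact: existsP. Qed.

Definition nb D X := [set v | [exists g, (g \notin D) && [exists x in X, joins g x v]]].

Lemma nbP D X v :
  reflect (exists g x, [/\ g \notin D, x \in X & joins g x v]) (v \in nb D X).
Proof.
rewrite inE; apply: (iffP existsP) => [[g /andP[gD /exists_inP[x xX j]]]|[g [x [gD xX j]]]].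
  by exists g, x.
by exists g; rewrite gD; apply/exists_inP; exists x.
Qed.

Lemma nbI D X g x v : g \notin D -> x \in X -> joins g x v -> v \in nb D X.
Proof. by move=> gD xX j; apply/nbP; exists g, x. Qed.

Lemma nbU D X Y : nb D (X :|: Y) = nb D X :|: nb D Y.
Proof.
apply/setP=> v; rewrite in_setU; apply/nbP/orP.
  case=> g [x [gD]]; rewrite inE => /orP[] xX j; [left|right]; exact: nbI j.
by case=> /nbP[g [x [gD xX j]]]; exists g, x; rewrite inE xX ?orbT.
Qed.

Lemma nbS D X Y : X \subset Y -> nb D X \subset nb D Y.
Proof. by move/setUidPr=> <-; rewrite nbU subsetUl. Qed.

Lemma nb0 D : nb D set0 = set0.
Proof. by apply/setP=> v; rewrite in_set0; apply/nbP=> -[g [x []]]; rewrite inE. Qed.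

Lemma nbI_sub D X Y : nb D (X :&: Y) \subset nb D X :&: nb D Y.
Proof. by rewrite subsetI !nbS // ?subsetIl ?subsetIr. Qed.

(** The uncrossing inequality: neighbourhoods commute with unions, while that of an intersection
    lies in the intersection of the neighbourhoods. *)
Lemma nb_submod D X Y :
  #|nb D (X :|: Y)| + #|nb D (X :&: Y)| <= #|nb D X| + #|nb D Y|.
Proof.
by rewrite -[leqRHS]cardsUI nbU leq_add2l subset_leq_card // nbI_sub.
Qed.

Lemma pm_onP S M :
  reflect ((forall g, g \in M -> vs g \subset S) /\
    (forall v, v \in S -> exists2 g, g \in M & v \in vs g /\
        forall g', g' \in M -> v \in vs g' -> g' = g))
   (pm_on S M).
Proof.
apply: (iffP andP) => [[/forall_inP h1 /forall_inP h2]|[h1 h2]]; split.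
- by move=> g /h1; rewrite subUset !sub1set.
- move=> v /h2 /cards1P[g eg].
  have : g \in [set e in M | incident e v] by rewrite eg inE.
  rewrite inE incidentE => /andP[gM vg]; exists g => //; split=> // g' g'M vg'.
  by apply/set1P; rewrite -eg inE g'M incidentE.
- by apply/forall_inP => g /h1; rewrite subUset !sub1set.
- apply/forall_inP => v /h2[g gM [vg un]]; apply/cards1P; exists g.
  apply/setP=> g'; rewrite inE in_set1 incidentE.
  apply/andP/eqP=> [[g'M vg']|->//]; exact: un.
Qed.

Lemma pm_uniq S M v g g' : pm_on S M -> v \in S ->
  g \in M -> g' \in M -> v \in vs g -> v \in vs g' -> g = g'.
Proof.
by case/pm_onP=> _ h vS gM g'M vg vg'; have [k _ [_ un]] := h v vS; rewrite (un g) // (un g').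
Qed.

Lemma pm_cover S M v : pm_on S M -> v \in S -> exists2 g, g \in M & v \in vs g.
Proof. by case/pm_onP=> _ h vS; have [k ? [? _]] := h v vS; exists k. Qed.

Lemma pm_sub S M g : pm_on S M -> g \in M -> vs g \subset S.
Proof. by case/pm_onP=> h _; apply: h. Qed.

(** Distinct vertices have distinct partners; in this form the existence of a matching becomes a
    lower bound for a neighbourhood. *)
Lemma pm_card S M X Y : pm_on S M -> X \subset S ->
  (forall g x v, g \in M -> x \in X -> joins g x v -> v \in Y) -> #|X| <= #|Y|.
Proof.
move=> pm sX hXY.
(* The default [x] is never taken on [X], whose vertices are all covered. *)
pose mate x := odflt x [pick v | [exists g in M, joins g x v]].
have mP x : x \in X -> exists2 g, g \in M & joins g x (mate x).
  move=> xX; rewrite /mate; case: pickP => [v /exists_inP[g]|no]; first by exists g.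
  have [g gM /vs_joins[v j]] := pm_cover pm (subsetP sX _ xX).
  by have /exists_inP[] := no v; exists g.
rewrite -(card_in_imset (f := mate) (D := X)).
  apply/subset_leq_card/subsetP=> _ /imsetP[x xX ->].
  have [g gM j] := mP x xX; exact: hXY j.
move=> x y xX yX em; have [g gM j] := mP x xX; have [g' g'M j'] := mP y yX.
have vS : mate x \in S by apply: (subsetP (pm_sub pm gM)); apply: joins_r j.
have eg : g = g' by apply: (pm_uniq pm vS) => //; rewrite ?(joins_r j) // em (joins_r j').
by rewrite -em -eg in j'; apply: joins_inj j j'.
Qed.

Lemma pm_union S1 S2 M1 M2 : pm_on S1 M1 -> pm_on S2 M2 -> [disjoint S1 & S2] ->
  pm_on (S1 :|: S2) (M1 :|: M2).
Proof.
move=> pm1 pm2 dj; apply/pm_onP; split=> [h|v].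
  rewrite inE => /orP[] /pm_sub hs.
    by rewrite (subset_trans (hs _ pm1)) ?subsetUl.
  by rewrite (subset_trans (hs _ pm2)) ?subsetUr.
have aux S S' M M' : pm_on S M -> pm_on S' M' -> [disjoint S & S'] -> v \in S ->
    exists2 g, g \in M & v \in vs g /\
      forall h, (h \in M) || (h \in M') -> v \in vs h -> h = g.
  move=> pm pm' d vS; have [g gM vg] := pm_cover pm vS; exists g => //.
  split=> // h /orP[hM|hM] vh; first exact: (pm_uniq pm vS).
  by have := disjointFr d vS; rewrite (subsetP (pm_sub pm' hM) _ vh).
rewrite inE => /orP[vS|vS].
  have [g gM [vg un]] := aux _ _ _ _ pm1 pm2 dj vS.
  by exists g; [rewrite inE gM | split=> // h; rewrite inE; apply: un].
rewrite disjoint_sym in dj; have [g gM [vg un]] := aux _ _ _ _ pm2 pm1 dj vS.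
by exists g; [rewrite inE gM orbT | split=> // h; rewrite inE orbC; apply: un].
Qed.

Lemma pm_single g : pm_on (vs g) [set g].
Proof.
apply/pm_onP; split=> [h /set1P->//|v vg].
by exists g; [rewrite inE | split=> // h /set1P].
Qed.

(** Hall's theorem for edges instead of vertex pairs. Since [S] and [T] have the same size, an
    injective choice of partners in [T] already covers [T]. *)
Lemma hall_pm D S T : [disjoint S & T] -> #|S| = #|T| ->
  (forall X, X \subset S -> #|X| <= #|nb D X :&: T|) ->
  exists2 M, pm_on (S :|: T) M & [disjoint M & D].
Proof.
move=> dST cST hS.
pose r : rel (vert G) := fun x y => (y \in nb D [set x]) && (y \in T).
have [X sX|f injf rf] := hall (r := r) (S := S).
  rewrite (leq_trans (hS X sX)) // subset_leq_card //.
  apply/subsetP=> y /setIP[/nbP[g [x [gD xX j]]] yT]; apply/rimgP; exists x => //.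
  by rewrite /r yT andbT; apply: nbI gD _ j; rewrite inE.
have exg x : x \in S -> exists2 g, g \notin D & joins g x (f x).
  by move=> /rf /andP[/nbP[g [x' [gD]]]]; rewrite inE => /eqP-> j; exists g.
(* One edge per vertex of [S], the one returned by [pick], so that parallel edges are never taken
   together. *)
pose M := [set g | [exists x in S, Some g == [pick g | (g \notin D) && joins g x (f x)]]].
have MP g : g \in M -> exists2 x, x \in S & (g \notin D) && joins g x (f x).
  rewrite inE => /exists_inP[x xS /eqP]; case: pickP => // g' h [->].
  by exists x.
have MI x : x \in S -> exists2 g, g \in M & joins g x (f x).
  move=> xS; have [g gD j] := exg x xS.
  case E: [pick g | (g \notin D) && joins g x (f x)] => [g'|].
    exists g'; first by rewrite inE; apply/exists_inP; exists x => //; rewrite E.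
    by move: E; case: pickP => // k /andP[_ jk] [<-].
  by move: E; case: pickP => // /(_ g); rewrite gD j.
have Mu g g' x : g \in M -> g' \in M -> x \in S ->
   joins g x (f x) -> joins g' x (f x) -> g = g'.
  rewrite !inE => /exists_inP[y yS /eqP eg] /exists_inP[y' yS' /eqP eg'] xS j j'.
  have get k z : z \in S -> Some k = [pick g | (g \notin D) && joins g z (f z)] ->
      joins k x (f x) -> z = x.
    move=> zS; case: pickP => // k' /andP[_ jk'] [->] jk.
    have := joins_l jk; rewrite (joins_vs jk') !inE => /orP[/eqP->//|/eqP efz].
    have := disjointFr dST xS; rewrite efz; have /andP[_ ->] := rf z zS; by [].
  have ey := get _ _ yS eg j; have ey' := get _ _ yS' eg' j'.
  by subst y y'; move: eg'; rewrite -eg => -[].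
have fT : f @: S = T.
  apply/eqP; rewrite eqEcard card_in_imset // cST leqnn andbT.
  by apply/subsetP=> _ /imsetP[x xS ->]; have /andP[] := rf x xS.
exists M; last first.
  by rewrite disjoints_subset; apply/subsetP=> g /MP[x _ /andP[gD _]]; rewrite inE.
have inS g x v : x \in S -> joins g x (f x) -> v \in vs g -> v \in S -> v = x.
  move=> xS j; rewrite (joins_vs j) !inE => /orP[/eqP->//|/eqP->].
  by move/(disjointFr dST); have /andP[_ ->] := rf x xS.
have inT g x v : x \in S -> joins g x (f x) -> v \in vs g -> v \in T -> v = f x.
  move=> xS j; rewrite (joins_vs j) !inE => /orP[/eqP->|/eqP->//].
  by move/(disjointFl dST); rewrite xS.
apply/pm_onP; split=> [g /MP[x xS /andP[_ j]]|v].
  rewrite (joins_vs j) subUset !sub1set !inE xS /=.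
  by have /andP[_ ->] := rf x xS; rewrite orbT.
rewrite inE => /orP[vS|]; last rewrite -fT => /imsetP[x xS ev].
  have [g gM j] := MI v vS; exists g => //; split; first exact: joins_l j.
  move=> g' g'M vg'; have [x xS /andP[_ jx]] := MP _ g'M.
  have ex := inS _ _ _ xS jx vg' vS; subst x; exact: (Mu _ _ v).
have [g gM j] := MI x xS; exists g => //; split; first by rewrite ev (joins_r j).
move=> g' g'M vg'; have [x' xS' /andP[_ jx]] := MP _ g'M.
have vT : v \in T by rewrite -fT ev imset_f.
have := inT _ _ _ xS' jx vg' vT; rewrite ev => /(injf _ _ xS xS') ex; subst x'.
exact: (Mu _ _ x).
Qed.

End Graph.

Section Deletion.
Variables (G : mgraph) (D : {set edge G}).

Lemma del_pm_val (M : {set edge (del_edges D)}) : perfect_matching M ->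
  @perfect_matching G (val @: M) /\ [disjoint val @: M & D].
Proof.
move=> pm; split.
  apply/pm_onP; split=> [g _|v _]; first exact: subsetT.
  have [g gM vg] := pm_cover pm (in_setT v); exists (val g); first exact: imset_f.
  split=> // _ /imsetP[h hM ->] vh; congr val.
  by apply: (pm_uniq pm (in_setT v)).
rewrite disjoints_subset; apply/subsetP=> _ /imsetP[h hM ->]; rewrite inE.
exact: (valP h).
Qed.

Lemma del_pm_preim (M : {set edge G}) : perfect_matching M -> [disjoint M & D] ->
  @perfect_matching (del_edges D) [set g | val g \in M].
Proof.
move=> pm dj; apply/pm_onP; split=> [g _|v _]; first exact: subsetT.
have [g gM vg] := pm_cover pm (in_setT v).
have gD : g \notin D by rewrite (disjointFr dj gM).
exists (Sub g gD : edge (del_edges D)); first by rewrite inE SubK.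
split; first by [].
move=> h; rewrite inE => hM vh; apply: val_inj; rewrite SubK.
exact: (pm_uniq pm (in_setT v)).
Qed.

Lemma del_adjP u v :
  reflect (exists2 g, g \notin D & joins g u v) (@adjb (del_edges D) u v).
Proof.
apply: (iffP (adjbP _ _)) => [[g j]|[g gD j]]; first by exists (val g) => //; apply: (valP g).
by exists (Sub g gD : edge (del_edges D)).
Qed.

Lemma del_mc_adm f : matching_covered (del_edges D) -> f \notin D ->
  exists2 M, perfect_matching M & f \in M /\ [disjoint M & D].
Proof.
case/and3P=> _ _ /forallP ad fD.
have /existsP[M /andP[pm fM]] := ad (Sub f fD : edge (del_edges D)).
have [pm' dj] := del_pm_val pm; exists (val @: M) => //; split=> //.
by apply/imsetP; exists (Sub f fD : edge (del_edges D)); rewrite ?SubK.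
Qed.

End Deletion.

Lemma removable_adm (G : mgraph) (e f : edge G) : removable e -> f != e ->
  exists2 M, perfect_matching M & f \in M /\ e \notin M.
Proof.
move=> mc ne; have [|M pm [fM dj]] := del_mc_adm (f := f) mc; first by rewrite inE.
by exists M => //; split=> //; rewrite (disjointFl dj) ?inE.
Qed.

Section Closed.
Variable (V : finType).
Lemma connect_closed (r : rel V) (C : {set V}) u v :
  (forall x y, x \in C -> r x y -> y \in C) -> connect r u v -> u \in C -> v \in C.
Proof.
move=> cl /connectP[p]; elim: p u => [|x p IH] u /=; first by move=> _ ->.
by case/andP=> rux px ev uC; apply: (IH x) => //; apply: cl uC rux.
Qed.
End Closed.

(** * The neighbourhood conditions *)

(** [nbs_C1] expresses that the bipartite graph [G - e1 - e2] is matching covered. [nbs_C2] comes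
    from deleting two vertices of [A]: a perfect matching of the rest must use [e2] and avoid [e1].
    [nbs_C3] comes from deleting two neighbours of [X], which forces [e1] in and [e2] out. *)
Record nbs (G : mgraph) (A : {set vert G}) (e1 e2 : edge G) : Prop := Nbs {
  nbs_e1 : vs e1 \subset A;
  nbs_e2 : vs e2 \subset ~: A;
  nbs_c1 : #|vs e1| = 2;
  nbs_c2 : #|vs e2| = 2;
  nbs_cross : forall g, g \notin [set e1; e2] ->
                ((ends g).1 \in A) != ((ends g).2 \in A);
  nbs_card : #|A| = #|~: A|;
  nbs_ge3 : 3 <= #|A|;
  nbs_C1 : forall X : {set vert G}, X \subset A -> X != set0 -> X != A ->
             #|X| < #|nb [set e1; e2] X|;
  nbs_C2 : forall X : {set vert G}, X \subset A -> #|X| + 2 <= #|A| ->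
             #|X| <= #|nb [set e1; e2] X :\: vs e2|;
  nbs_C3 : forall X : {set vert G}, X \subset A :\: vs e1 -> X != set0 ->
             #|X| + 2 <= #|nb [set e1; e2] X| }.

Lemma cardsUD (T : finType) (X Y : {set T}) : #|X :|: Y| = #|X :\: Y| + #|Y|.
Proof. by rewrite cardsU cardsD; have := subset_leq_card (subsetIl X Y); lia. Qed.

Lemma setC_flip (T : finType) (A : {set T}) x y :
  ((x \in A) != (y \in A)) = ((x \in ~: A) != (y \in ~: A)).
Proof. by rewrite !in_setC; case: (x \in A); case: (y \in A). Qed.

Section Cross.
Variables (G : mgraph) (A : {set vert G}) (e1 e2 : edge G).
Implicit Types X Y : {set vert G}.
Hypothesis cr : forall g, g \notin [set e1; e2] ->
                ((ends g).1 \in A) != ((ends g).2 \in A).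

Lemma cross_joins g x v : g \notin [set e1; e2] -> joins g x v ->
  (v \in A) = (x \notin A).
Proof.
move/cr=> c; case/orP=> /eqP eg; move: c; rewrite eg /=;
by case: (x \in A); case: (v \in A).
Qed.

Lemma cross_nb X : X \subset A -> nb [set e1; e2] X \subset ~: A.
Proof.
move=> sX; apply/subsetP=> v /nbP[g [x [gD xX j]]].
by rewrite inE (cross_joins gD j) (subsetP sX _ xX).
Qed.

Lemma cross_nbC Y : Y \subset ~: A -> nb [set e1; e2] Y \subset A.
Proof.
move=> sX; apply/subsetP=> v /nbP[g [x [gD xX j]]].
by rewrite (cross_joins gD j); have := subsetP sX _ xX; rewrite inE.
Qed.

Lemma nb_compl X Y : [disjoint X & nb [set e1; e2] Y] ->
  [disjoint nb [set e1; e2] X & Y].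
Proof.
rewrite !disjoints_subset => /subsetP h; apply/subsetP=> v /nbP[g [x [gD xX j]]].
rewrite inE; apply/negP=> vY; have := h x xX; rewrite inE => /negP[].
by apply: nbI gD vY _; rewrite joinsC.
Qed.

End Cross.

(** For [Y] in the other class, the part of [A] outside the neighbourhood of [Y] has no neighbour in
    [Y], which turns lower bounds for it into lower bounds for [Y]. [nbs_C1] is self-dual; [nbs_C2]
    and [nbs_C3] change places. *)
Lemma nbs_sym (G : mgraph) (A : {set vert G}) e1 e2 : nbs A e1 e2 -> nbs (~: A) e2 e1.
Proof.
case=> s1 s2 c1 c2 cr cA ge3 C1 C2 C3.
have cr' g : g \notin [set e2; e1] -> ((ends g).1 \in ~: A) != ((ends g).2 \in ~: A).
  by rewrite -setC_flip setUC => /cr.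
set N := nb [set e1; e2].
(* [nbs_C1] excludes [A] itself; but deleting one vertex already leaves a neighbourhood as large as
   [A]. *)
have NA : N A = ~: A.
  apply/eqP; rewrite eqEcard cross_nb //= -cA.
  have /card_gt0P[a aA] : 0 < #|A| by lia.
  have ne : A :\ a != A by apply/eqP=> /setP/(_ a); rewrite !inE eqxx aA.
  have cD := cardsD1 a A; rewrite aA in cD.
  have nz : A :\ a != set0 by rewrite -card_gt0; lia.
  have := C1 _ (subsetDl _ _) nz ne.
  by have := subset_leq_card (nbS [set e1; e2] (subsetDl A [set a])); rewrite -/N; lia.
have cN (X Y : {set vert G}) : X \subset A -> Y \subset ~: A -> [disjoint X & N Y] ->
    #|N X| + #|Y| <= #|A|.
  move=> sX sY dj; rewrite cA.
  have /disjoint_setI0 d0 := nb_compl dj.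
  have -> : #|N X| + #|Y| = #|N X :|: Y| by rewrite cardsU d0 cards0 subn0.
  by apply: subset_leq_card; rewrite subUset sY cross_nb.
have dD (X Y : {set vert G}) : [disjoint X :\: Y & Y] by rewrite disjoints_subset setDE subsetIr.
have cNY (Y : {set vert G}) : Y \subset ~: A -> #|A :\: N Y| + #|N Y| = #|A|.
  move=> sY; have sNY : N Y \subset A by apply: cross_nbC sY.
  by rewrite cardsD (setIidPr sNY) subnK // subset_leq_card.
have D' : [set e2; e1] = [set e1; e2] by rewrite setUC.
split; rewrite ?setCK ?D' //.
- by rewrite -D'.
- by rewrite -cA.
- move=> Y sY nY nYB.
  have := cNY Y sY; have := cN (A :\: N Y) Y (subsetDl _ _) sY (dD _ _).
  have ltY : #|Y| < #|A| by rewrite cA; apply: proper_card; rewrite properEneq nYB.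
  have gtY : 0 < #|Y| by rewrite card_gt0.
  have [->|nz] := eqVneq (A :\: N Y) set0; first by rewrite cards0 -/N; lia.
  have [eA|nA] := eqVneq (A :\: N Y) A; first by rewrite eA NA -cA; lia.
  by have := C1 _ (subsetDl _ _) nz nA; rewrite -/N; lia.
- rewrite -cA => Y sY leY; rewrite -/N.
  pose X := A :\: (N Y :|: vs e1).
  have cX : #|X| + #|N Y :\: vs e1| + 2 = #|A|.
    have sNY : N Y \subset A by apply: cross_nbC sY.
    have sU : N Y :|: vs e1 \subset A by rewrite subUset sNY.
    rewrite -addnA -c1 -cardsUD cardsD (setIidPr sU) subnK //.
    exact: subset_leq_card.
  have [X0|nz] := eqVneq X set0; first by rewrite X0 cards0 in cX; lia.
  have sX : X \subset A :\: vs e1 by rewrite setDS // subsetUr.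
  have := C3 X sX nz; rewrite -/N => h.
  have := cN X Y (subsetDl _ _) sY; rewrite (disjointWr _ (dD A (N Y :|: vs e1))) ?subsetUl //.
  by move=> /(_ isT); lia.
- move=> Y; rewrite setDE subsetI => /andP[sY sYe] nY; rewrite -/N.
  have := cNY Y sY; have gtY : 0 < #|Y| by rewrite card_gt0.
  pose X := A :\: N Y.
  have := cN X Y (subsetDl _ _) sY (dD _ _).
  have h2 : #|N X :\: vs e2| + #|Y| + 2 <= #|A|.
    have /disjoint_setI0 d0 := nb_compl (dD A (N Y)).
    rewrite cA -c2.
    have -> : #|N X :\: vs e2| + #|Y| + #|vs e2| = #|(N X :|: Y) :|: vs e2|.
      rewrite [RHS]cardsUD setDUl cardsU; congr (_ + _).
      have -> : Y :\: vs e2 = Y by apply/setDidPl; rewrite disjoints_subset.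
      rewrite (_ : _ :&: _ = set0) ?cards0 ?subn0 //.
      by apply/eqP; rewrite -subset0 -d0 setISS ?subsetDl.
    by apply: subset_leq_card; rewrite subUset s2 andbT subUset sY andbT cross_nb // subsetDl.
  (* [nbs_C2] needs two vertices of [A] outside [X]; larger sets are handled by [nbs_C1] or, for [A]
     itself, by its full neighbourhood. *)
  rewrite -/X; case: (leqP (#|X| + 2) #|A|) => [leX|ltX].
    by have := C2 X (subsetDl _ _) leX; rewrite -/N; lia.
  have nz : X != set0 by rewrite -card_gt0; lia.
  have [eA|nA] := eqVneq X A; first by rewrite eA NA -cA; lia.
  by have := C1 _ (subsetDl _ _) nz nA; rewrite -/N -/X; lia.
Qed.

Section DelConnected.
Variables (G : mgraph) (D : {set edge G}).
Hypothesis mcH : matching_covered (del_edges D).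

Lemma del_closed (C : {set vert G}) u v : u \in C ->
  (forall g x y, g \notin D -> x \in C -> joins g x y -> y \in C) -> v \in C.
Proof.
move=> uC cl; case/and3P: mcH => _ cn _.
have /forall_inP/(_ v (in_setT v)) := forall_inP cn u (in_setT u).
move/connect_closed; apply=> // x y xC /= /and3P[_ _ /del_adjP[g gD j]].
exact: cl gD xC j.
Qed.

Lemma del_pm_ex : exists2 M, @perfect_matching G M & [disjoint M & D].
Proof.
case/and3P: (mcH) => /card_gt1P[a [b [_ _ ab]]] _ _.
have [e0|[v /nbP[g [x [gD _ _]]]]] := set_0Vmem (nb D [set a]); last first.
  by have [M pm [_ dj]] := del_mc_adm mcH gD; exists M.
suff : b \in [set a] by rewrite inE eq_sym (negPf ab).
apply: (del_closed (u := a)); rewrite ?inE // => g x y gD xa j.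
by have := nbI gD xa j; rewrite e0 inE.
Qed.

End DelConnected.

Section Halves.
Variables (G : mgraph) (A : {set vert G}) (e1 e2 : edge G).
Hypothesis cr : forall g, g \notin [set e1; e2] ->
                ((ends g).1 \in A) != ((ends g).2 \in A).
Hypothesis mcH : matching_covered (del_edges [set e1; e2]).

Lemma half_le : #|A| <= #|~: A|.
Proof.
have [M pm dj] := del_pm_ex mcH; apply: (pm_card pm) => [|g x v gM xA j].
  exact: subsetT.
by rewrite inE (cross_joins cr (negbT (disjointFr dj gM)) j) xA.
Qed.

End Halves.

Lemma half_eq (G : mgraph) (A : {set vert G}) (e1 e2 : edge G) :
  (forall g, g \notin [set e1; e2] -> ((ends g).1 \in A) != ((ends g).2 \in A)) ->
  matching_covered (del_edges [set e1; e2]) -> #|A| = #|~: A|.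
Proof.
move=> cr mcH; apply/eqP; rewrite eqn_leq (half_le cr) //=.
have := @half_le G (~: A) e1 e2; rewrite setCK; apply=> // g.
by rewrite -setC_flip => /cr.
Qed.

Section Bicritical.
Variables (G : mgraph) (A : {set vert G}) (e1 e2 : edge G).
Hypothesis s1 : vs e1 \subset A.
Hypothesis s2 : vs e2 \subset ~: A.
Hypothesis c1 : #|vs e1| = 2.
Hypothesis c2 : #|vs e2| = 2.
Hypothesis cr : forall g, g \notin [set e1; e2] ->
                ((ends g).1 \in A) != ((ends g).2 \in A).
Hypothesis cA : #|A| = #|~: A|.
Hypothesis bic : bicritical G.

(** Deleting two vertices of [A] leaves the other class with two vertices too many. Only [e2] can
    have both ends there, so it must be used, and using [e1] as well would create a new
    imbalance. *)
Lemma bicritical_half x y : x \in A -> y \in A -> x != y ->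
  exists2 M, pm_on (~: [set x; y]) M & (e2 \in M) /\ (e1 \notin M).
Proof.
move=> xA yA xy; have /existsP[M pm] := bic xy; exists M => //.
have sxy : [set x; y] \subset A by rewrite subUset !sub1set xA.
have cxy : #|[set x; y]| = 2 by rewrite cards2 xy.
have cD : #|A :\: [set x; y]| = #|A| - 2 by rewrite cardsD (setIidPr sxy) cxy.
have ge2 : 2 <= #|A| by rewrite -cxy subset_leq_card.
have sB : ~: A \subset ~: [set x; y] by rewrite setCS.
have nxy g v : g \in M -> v \in vs g -> v \notin [set x; y].
  by move=> /(pm_sub pm)/subsetP h /h; rewrite inE.
have e2M : e2 \in M.
  apply/negPn/negP=> e2M; have := pm_card (Y := A :\: [set x; y]) pm sB.
  rewrite cD -cA; move=> h; suff : #|A| <= #|A| - 2 by move: ge2; clear; lia.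
  apply: h => g v u gM; rewrite inE => vA j.
  have gD : g \notin [set e1; e2].
    rewrite !inE; apply/norP; split; apply: contraNneq e2M => eg; last by rewrite -eg.
    by case/negP: vA; apply: (subsetP s1); rewrite -eg (joins_l j).
  by rewrite inE (cross_joins cr gD j) vA (nxy g) // (joins_r j).
split=> //; apply/negP=> e1M.
have := pm_card (X := ~: A :\: vs e2) (Y := (A :\: [set x; y]) :\: vs e1) pm.
rewrite (subset_trans (subsetDl _ _) sB) => /(_ isT) h.
have se1 : vs e1 \subset A :\: [set x; y].
  by rewrite setDE subsetI s1; apply: (pm_sub pm).
have : #|~: A :\: vs e2| <= #|A :\: [set x; y] :\: vs e1|.
  apply: h => g v u gM; rewrite !in_setD in_setC => /andP[v2 vA] j.
  have ge1 : g != e1.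
    by apply: contraNneq vA => eg; apply: (subsetP s1); rewrite -eg (joins_l j).
  have gD : g \notin [set e1; e2].
    rewrite !inE (negPf ge1) /=; apply: contraNneq v2 => eg.
    by rewrite -eg (joins_l j).
  rewrite (cross_joins cr gD j) vA (nxy g) ?(joins_r j) // !andbT.
  apply: contra ge1 => u1; apply/eqP; apply: (pm_uniq pm _ gM e1M (joins_r j) u1).
  by rewrite in_setC (nxy g) ?(joins_r j).
have := subset_leq_card se1.
by rewrite !cardsD (setIidPr s2) -cardsD (setIidPr se1) c1 c2 cD -cA; move: ge2; clear; lia.
Qed.

Lemma bicritical_C2 (X : {set vert G}) : X \subset A -> #|X| + 2 <= #|A| ->
  #|X| <= #|nb [set e1; e2] X :\: vs e2|.
Proof.
move=> sX leX.
have : 1 < #|A :\: X| by rewrite cardsD (setIidPr sX); lia.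
case/card_gt1P=> x [y [/setDP[xA xX] /setDP[yA yX] xy]].
have [M pm [e2M e1M]] := bicritical_half xA yA xy.
have sXS : X \subset ~: [set x; y].
  apply/subsetP=> v vX; rewrite !inE negb_or.
  by apply/andP; split; apply: contraTneq vX => ->.
apply: (pm_card pm sXS) => g v u gM vX j.
have vA := subsetP sX _ vX.
have ge2 : g != e2.
  apply: contraTneq vA => eg; have := subsetP s2 v; rewrite -eg (joins_l j) inE.
  exact.
have gD : g \notin [set e1; e2].
  by rewrite !inE (negPf ge2) orbF; apply: contraNneq e1M => <-.
rewrite inE (nbI gD vX j) andbT; apply: contra ge2 => u2; apply/eqP.
have uS : u \in ~: [set x; y] by apply: (subsetP (pm_sub pm gM)); apply: joins_r j.
exact: (pm_uniq pm uS gM e2M (joins_r j) u2).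
Qed.

End Bicritical.

Section Intro.
Variables (G : mgraph) (A : {set vert G}) (e1 e2 : edge G).
Hypothesis ll : loopless G.
Hypothesis s1 : vs e1 \subset A.
Hypothesis s2 : vs e2 \subset ~: A.
Hypothesis cr : forall g, g \notin [set e1; e2] ->
                ((ends g).1 \in A) != ((ends g).2 \in A).
Hypothesis bic : bicritical G.
Hypothesis mcH : matching_covered (del_edges [set e1; e2]).

(** If [X] had no surplus, every perfect matching of the bipartite graph would match it onto its
    neighbourhood. An edge from there to a vertex outside [X] would lie in none of them, so [X] and
    its neighbours would be closed under adjacency. *)
Lemma mc_C1 (X : {set vert G}) : X \subset A -> X != set0 -> X != A ->
  #|X| < #|nb [set e1; e2] X|.
Proof.
move=> sX /set0Pn[x0 x0X] nX; rewrite ltnNge; apply/negP=> leN.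
have /properP[_ [z zA zX]] : X \proper A by rewrite properEneq nX.
have sN := cross_nb cr sX.
have : z \in X :|: nb [set e1; e2] X.
  apply: (del_closed mcH (u := x0)); first by rewrite inE x0X.
  move=> g u v gD; rewrite inE => /orP[uX|uN] j; first by rewrite inE (nbI gD uX j) orbT.
  rewrite inE; apply/orP; left; apply: contraLR leN => vX; rewrite -ltnNge.
  have [M pm [gM dj]] := del_mc_adm mcH gD.
  have -> : #|nb [set e1; e2] X| = #|nb [set e1; e2] X :\ u|.+1.
    by rewrite (cardsD1 u) uN.
  rewrite ltnS; apply: (pm_card pm) => [|h x w hM xX jh]; first exact: subsetT.
  rewrite !in_setD1 (nbI (negbT (disjointFr dj hM)) xX jh) andbT.
  apply: contraNneq vX => ew; rewrite ew in jh.
  have eh : h = g by apply: (pm_uniq pm (in_setT u)) => //; rewrite ?(joins_r jh) ?(joins_l j).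
  by rewrite eh joinsC in jh; rewrite -(joins_injr jh j).
rewrite inE (negPf zX) /= => /(subsetP sN); rewrite inE zA; by [].
Qed.

Lemma vs_card (e : edge G) : #|vs e| = 2.
Proof. by rewrite cards2 ll. Qed.

Lemma nbs_intro : 6 <= #|vert G| -> nbs A e1 e2.
Proof.
move=> ge6; have cA := half_eq cr mcH.
have ge3 : 3 <= #|A| by have := cardsC A; rewrite -cA; move: ge6; clear; lia.
split; rewrite ?vs_card //; first exact: mc_C1.
  by apply: bicritical_C2; rewrite ?vs_card.
move=> X; rewrite setDE subsetI => /andP[sX sXe] nX.
have nXA : X != A.
  apply: contraTneq sXe => ->; apply/subsetPn; exists (ends e1).1.
    by apply: (subsetP s1); rewrite !inE eqxx.
  by rewrite !inE eqxx.
have lt := mc_C1 sX nX nXA.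
have gt0 : 0 < #|X| by rewrite card_gt0.
have /card_gt1P[x [y [xN yN xy]]] : 1 < #|nb [set e1; e2] X| by apply: leq_trans lt.
have sN := cross_nb cr sX.
have cr' g : g \notin [set e2; e1] -> ((ends g).1 \in ~: A) != ((ends g).2 \in ~: A).
  by rewrite -setC_flip setUC => /cr.
have s1' : vs e1 \subset ~: ~: A by rewrite setCK.
have cA' : #|~: A| = #|~: ~: A| by rewrite setCK.
have [M pm [e1M e2M]] := bicritical_half s2 s1' (vs_card e2) (vs_card e1) cr' cA' bic
   (subsetP sN _ xN) (subsetP sN _ yN) xy.
have sXS : X \subset ~: [set x; y].
  apply/subsetP=> v vX; rewrite in_setC; apply/negP=> vxy.
  have := subsetP sN v; rewrite in_setC (subsetP sX _ vX) => h.
  suff /h : v \in nb [set e1; e2] X by [].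
  by case/set2P: vxy => ->.
have : #|X| <= #|nb [set e1; e2] X :\: [set x; y]|.
  apply: (pm_card pm sXS) => g v u gM vX j.
  have gD : g \notin [set e1; e2].
    rewrite !inE; apply/norP; split; last by apply: contraNneq e2M => <-.
    apply/eqP=> eg; have := subsetP sXe _ vX; rewrite inE -eg (joins_l j); by [].
  rewrite in_setD (nbI gD vX j) andbT.
  have := subsetP (pm_sub pm gM) _ (joins_r j); by rewrite in_setC.
have sxy : [set x; y] \subset nb [set e1; e2] X by rewrite subUset !sub1set xN.
have := subset_leq_card sxy.
by rewrite cardsD (setIidPr sxy) cards2 xy; clear; lia.
Qed.

End Intro.

(** One of [e1], [e2] has both ends in one class, since otherwise [G] is bipartite; up to symmetry
    it is [e1] in [A]. A perfect matching through [e1] then leaves too few vertices of [A] for the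
    other class, so [e2] lies in that class. *)
Lemma nbs_of_near_bipartite_brick (G : mgraph) :
  loopless G -> bicritical G -> near_bipartite G -> 6 <= #|vert G| ->
  exists A e1 e2, @nbs G A e1 e2.
Proof.
move=> ll bic [nbip [mcG [e1 [e2 [ne [bip mcH]]]]]] ge6.
have [A] : exists A : {set vert G}, forall g, g \notin [set e1; e2] ->
    ((ends g).1 \in A) != ((ends g).2 \in A).
  case: bip => A cr0; exists A => g gD.
  exact: (cr0 (Sub g gD : edge (del_edges [set e1; e2]))).
clear bip.
wlog n1 : e1 e2 ne mcH / ((ends e1).1 \in A) == ((ends e1).2 \in A).
  move=> wl cr.
  case: (eqVneq ((ends e1).1 \in A) ((ends e1).2 \in A)) => [e|c1].
    by apply: (wl e1 e2) => //; apply/eqP.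
  case: (eqVneq ((ends e2).1 \in A) ((ends e2).2 \in A)) => [e|c2].
    by apply: (wl e2 e1); rewrite 1?eq_sym // 1?setUC //; apply/eqP.
  case: nbip; exists A => g; have [gD|] := boolP (g \in [set e1; e2]); last exact: cr.
  by move: gD; rewrite !inE => /orP[]/eqP->.
wlog s1 : A n1 / vs e1 \subset A.
  move=> wl cr; case: (boolP ((ends e1).1 \in A)) => h.
    by apply: (wl A) => //; rewrite subUset !sub1set -(eqP n1) h.
  apply: (wl (~: A)).
  - by rewrite !in_setC (eqP n1).
  - by rewrite subUset !sub1set !in_setC -(eqP n1) h.
  - by move=> g /cr; rewrite -setC_flip.
move=> cr; exists A, e1, e2.
have cA := half_eq cr mcH.
apply: nbs_intro => //.
case/and3P: mcG => _ _ /forallP/(_ e1)/existsP[M /andP[pm e1M]].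
apply/negPn/negP=> ns2.
have : #|~: A| <= #|A :\: vs e1|.
  apply: (pm_card pm) => [|g x v gM xA j]; first exact: subsetT.
  rewrite inE in xA.
  have ge1 : g != e1.
    by apply: contraNneq xA => eg; apply: (subsetP s1); rewrite -eg (joins_l j).
  rewrite inE; apply/andP; split.
    apply: contra ge1 => v1; apply/eqP.
    exact: (pm_uniq pm (in_setT v) gM e1M (joins_r j) v1).
  have [eg|ge2] := eqVneq g e2.
    apply: contraNT ns2 => vA; rewrite -eg (joins_vs j).
    by rewrite subUset !sub1set !inE xA.
  by rewrite (cross_joins cr _ j) // !inE (negPf ge1).
have c1 : #|vs e1| = 2 by rewrite cards2 ll.
have := subset_leq_card s1; rewrite cardsD (setIidPr s1) -cA c1; clear; lia.
Qed.

Lemma setC_DD (T : finType) (A E F : {set T}) : E \subset A -> F \subset ~: A ->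
  ~: (A :\: E :|: ~: A :\: F) = E :|: F.
Proof.
move=> /subsetP sE /subsetP sF; apply/setP=> v; rewrite !inE.
have := sE v; have := sF v; rewrite inE.
case: (v \in E) => [_ /(_ isT)->|]; case: (v \in F) => //.
  by move=> /(_ isT) /negPf->.
by case: (v \in A).
Qed.

(** * Nonremovable edges *)

Section Core.
Variables (G : mgraph) (A : {set vert G}) (e1 e2 : edge G).
Hypothesis HN : nbs A e1 e2.
Implicit Types (X Y Z V S T : {set vert G}) (M : {set edge G}).
Implicit Types (e f g h : edge G) (a b c d u v x y : vert G).
Local Notation D := [set e1; e2].
Local Notation N := (nb [set e1; e2]).
Local Notation Ne e := (nb (e |: [set e1; e2])).

Let s1 := nbs_e1 HN. Let s2 := nbs_e2 HN.
Let cr := nbs_cross HN. Let cA := nbs_card HN.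
Let C1 := nbs_C1 HN. Let C2 := nbs_C2 HN. Let C3 := nbs_C3 HN.

Lemma e1_neq_e2 : e1 != e2.
Proof.
apply/eqP=> e12; have := nbs_e2 HN; rewrite -e12 => s.
have h : (ends e1).1 \in vs e1 by rewrite !inE eqxx.
by have := subsetP s _ h; rewrite inE (subsetP s1 _ h).
Qed.

Lemma nbs_C1B Y : Y \subset ~: A -> Y != set0 -> Y != ~: A -> #|Y| < #|N Y|.
Proof. by move=> ? ? ?; rewrite setUC; apply: (nbs_C1 (nbs_sym HN)). Qed.

Lemma nbs_C3B Y : Y \subset ~: A :\: vs e2 -> Y != set0 -> #|Y| + 2 <= #|N Y|.
Proof. by move=> ? ?; rewrite setUC; apply: (nbs_C3 (nbs_sym HN)). Qed.

Lemma N_sub X : X \subset A -> N X \subset ~: A.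
Proof. exact: cross_nb cr _. Qed.

Lemma joinsB e a b : e \notin D -> joins e a b -> a \in A -> b \notin A.
Proof. by move=> eD j aA; rewrite (cross_joins cr eD j) aA. Qed.

Lemma joinsA e a b : e \notin D -> joins e a b -> b \notin A -> a \in A.
Proof. by move=> eD j; rewrite (cross_joins cr eD j) negbK. Qed.

Lemma edge_ends e : e \notin D -> exists a b, [/\ joins e a b, a \in A & b \notin A].
Proof.
move=> eD; have j := joins_ends e; case aA: ((ends e).1 \in A).
  by exists (ends e).1, (ends e).2; split=> //; apply: joinsB j _.
exists (ends e).2, (ends e).1; rewrite joinsC; split=> //; last by rewrite aA.
by rewrite (cross_joins cr eD j) aA.
Qed.

Lemma Ne_sub e X : Ne e X \subset N X.
Proof.
apply/subsetP=> v /nbP[g [x [gD xX j]]]; apply: nbI xX j.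
by apply: contra gD; rewrite !inE => ->; rewrite orbT.
Qed.

Lemma N_Ne e a b X v : e \notin D -> joins e a b -> a \in A -> X \subset A ->
  v \in N X -> v \notin Ne e X -> v = b /\ a \in X.
Proof.
move=> eD j aA sX /nbP[g [x [gD xX jx]]] vN.
have [eg|ge] := eqVneq g e; last first.
  by case/negP: vN; apply: nbI xX jx; rewrite in_setU1 negb_or ge gD.
have xa : x = a.
  have := joins_l jx; rewrite eg (joins_vs j) !inE => /orP[/eqP//|/eqP xb].
  by have := subsetP sX _ xX; rewrite xb (negPf (joinsB eD j aA)).
by split; [rewrite xa eg in jx; apply: (joins_injr jx j) | rewrite -xa].
Qed.

Lemma N_le_Ne e a b X : e \notin D -> joins e a b -> a \in A -> X \subset A ->
  #|N X| <= #|Ne e X|.+1.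
Proof.
move=> eD j aA sX; rewrite -add1n -(cards1 b).
rewrite (leq_trans (subset_leq_card (_ : N X \subset [set b] :|: Ne e X))) //.
  apply/subsetP=> v vN; rewrite in_setU; case vE: (v \in Ne e X); first by rewrite orbT.
  by have [->] := N_Ne eD j aA sX vN (negbT vE); rewrite inE eqxx.
by rewrite cardsU leq_subr.
Qed.

Lemma Ne_ge e X : e \notin D -> X \subset A -> #|X| <= #|Ne e X|.
Proof.
move=> eD sX; have [a [b [j aA bA]]] := edge_ends eD.
have [->|nX] := eqVneq X set0; first by rewrite cards0.
have [XA|nXA] := eqVneq X A; last first.
  by rewrite -ltnS (leq_trans (C1 sX nX nXA)) // (N_le_Ne eD j).
(* [A] has no surplus to spend; but all its neighbours are already seen from [A] without the end [a]
   of [e], hence without using [e]. *)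
rewrite XA; have ge3 := nbs_ge3 HN.
have cD := cardsD1 a A; rewrite aA in cD.
have nz : A :\ a != set0 by rewrite -card_gt0; move: ge3 cD; clear; lia.
have ne : A :\ a != A by apply/eqP=> /setP/(_ a); rewrite !inE eqxx aA.
have := C1 (subsetDl _ _) nz ne.
have : #|N (A :\ a)| <= #|Ne e A|.
  apply/subset_leq_card/subsetP=> v vN; have [//|vE] := boolP (v \in Ne e A).
  have [] := N_Ne eD j aA (subsetDl A [set a]) vN; last by rewrite !inE eqxx.
  by apply: contra vE => /(subsetP (nbS _ (subsetDl A [set a]))).
by move: cD; clear; lia.
Qed.

(** With [e2] but not [e1], all of [A] would have to be matched into the opposite class minus the
    two ends of [e2]. *)
Lemma pm_e2_e1 M : perfect_matching M -> e2 \in M -> e1 \in M.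
Proof.
move=> pm e2M; apply/negPn/negP=> e1M.
have : #|A| <= #|~: A :\: vs e2|.
  apply: (pm_card pm) => [|g x v gM xA j]; first exact: subsetT.
  have ge2 : g != e2.
    apply: contraTneq xA => eg; have := subsetP s2 x; rewrite -eg (joins_l j) inE.
    exact.
  have gD : g \notin D by rewrite !inE (negPf ge2) orbF; apply: contraNneq e1M => <-.
  rewrite inE in_setC (joinsB gD j xA) andbT; apply: contra ge2 => v2.
  by apply/eqP; apply: (pm_uniq pm (in_setT v) gM e2M (joins_r j) v2).
have := subset_leq_card s2; rewrite cardsD (setIidPr s2) -cA (nbs_c2 HN).
have := nbs_ge3 HN; clear; lia.
Qed.

Lemma hall_ext e S T M1 : S \subset A -> T \subset ~: A -> #|S| = #|T| ->
  pm_on (~: (S :|: T)) M1 -> e \notin M1 ->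
  (forall X, X \subset S -> #|X| <= #|Ne e X :&: T|) ->
  exists2 M, perfect_matching M & M1 \subset M /\ e \notin M.
Proof.
move=> sS sT cST pm1 eM1 hS.
have dST : [disjoint S & T].
  rewrite disjoints_subset (subset_trans sS) // -[A]setCK setCS //.
have [M pm dj] := hall_pm dST cST hS.
have pmU : pm_on (~: (S :|: T) :|: (S :|: T)) (M1 :|: M).
  apply: pm_union => //; by rewrite disjoints_subset subxx.
exists (M1 :|: M); first by move: pmU; rewrite setUC setUCr.
rewrite subsetUl; split=> //; rewrite inE negb_or eM1.
by rewrite (disjointFl dj) // !inE eqxx.
Qed.

(** This is how nonremovability is exploited: if every perfect matching containing [M1] uses [e],
    Hall's condition for the uncovered vertices fails once [e] is deleted. *)
Lemma hall_viol e S T M1 : S \subset A -> T \subset ~: A -> #|S| = #|T| ->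
  pm_on (~: (S :|: T)) M1 -> e \notin M1 ->
  (forall M, perfect_matching M -> M1 \subset M -> e \in M) ->
  exists2 X : {set vert G}, X \subset S & #|Ne e X :&: T| < #|X|.
Proof.
move=> sS sT cST pm1 eM1 no.
case: (boolP [exists X : {set vert G}, (X \subset S) && (#|Ne e X :&: T| < #|X|)]).
  by case/existsP=> X /andP[sX lt]; exists X.
rewrite negb_exists => /forallP h.
have [X sX|M pm [sM eM]] := hall_ext sS sT cST pm1 eM1.
  by have := h X; rewrite sX -leqNgt.
by rewrite (no M pm sM) in eM.
Qed.

Definition forced1 e := forall M, perfect_matching M -> e1 \in M -> e \in M.

Lemma dis12 : [disjoint vs e1 & vs e2].
Proof.
rewrite disjoints_subset (subset_trans s1) // -[A]setCK setCS //.
Qed.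

Lemma pm_e12 : pm_on (vs e1 :|: vs e2) D.
Proof. by apply: pm_union; rewrite ?pm_single ?dis12. Qed.

Lemma cardAe1 : #|A :\: vs e1| + 2 = #|A|.
Proof.
have := subset_leq_card s1; rewrite cardsD (setIidPr s1) (nbs_c1 HN); clear; lia.
Qed.

Lemma cardBe2 : #|~: A :\: vs e2| + 2 = #|A|.
Proof.
have := subset_leq_card s2; rewrite cardsD (setIidPr s2) (nbs_c2 HN) -cA; clear; lia.
Qed.

(** A certificate that [e] is forced by [e1]: a perfect matching through [e1] uses [e2] as well,
    hence matches [X] onto its neighbours outside [e2]; one of them is [b], and [e] is the only edge
    from [X] to [b]. *)
Record k1set e a b X : Prop := K1set {
  k1_sub : X \subset A :\: vs e1;
  k1_in : a \in X;
  k1_card : #|N X| = #|X| + 2;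
  k1_e2 : vs e2 \subset N X;
  k1_b : b \notin vs e2;
  k1_un : b \notin Ne e X }.

(** By [nbs_C2] the Hall violator has at least [#|X|] neighbours outside [e2], so deleting [e] must
    have cost the neighbour [b]. Then exactly [#|X|] neighbours lie outside [e2], and [nbs_C3]
    forces both ends of [e2] among the others. *)
Lemma forced1_set e a b : e \notin D -> joins e a b -> a \in A -> forced1 e ->
  exists X, k1set e a b X.
Proof.
move=> eD j aA fe.
have compl : ~: (A :\: vs e1 :|: ~: A :\: vs e2) = vs e1 :|: vs e2.
  exact: setC_DD.
have [||||||X sX lt] := @hall_viol e (A :\: vs e1) (~: A :\: vs e2) D.
- exact: subsetDl.
- exact: subsetDl.
- by apply/eqP; rewrite -(eqn_add2r 2) cardAe1 cardBe2.
- rewrite compl; exact: pm_e12.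
- by [].
- by move=> M pm; rewrite subUset !sub1set => /andP[h1 _]; apply: fe.
have sXA : X \subset A := subset_trans sX (subsetDl _ _).
have leX := subset_leq_card sX; have cAe := cardAe1.
have h2 : #|X| <= #|N X :\: vs e2| by apply: C2 => //; move: leX cAe; clear; lia.
have gt0 : 0 < #|X| by apply: leq_ltn_trans lt.
have h3 : #|X| + 2 <= #|N X| by apply: C3; rewrite // -card_gt0.
have sNB := N_sub sXA.
have [v vN vE] : exists2 v, v \in N X :\: vs e2 & v \notin Ne e X.
  apply/subsetPn; apply/negP=> /subsetP s; have := leq_trans lt h2.
  rewrite ltnNge; case/negP; apply/subset_leq_card/subsetP=> v vN; rewrite inE s //.
  by case/setDP: vN => vN v2; rewrite inE v2 (subsetP sNB).
have [vN0 v2] := setDP vN; have [vb aX] := N_Ne eD j aA sXA vN0 vE; subst v.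
have eX : #|N X :\: vs e2| = #|X|.
  apply/eqP; rewrite eqn_leq h2 andbT.
  have : N X :\: vs e2 :\ b \subset Ne e X :&: (~: A :\: vs e2).
    apply/subsetP=> v /setD1P[nvb /setDP[vNX v2']].
    rewrite in_setI in_setD v2' (subsetP sNB) // !andbT.
    apply/negPn/negP=> vE'; have [evb _] := N_Ne eD j aA sXA vNX vE'.
    by rewrite evb eqxx in nvb.
  move/subset_leq_card; rewrite (cardsD1 b (N X :\: vs e2)) vN; move: lt; clear; lia.
have cI : #|N X :&: vs e2| = 2.
  have := subset_leq_card (subsetIr (N X) (vs e2)).
  by have := cardsID (vs e2) (N X); rewrite eX (nbs_c2 HN); move: h3; clear; lia.
exists X; split=> //.
  by have := cardsID (vs e2) (N X); rewrite eX cI addnC.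
by apply/setIidPr/eqP; rewrite eqEcard subsetIr cI (nbs_c2 HN).
Qed.

(** A component [C] of [G - e] contains equally many vertices of both classes. If it contains some
    but not all of [A], the surplus in [nbs_C1] is lost to [e] both inside and outside [C], so the
    end [a] would lie on both sides. *)
Lemma del1_connected e : e \notin D -> connectedG (del_edges [set e]).
Proof.
move=> eD; have [a [b [j aA bA]]] := edge_ends eD.
apply/forall_inP=> u _; apply/forall_inP=> v _.
pose r : rel (vert G) := fun x y => [exists g, (g != e) && joins g x y].
suff : connect r u v.
  apply: connect_sub => x y /existsP[g /andP[ge jx]]; apply: connect1 => /=.
  by rewrite !inE /=; apply/del_adjP; exists g; rewrite ?inE.
have [C inC] : exists C : {set vert G}, forall w, (w \in C) = connect r u w.
  by exists [set w | connect r u w] => w; rewrite inE.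
rewrite -inC.
have cl g x y : g != e -> x \in C -> joins g x y -> y \in C.
  rewrite !inC => ge ux jx; apply: connect_trans ux (connect1 _).
  by apply/existsP; exists g; rewrite ge.
have clE g x y : g \notin e |: D -> x \in C -> joins g x y -> y \in C.
  by rewrite in_setU1 negb_or => /andP[ge _]; apply: cl.
have n1 : #|Ne e (C :&: A)| <= #|C :\: A|.
  apply/subset_leq_card/subsetP=> v' wN.
  have := subsetP (N_sub (subsetIr C A)) _ (subsetP (Ne_sub e _) _ wN).
  rewrite in_setC in_setD => ->; case/nbP: wN => g [x [gD /setIP[xC _] jx]].
  exact: (clE _ _ _ gD xC jx).
have n2 : #|Ne e (A :\: C)| <= #|~: A :\: C|.
  apply/subset_leq_card/subsetP=> v' wN.
  have := subsetP (N_sub (subsetDl A C)) _ (subsetP (Ne_sub e _) _ wN).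
  rewrite in_setC inE => wA; rewrite in_setC wA andbT.
  case/nbP: wN => g [x [gD /setDP[_ xC] jx]]; apply: contra xC => wC.
  by apply: (clE _ _ _ gD wC); rewrite joinsC.
have h1 := leq_trans (Ne_ge eD (subsetIr C A)) n1.
have h2 := leq_trans (Ne_ge eD (subsetDl A C)) n2.
have := cardsID C A; have := cardsID C (~: A).
have eI : #|~: A :&: C| = #|C :\: A| by rewrite setIC setDE.
rewrite eI -cA setIC => k1 k2.
have e1' : #|C :&: A| = #|C :\: A| by move: h1 h2 k1 k2; clear; lia.
have e2' : #|A :\: C| = #|~: A :\: C| by move: h1 h2 k1 k2; clear; lia.
have uC : u \in C by rewrite inC connect0.
have nz : C :&: A != set0.
  rewrite -card_gt0 lt0n; apply/negP=> /eqP z; rewrite z in e1'.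
  have : u \in (C :&: A) :|: (C :\: A) by rewrite setID.
  by rewrite (cards0_eq z) (cards0_eq (esym e1')) !inE.
have [AC|nA] := eqVneq (C :&: A) A.
  have z : #|A :\: C| = 0.
    by apply/eqP; rewrite cards_eq0 setD_eq0 -AC subsetIl.
  rewrite z in e2'; have := cards0_eq (esym e2') => /eqP; rewrite setD_eq0 => sB.
  have [vA|vB] := boolP (v \in A); first by rewrite -AC in vA; case/setIP: vA.
  by apply: (subsetP sB); rewrite inE.
have lt := C1 (subsetIr C A) nz nA.
have aC : a \in C.
  have [v' vN vE] : exists2 v', v' \in N (C :&: A) & v' \notin Ne e (C :&: A).
    apply/subsetPn; apply/negP=> /subset_leq_card le.
    move: lt le e1' n1; clear; lia.
  by have [_ /setIP[]] := N_Ne eD j aA (subsetIr C A) vN vE.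
have nz2 : A :\: C != set0.
  apply: contraNneq nA => z; apply/eqP/setIidPr; rewrite -setD_eq0; exact/eqP.
have nA2 : A :\: C != A.
  by apply: contraTneq aC => eA; move: aA; rewrite -eA => /setDP[].
have lt2 := C1 (subsetDl A C) nz2 nA2.
have [v' vN vE] : exists2 v', v' \in N (A :\: C) & v' \notin Ne e (A :\: C).
  apply/subsetPn; apply/negP=> /subset_leq_card le.
  move: lt2 le e2' n2; clear; lia.
by have [_ /setDP[_ /negP]] := N_Ne eD j aA (subsetDl A C) vN vE.
Qed.

Lemma removable_intro e : e \notin D ->
  (forall f, f != e -> exists2 M, perfect_matching M & f \in M /\ e \notin M) ->
  removable e.
Proof.
move=> eD h; apply/and3P; split; last 1 first.
- apply/forallP=> f.
  have [|M pm [fM eM]] := h (val f); first by have := valP f; rewrite inE.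
  have dj : [disjoint M & [set e]].
    rewrite disjoints_subset; apply/subsetP=> g gM; rewrite !inE.
    by apply: contraNneq eM => <-.
  apply/existsP; exists [set g | val g \in M].
  by rewrite (del_pm_preim pm dj) inE fM.
- have ge3 := nbs_ge3 HN; have := cardsC A; rewrite /= -cA.
  have -> : #|vert (del_edges [set e])| = #|vert G| by [].
  by move: ge3; clear; lia.
- exact: del1_connected.
Qed.
End Core.

Section Tight.
Variables (G : mgraph) (A : {set vert G}) (e1 e2 : edge G).
Hypothesis HN : nbs A e1 e2.
Implicit Types (X Y Z V S T : {set vert G}) (M : {set edge G}).
Implicit Types (e f g h : edge G) (a b c d u v x y : vert G).
Local Notation D := [set e1; e2].
Local Notation N := (nb [set e1; e2]).
Local Notation Ne e := (nb (e |: [set e1; e2])).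

Let s1 := nbs_e1 HN. Let s2 := nbs_e2 HN.
Let cr := nbs_cross HN. Let cA := nbs_card HN.
Let C1 := nbs_C1 HN. Let C2 := nbs_C2 HN. Let C3 := nbs_C3 HN.

Lemma pm_e1_e2 M : perfect_matching M -> e1 \in M -> e2 \in M.
Proof. exact: pm_e2_e1 (nbs_sym HN) _. Qed.

(** [X] has no surplus once [e] is deleted. In the bipartite graph, [e] is then the only edge from
    [X] to the vertices outside [Ne e X]; these vertices and the rest of [A] are called [Qt] and
    [Pt] below. *)
Record tight e a b X : Prop := Tight {
  t_D : e \notin D;
  t_j : joins e a b;
  t_sub : X \subset A;
  t_in : a \in X;
  t_card : #|Ne e X| = #|X|;
  t_un : b \notin Ne e X;
  t_ne : X != A }.

(** An edge [g] entering [Ne e X] from outside [X] takes a partner away from [X], so that [e] is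
    needed. [k2_no] is recorded for all perfect matchings, since [k2_V] uses it for those through
    [e1] and [e2]. *)
Record k2set e a b X g c w : Prop := K2set {
  k2_tight : tight e a b X;
  k2_gD : g \notin D;
  k2_ge : g != e;
  k2_j : joins g c w;
  k2_c : c \in A :\: X;
  k2_w : w \in Ne e X;
  k2_no : forall M, perfect_matching M -> g \in M -> e \in M }.

(** Some [f] occurs in perfect matchings only together with [e]. It is neither [e1] nor [e2], as [e]
    is not forced, so its ends lie in different classes and Hall's theorem for the remaining
    vertices yields the tight set. *)
Lemma nonremovable_k2 e a b : e \notin D -> joins e a b -> a \in A ->
  ~~ removable e -> ~ forced1 e1 e -> exists X g c w, k2set e a b X g c w.
Proof.
move=> eD j aA nr nf.
have [f nfe ff] : exists2 f, f != e &
    forall M, perfect_matching M -> f \in M -> e \in M.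
  case: (boolP [exists f : edge G, (f != e) &&
      [forall M : {set edge G}, perfect_matching M ==> (f \in M) ==> (e \in M)]]).
    case/existsP=> f /andP[nfe /forallP h]; exists f => // M pm fM.
    by have := h M; rewrite pm fM.
  rewrite negb_exists => /forallP h; case/negP: nr; apply: (removable_intro HN) => // f nfe.
  have := h f; rewrite nfe /= negb_forall => /existsP[M].
  by rewrite !negb_imply => /and3P[pm fM eM]; exists M.
have f1 : f != e1 by apply/eqP=> E; case: nf => M pm; rewrite -E; apply: ff.
have f2 : f != e2.
  by apply/eqP=> E; case: nf => M pm /(pm_e1_e2 pm); rewrite -E; apply: ff.
have fD : f \notin D by rewrite !inE negb_or f1.
have [c [w [jf cAA wA]]] := edge_ends HN fD.
have compl : ~: (A :\ c :|: ~: A :\ w) = vs f.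
  by rewrite setC_DD ?(joins_vs jf) // sub1set // inE.
have [||||||X sX lt] := @hall_viol _ A e1 e2 e (A :\ c) (~: A :\ w) [set f].
- exact: subsetDl.
- exact: subsetDl.
- by have := cardsD1 c A; have := cardsD1 w (~: A); rewrite cAA -cA inE wA; clear; lia.
- rewrite compl; exact: pm_single.
- by rewrite inE eq_sym.
- by move=> M pm; rewrite sub1set; apply: ff.
have [sXA cX] : X \subset A /\ c \notin X.
  split; first exact: subset_trans sX (subsetDl _ _).
  by apply/negP=> /(subsetP sX); rewrite !inE eqxx.
have ge := Ne_ge HN eD sXA.
have sNe : Ne e X \subset ~: A := subset_trans (Ne_sub _ _ _ _) (N_sub HN sXA).
have wN : w \in Ne e X.
  apply/negPn/negP=> wN; have := leq_trans lt ge; rewrite ltnNge; case/negP.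
  apply/subset_leq_card/subsetP=> v vN; rewrite in_setI vN in_setD1 (subsetP sNe) // andbT.
  by apply: contraNneq wN => <-.
have cNe : #|Ne e X| = #|X|.
  apply/eqP; rewrite eqn_leq ge andbT (cardsD1 w) wN.
  apply: leq_trans lt; rewrite ltnS; apply/subset_leq_card/subsetP=> v /setD1P[vw vN].
  by rewrite in_setI vN in_setD1 vw (subsetP sNe).
have nX : X != set0 by rewrite -card_gt0; apply: leq_ltn_trans lt.
have nXA : X != A by apply: contraNneq cX => ->.
have [v vN vE] : exists2 v, v \in N X & v \notin Ne e X.
  apply/subsetPn; apply/negP=> /subset_leq_card; rewrite cNe leqNgt.
  by rewrite (C1 sXA nX nXA).
have [vb aX] := N_Ne HN eD j aA sXA vN vE; subst v.
by exists X, f, c, w; split=> //; rewrite inE cX.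
Qed.

Section OneTight.
Variables (e : edge G) (a b : vert G) (X : {set vert G}).
Hypothesis tX : tight e a b X.

Let eD := t_D tX. Let j := t_j tX. Let sX := t_sub tX. Let aX := t_in tX.
Let aA : a \in A := subsetP sX _ aX.

Definition Pt := A :\: X.
Definition Qt := ~: A :\: Ne e X.

Lemma tight_b : b \in Qt.
Proof. by rewrite in_setD (t_un tX) inE (joinsB HN eD j aA). Qed.

Lemma tight_cardPQ : #|Pt| = #|Qt|.
Proof.
have sNe : Ne e X \subset ~: A := subset_trans (Ne_sub _ _ _ _) (N_sub HN sX).
by rewrite !cardsD (setIidPr sX) (setIidPr sNe) (t_card tX) cA.
Qed.

Lemma tight_NQ : N Qt \subset a |: Pt.
Proof.
apply/subsetP=> v /nbP[g [x [gD /setDP[xB xN] jx]]].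
have vA : v \in A by move: xB; rewrite inE (cross_joins cr gD jx).
rewrite in_setU1 in_setD vA andbT; case vX: (v \in X); rewrite ?orbT ?orbF //.
apply/eqP; have jx' : joins g v x by rewrite joinsC.
have [eg|ge] := eqVneq g e.
  have := joins_r jx; rewrite eg (joins_vs j) !inE => /orP[/eqP//|/eqP vb].
  by move: vA; rewrite vb (negPf (joinsB HN eD j aA)).
by case/negP: xN; apply: nbI vX jx'; rewrite in_setU1 negb_or ge.
Qed.

Lemma tight_un g v : g \notin D -> v \in X -> joins g v b -> g = e.
Proof.
move=> gD vX jg; apply/eqP; apply: contraNT (t_un tX) => ge.
by apply: nbI vX jg; rewrite in_setU1 negb_or ge.
Qed.

Lemma tight_N1 V : V \subset X -> a \notin V -> b \notin N V.
Proof.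
move=> sV aV; apply/negP=> /nbP[g [x [gD xV jx]]].
have eg := tight_un gD (subsetP sV _ xV) jx; rewrite eg in jx.
by case/negP: aV; rewrite -(joins_inj jx j).
Qed.

Lemma tight_cardN : #|N X| = #|X|.+1.
Proof.
apply/eqP; rewrite eqn_leq (C1 sX _ (t_ne tX)) ?andbT; last by apply/set0Pn; exists a.
by rewrite -(t_card tX) (N_le_Ne HN eD j).
Qed.

(** Otherwise [nbs_C3B] gives [Qt] a surplus of two, while its neighbours lie in [Pt] together with
    [a], which allows a surplus of one at most. *)
Lemma tight_Qe2 : exists2 v, v \in vs e2 & v \in Qt.
Proof.
apply/exists_inP; case: (boolP [exists x in vs e2, x \in Qt]) => // /exists_inPn no.
have sQ : Qt \subset ~: A :\: vs e2.
  apply/subsetP=> v vQ; rewrite in_setD (subsetP (subsetDl _ _) _ vQ) andbT.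
  by apply/negP=> v2; have := no v v2; rewrite vQ.
have nQ : Qt != set0 by apply/set0Pn; exists b; apply: tight_b.
have := nbs_C3B HN sQ nQ; have := subset_leq_card tight_NQ.
have := cardsU [set a] Pt; rewrite cards1 tight_cardPQ; clear; lia.
Qed.

Lemma tight_NX v : v \notin A -> v \notin Qt -> v \in N X.
Proof.
by move=> vA; rewrite in_setD in_setC vA andbT negbK; apply: (subsetP (Ne_sub _ _ _ _)).
Qed.

End OneTight.

Section TwoTight.
Variables (e e' : edge G) (a b b' : vert G) (X X' : {set vert G}).
Hypotheses (tX : tight e a b X) (tX' : tight e' a b' X') (ne : e != e').
Hypothesis a1 : a \notin vs e1.

Let aA : a \in A := subsetP (t_sub tX) _ (t_in tX).

Lemma two_tight_neq : b != b'.
Proof.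
apply: contraNneq ne => bb; apply/eqP/esym.
apply: (tight_un tX (t_D tX') (t_in tX)); rewrite bb; exact: t_j tX'.
Qed.

(** If the union is not [A], submodularity leaves the intersection [I] a surplus of at most one.
    Both [b] and [b'] are seen from [I] only through [a], so [I] without [a] would have no surplus,
    against [nbs_C1]; if [I] is just [a], [nbs_C3] gives it three neighbours. *)
Lemma two_tight_union : X :|: X' = A.
Proof.
apply/eqP/negPn/negP=> nU.
have sU : X :|: X' \subset A by rewrite subUset (t_sub tX) (t_sub tX').
have nz : X :|: X' != set0 by apply/set0Pn; exists a; rewrite inE (t_in tX).
have h1 := C1 sU nz nU.
have h2 := nb_submod D X X'.
rewrite (tight_cardN tX) (tight_cardN tX') in h2.
have h3 := cardsUI X X'.
set I := X :&: X' in h2 h3.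
have aI : a \in I by rewrite inE (t_in tX) (t_in tX').
have cI := cardsD1 a I; rewrite aI in cI.
have sIX : I :\ a \subset X := subset_trans (subsetDl _ _) (subsetIl _ _).
have sIX' : I :\ a \subset X' := subset_trans (subsetDl _ _) (subsetIr _ _).
have aIa : a \notin I :\ a by rewrite !inE eqxx.
have bN : b \in N I by apply: nbI (t_D tX) aI (t_j tX).
have bN' : b' \in N I by apply: nbI (t_D tX') aI (t_j tX').
have h4 : #|N (I :\ a)| + 2 <= #|N I|.
  have -> : 2 = #|[set b; b']| by rewrite cards2 two_tight_neq.
  have dj : N (I :\ a) :&: [set b; b'] = set0.
    apply/eqP; rewrite -subset0; apply/subsetP=> v /setIP[vN /set2P[] ev].
      by have := tight_N1 tX sIX aIa; rewrite -ev vN.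
    by have := tight_N1 tX' sIX' aIa; rewrite -ev vN.
  rewrite -[leqLHS]subn0 -(cards0 (vert G)) -dj -cardsU subset_leq_card // subUset.
  by rewrite nbS ?subsetDl // subUset !sub1set bN.
have [z|nz2] := eqVneq (I :\ a) set0.
  have sa : [set a] \subset A :\: vs e1 by rewrite sub1set inE a1.
  have := C3 sa; rewrite -card_gt0 cards1 => /(_ isT).
  have -> : [set a] = I by rewrite -(setD1K aI) z setU0.
  by move: cI h1 h2 h3; rewrite z cards0; clear; lia.
have neA : I :\ a != A by apply: contraTneq aA => <-.
have := C1 (subset_trans sIX (t_sub tX)) nz2 neA.
by move: cI h1 h2 h3 h4; clear; lia.
Qed.

Lemma two_tight_P : [disjoint Pt X & Pt X'].
Proof.
rewrite /Pt disjoints_subset; apply/subsetP=> v /setDP[vA vX].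
rewrite in_setC in_setD vA andbT negbK.
by move: vA; rewrite -two_tight_union inE (negPf vX).
Qed.

(** A common vertex could only have [a] as a neighbour, because the sets [Pt] are disjoint. *)
Lemma two_tight_Q : [disjoint Qt e X & Qt e' X'].
Proof.
rewrite disjoints_subset; apply/subsetP=> v vQ; rewrite in_setC; apply/negP=> vQ'.
have vB : v \in ~: A by apply: (subsetP (subsetDl _ _) _ vQ).
have sN : N [set v] \subset [set a].
  apply/subsetP=> x xN.
  have xQ : x \in a |: Pt X.
    by apply: (subsetP (tight_NQ tX)); apply: (subsetP (nbS _ _) _ xN); rewrite sub1set.
  have xQ' : x \in a |: Pt X'.
    by apply: (subsetP (tight_NQ tX')); apply: (subsetP (nbS _ _) _ xN); rewrite sub1set.
  move: xQ xQ'; rewrite !in_setU1 in_set1; case/orP=> [->//|xP] /orP[//|xP'].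
  by have := disjointFr two_tight_P xP; rewrite xP'.
have nz : [set v] != set0 by rewrite -card_gt0 cards1.
have nB : [set v] != ~: A.
  apply/eqP=> E; have := nbs_ge3 HN; by rewrite cA -E cards1.
have := nbs_C1B HN _ nz nB; rewrite sub1set vB => /(_ isT); rewrite cards1 ltnNge.
by rewrite -(cards1 a) subset_leq_card.
Qed.

End TwoTight.

(** Three pairwise disjoint sets [Qt] would each contain an end of [e2]. *)
Lemma three_tight e e' e'' a b b' b'' X X' X'' :
  tight e a b X -> tight e' a b' X' -> tight e'' a b'' X'' ->
  e != e' -> e != e'' -> e' != e'' -> a \notin vs e1 -> False.
Proof.
move=> t t' t'' n1 n2 n3 a1.
have [v v2 vQ] := tight_Qe2 t; have [v' v2' vQ'] := tight_Qe2 t'.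
have [v'' v2'' vQ''] := tight_Qe2 t''.
have d (Q Q' : {set vert G}) x y : [disjoint Q & Q'] -> x \in Q -> y \in Q' -> x != y.
  by move=> dj xQ yQ; apply: contraTneq yQ => <-; rewrite (disjointFr dj xQ).
have m1 := d _ _ _ _ (two_tight_Q t t' n1 a1) vQ vQ'.
have m2 := d _ _ _ _ (two_tight_Q t t'' n2 a1) vQ vQ''.
have m3 := d _ _ _ _ (two_tight_Q t' t'' n3 a1) vQ' vQ''.
have : #|[set v; v'; v'']| <= #|vs e2|.
  by apply: subset_leq_card; rewrite !subUset !sub1set v2 v2' v2''.
rewrite (nbs_c2 HN) -setUA cardsU1 cards2 !inE negb_or m1 m2 m3; by [].
Qed.

End Tight.

Section Exceptional.
Variables (G : mgraph) (A : {set vert G}) (e1 e2 : edge G).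
Hypothesis HN : nbs A e1 e2.
Implicit Types (X Y Z V S T : {set vert G}) (M : {set edge G}).
Implicit Types (e f g h : edge G) (a b c d u v w x y : vert G).
Local Notation D := [set e1; e2].
Local Notation N := (nb [set e1; e2]).
Local Notation Ne e := (nb (e |: [set e1; e2])).
Local Notation P := (Pt A).
Local Notation Q := (Qt A e1 e2).
Local Notation tight := (tight A e1 e2).
Local Notation k2set := (k2set A e1 e2).
Local Notation k1set := (k1set A e1 e2).

Let s1 := nbs_e1 HN. Let s2 := nbs_e2 HN.
Let cr := nbs_cross HN. Let cA := nbs_card HN.
Let C1 := nbs_C1 HN. Let C2 := nbs_C2 HN. Let C3 := nbs_C3 HN.

(** [X] may contain ends of [e1], so [nbs_C3] does not apply to it. A smaller set avoiding [e1] is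
    extracted from the Hall violator obtained by fixing [e1], [e2] and [g] at once. *)
Lemma k2_V e a b X g c w b1 b2 : k2set e a b X g c w ->
  [disjoint P X & vs e1] -> vs e2 = [set b1; b2] ->
  b1 \in Q e X -> b2 \notin Q e X -> w != b2 ->
  exists V, [/\ V \subset X, V \subset A :\: vs e1, a \in V,
               #|N V| = #|V| + 2 & b2 \in N V].
Proof.
case=> tX gD ge jg cP wN no dP e2E b1Q b2Q wb2.
have [cAA cX] := setDP cP.
have wA : w \notin A by apply: (joinsB HN gD jg).
have ce1 : c \notin vs e1 by rewrite (disjointFr dP cP).
have wb1 : w != b1 by apply: contraTneq b1Q => <-; rewrite in_setD wN.
have we2 : w \notin vs e2 by rewrite e2E !inE negb_or wb1.
have we1 : w \notin vs e1 by apply: contra wA; apply: (subsetP s1).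
have ce2 : c \notin vs e2.
  by apply: contraL cAA => /(subsetP s2); rewrite inE.
have sE : vs e1 :|: [set c] \subset A by rewrite subUset s1 sub1set.
have sF : vs e2 :|: [set w] \subset ~: A by rewrite subUset s2 sub1set inE.
have cE : #|vs e1 :|: [set c]| = 3.
  by rewrite setUC cardsU1 ce1 (nbs_c1 HN).
have cF : #|vs e2 :|: [set w]| = 3.
  by rewrite setUC cardsU1 we2 (nbs_c2 HN).
set T := ~: A :\: (vs e2 :|: [set w]).
have [||||||V0 sV0 lt] :=
    @hall_viol _ A e1 e2 e (A :\: (vs e1 :|: [set c])) T (D :|: [set g]).
- exact: subsetDl.
- exact: subsetDl.
- by rewrite !cardsD (setIidPr sE) (setIidPr sF) cE cF cA.
- rewrite setC_DD // setUACA -(joins_vs jg); apply: pm_union.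
  + exact: pm_e12 HN.
  + exact: pm_single.
  + rewrite disjoint_sym (joins_vs jg) disjoints_subset subUset !sub1set !in_setC.
    by rewrite !(in_setU _ (vs e1) (vs e2)) (negPf ce1) (negPf ce2) (negPf we1) (negPf we2).
- by have := t_D tX; rewrite !inE !negb_or eq_sym => ->; rewrite eq_sym.
- by move=> M pm; rewrite subUset sub1set => /andP[_]; apply: no.
have sV0A : V0 \subset A := subset_trans sV0 (subsetDl _ _).
have V0c : c \notin V0 by apply/negP=> /(subsetP sV0); rewrite !inE eqxx orbT.
have V0e : V0 \subset A :\: vs e1 by apply: subset_trans sV0 _; rewrite setDS // subsetUl.
pose V := V0 :&: X; pose U := V0 :\: X.
have cV : #|V| + #|U| = #|V0| by apply: cardsID.
have sVX : V \subset X := subsetIr _ _.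
have sVA : V \subset A := subset_trans sVX (t_sub tX).
have sUP : U \subset P X :\ c.
  apply/subsetP=> v /setDP[vV vX]; rewrite !inE vX (subsetP sV0A) //= andbT.
  by apply: contraNneq V0c => <-.
have aU : a \notin U by rewrite inE (t_in tX).
have Q2 : Q e X :\ b1 \subset ~: A :\: vs e2.
  apply/subsetP=> v /setD1P[vb1 vQ]; rewrite in_setD (subsetP (subsetDl _ _) _ vQ) andbT.
  rewrite e2E !inE (negPf vb1) /=; by apply: contraNneq b2Q => <-.
have cQ := cardsD1 b1 (Q e X); rewrite b1Q in cQ.
have cP' := cardsD1 c (P X); rewrite cP in cP'.
have cPQ := tight_cardPQ HN tX.
(* The part [U] of the violator outside [X] has enough neighbours in [Q] without [b1]: the vertices
   [W] missed by [U] have surplus two by [nbs_C3B], but their neighbours avoid [U]. Hence the part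
   [V] inside [X] is already a violator. *)
have hU : #|U| <= #|N U :&: (Q e X :\ b1)|.
  pose W := (Q e X :\ b1) :\: N U.
  have cW : #|N U :&: (Q e X :\ b1)| + #|W| = #|Q e X :\ b1|.
    by rewrite setIC; apply: cardsID.
  have leU := subset_leq_card sUP.
  have [W0|nW] := eqVneq W set0.
    by move: cW cQ cP' cPQ leU; rewrite W0 cards0; clear; lia.
  have sWQ : W \subset Q e X :\ b1 := subsetDl _ _.
  have h3 := nbs_C3B HN (subset_trans sWQ Q2) nW.
  have : N W \subset a |: (P X :\: U).
    apply/subsetP=> v vN.
    have : v \in a |: P X.
      apply: (subsetP (tight_NQ HN tX)); apply: (subsetP (nbS _ _) _ vN).
      exact: subset_trans sWQ (subsetDl _ _).
    rewrite !in_setU1 in_setD => /orP[->//|->]; rewrite andbT.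
    case/nbP: vN => h [x [hD /setDP[_ xN] jx]].
    case vU: (v \in U) => /=; last by rewrite orbT.
    by case/negP: xN; apply: nbI hD vU _; rewrite joinsC.
  move/subset_leq_card; rewrite cardsU1 cardsD (setIidPr _); last first.
    exact: subset_trans sUP (subsetDl _ _).
  by case: (a \notin _) => /=; move: h3 cW cQ cP' cPQ leU; clear; lia.
have sNeX : Ne e V \subset Ne e X := nbS _ sVX.
have hV : #|Ne e V :&: T| < #|V|.
  have dj : (Ne e V :&: T) :&: (N U :&: (Q e X :\ b1)) = set0.
    apply/eqP; rewrite -subset0; apply/subsetP=> v /setIP[/setIP[vV _] /setIP[_]].
    by move=> /setD1P[_ /setDP[_]]; rewrite (subsetP sNeX).
  have : (Ne e V :&: T) :|: (N U :&: (Q e X :\ b1)) \subset Ne e V0 :&: T.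
    rewrite subUset setSI ?nbS ?subsetIl //=.
    apply/subsetP=> v /setIP[vN vQ]; rewrite in_setI; apply/andP; split.
      apply: (subsetP (nbS _ (subsetDl V0 X))); apply/negPn/negP=> vE.
      have aA := subsetP (t_sub tX) _ (t_in tX).
      have [_ aU'] := N_Ne HN (t_D tX) (t_j tX) aA (subset_trans (subsetDl V0 X) sV0A) vN vE.
      by rewrite aU' in aU.
    have /setDP[vB v2] := subsetP Q2 _ vQ; rewrite in_setD vB andbT in_setU (negPf v2) in_set1.
    apply: contraTneq vQ => ->; rewrite in_setD1 negb_and in_setD wN /=; by rewrite orbT.
  move/subset_leq_card; rewrite cardsU dj cards0.
  by move: lt hU cV; clear; lia.
have Vgt0 : 0 < #|V| by apply: leq_ltn_trans hV.
have sVe : V \subset A :\: vs e1 := subset_trans (subsetIl _ _) V0e.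
have h3 : #|V| + 2 <= #|N V| by apply: C3; rewrite // -card_gt0.
have sNeB : Ne e V \subset ~: A := subset_trans (Ne_sub _ _ _ _) (N_sub HN sVA).
(* At most [b2] and [w] are lost outside [T], and at most one neighbour with [e]; the lower bound
   [h3] is reached only if all three losses occur. *)
have hD : Ne e V :\: T \subset Ne e V :&: [set b2; w].
  apply/subsetP=> v /setDP[vN]; rewrite in_setD (subsetP sNeB) // andbT negbK.
  rewrite in_setI vN in_set2 => /setUP[|/set1P->]; last by rewrite eqxx orbT.
  rewrite e2E => /set2P[vb1|->]; last by rewrite eqxx.
  by move: b1Q; rewrite -vb1 in_setD (subsetP sNeX).
have cNe := cardsID T (Ne e V).
have leD := subset_leq_card hD.
have aA := subsetP (t_sub tX) _ (t_in tX).
have leN := N_le_Ne HN (t_D tX) (t_j tX) aA sVA.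
have le2 : #|Ne e V :&: [set b2; w]| <= 2.
  by rewrite (leq_trans (subset_leq_card (subsetIr _ _))) // cards2; case: (_ != _).
exists V; split=> //.
- apply/negPn/negP=> aV.
  have : #|N V| <= #|Ne e V|.
    apply/subset_leq_card/subsetP=> v vN; apply/negPn/negP=> vE.
    by have [_] := N_Ne HN (t_D tX) (t_j tX) aA sVA vN vE; rewrite (negPf aV).
  by move: h3 hV cNe leD le2; clear; lia.
- by apply/eqP; rewrite eqn_leq h3 andbT; move: hV cNe leD le2 leN; clear; lia.
- apply: (subsetP (Ne_sub _ _ e _)); apply/negPn/negP=> b2N.
  have : #|Ne e V :&: [set b2; w]| <= 1.
    rewrite -(cards1 w); apply/subset_leq_card/subsetP=> v /setIP[vN /set2P[vb|->]].
      by rewrite vb (negPf b2N) in vN.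
    by rewrite inE.
  by move: h3 hV cNe leD leN; clear; lia.
Qed.

(* [V] is either the tight set itself, when its complement meets [e1], or the
   smaller set produced by [k2_V]; both uncross with [Z]. *)
Lemma exceptional_half e e' e'' a b b' d X X' Z g c w :
  a \notin vs e1 -> e != e' -> e'' != e -> e'' != e' ->
  k2set e a b X g c w -> tight e' a b' X' ->
  e'' \notin D -> joins e'' a d -> k1set e'' a d Z ->
  N [set a] = [set b; b'; d] /\
    (forall v, v \in vs e2 -> v \in Q e' X' -> v = b').
Proof.
move=> a1 ne ne1 ne2 k2 tX' eD'' j'' [sZ aZ cZ e2Z d2 dun].
have tX := k2_tight k2.
have aA := subsetP (t_sub tX) _ (t_in tX).
have bb' := two_tight_neq tX tX' ne.
have bd : b != d.
  apply: contraNneq ne1 => bd; apply/eqP/(tight_un tX eD'' (t_in tX)); by rewrite bd.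
have b'd : b' != d.
  apply: contraNneq ne2 => bd'; apply/eqP/(tight_un tX' eD'' (t_in tX')); by rewrite bd'.
have dQ := two_tight_Q HN tX tX' ne a1.
have dP := two_tight_P HN tX tX' ne a1.
have sZA : Z \subset A := subset_trans sZ (subsetDl _ _).
have [v1 v12 v1Q] := tight_Qe2 HN tX.
have [v0 v02 v0Q'] := tight_Qe2 HN tX'.
have key v2 : v2 \in vs e2 -> v2 \in Q e' X' ->
   N [set a] = [set b; b'; d] /\ v2 = b'.
  move=> v22 v2Q'.
  have v2Q : v2 \notin Q e X by rewrite (disjointFl dQ v2Q').
  have v12n : v1 != v2 by apply: contraNneq v2Q => <-.
  have e2E : vs e2 = [set v1; v2].
    apply/esym/eqP; rewrite eqEcard subUset !sub1set v12 v22 (nbs_c2 HN).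
    by rewrite cards2 v12n.
  have v2A : v2 \notin A by have := subsetP s2 _ v22; rewrite inE.
  (* The bound [cI] comes from [nbs_C3] for the union when it avoids [e1]. Otherwise the union
     misses an end [p] of [e1], and the weaker [nbs_C1] suffices because [X] has surplus one
     only. *)
  have [V [sVX aV v2V cI]] : exists V, [/\ V \subset X, a \in V, v2 \in N V &
      #|N V :&: N Z| <= #|V :&: Z| + 2].
    have [dPe|] := boolP [disjoint P X & vs e1].
      have [|V [sVX sVe aV cV v2V]] := k2_V k2 dPe e2E v1Q v2Q.
        apply: contraTneq (k2_c k2) => wv2; have jg := k2_j k2; rewrite wv2 in jg.
        apply/negP=> cP.
        have : c \in a |: P X'.
          apply: (subsetP (tight_NQ HN tX')); apply: nbI (k2_gD k2) v2Q' _.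
          by rewrite joinsC.
        rewrite in_setU1 (disjointFr dP cP) orbF => /eqP ca.
        by case/setDP: cP; rewrite ca (t_in tX).
      exists V; split=> //.
      have sU : V :|: Z \subset A :\: vs e1 by rewrite subUset sVe.
      have nU : V :|: Z != set0 by apply/set0Pn; exists a; rewrite inE aV.
      have := C3 sU nU; rewrite nbU; have := cardsUI (N V) (N Z); have := cardsUI V Z.
      by move: cV cZ; clear; lia.
    rewrite disjoints_subset => /subsetPn[p pP]; rewrite in_setC negbK => p1.
    exists X; split=> //; [exact: t_in tX|exact: (tight_NX v2A v2Q)|].
    have [pA pX] := setDP pP.
    have pZ : p \notin Z by apply/negP=> /(subsetP sZ); rewrite in_setD p1.
    have sU : X :|: Z \subset A by rewrite subUset (t_sub tX).
    have nU : X :|: Z != set0 by apply/set0Pn; exists a; rewrite inE aZ orbT.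
    have nA : X :|: Z != A by apply: contraTneq pA => <-; rewrite inE negb_or pX.
    have := C1 sU nU nA; rewrite nbU; have := cardsUI (N X) (N Z); have := cardsUI X Z.
    by rewrite (tight_cardN HN tX); move: cZ; clear; lia.
  pose I := V :&: Z.
  have aI : a \in I by rewrite inE aV.
  have aIa : a \notin I :\ a by rewrite !inE eqxx.
  have cIa := cardsD1 a I; rewrite aI in cIa.
  have bNa : b \in N [set a] by apply: nbI (t_D tX) _ (t_j tX); rewrite inE.
  have b'Na : b' \in N [set a] by apply: nbI (t_D tX') _ (t_j tX'); rewrite inE.
  have dNa : d \in N [set a] by apply: nbI eD'' _ j''; rewrite inE.
  have sNa : N [set a] \subset N V :&: N Z by rewrite subsetI !nbS // sub1set.
  have bN : b \notin N (I :\ a).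
    by apply: (tight_N1 tX _ aIa); apply: subset_trans sVX; rewrite (subset_trans (subsetDl _ _)) ?subsetIl.
  have dN : d \notin N (I :\ a).
    apply/negP=> /nbP[h [x [hD /setD1P[xa /setIP[_ xZ]] jx]]].
    have [eh|he] := eqVneq h e''.
      by rewrite eh in jx; rewrite (joins_inj jx j'') eqxx in xa.
    by case/negP: dun; apply: nbI xZ jx; rewrite in_setU1 negb_or he.
  (* A nonempty rest would have surplus two by [nbs_C3], and [b], [d] are seen only from [a]: one
     neighbour more than [cI] allows. *)
  have I1 : I :\ a = set0.
    apply/eqP/negPn/negP=> nz.
    have sIe : I :\ a \subset A :\: vs e1.
      by apply: subset_trans sZ; rewrite (subset_trans (subsetDl _ _)) ?subsetIr.
    have h3 := C3 sIe nz.
    have : N (I :\ a) :|: [set b; d] \subset N V :&: N Z.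
      rewrite subUset; apply/andP; split.
        by rewrite subsetI !nbS // (subset_trans (subsetDl _ _)) ?subsetIl ?subsetIr.
      by rewrite subUset !sub1set !(subsetP sNa).
    move/subset_leq_card; rewrite cardsUD setDE cards2 bd (setIidPl _); last first.
      rewrite -disjoints_subset disjoint_sym disjoints_subset subUset !sub1set.
      by rewrite !in_setC bN dN.
    by move: h3 cI cIa; rewrite -/I; clear; lia.
  have NE : [set b; b'; d] = N V :&: N Z.
    apply/eqP; rewrite eqEcard !subUset !sub1set !(subsetP sNa) //=.
    rewrite (leq_trans cI) // -/I cIa I1 cards0 addn0.
    by rewrite -setUA cardsU1 cards2 b'd !inE negb_or bb' bd.
  split.
    apply/eqP; rewrite eqEsubset {1}NE sNa.
    by rewrite !subUset !sub1set bNa b'Na dNa.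
  have : v2 \in N V :&: N Z by rewrite inE v2V (subsetP e2Z).
  rewrite -NE !inE => /orP[/orP[]|] /eqP // v2b.
    by move: v2Q; rewrite v2b (tight_b HN tX).
  by move: d2; rewrite -v2b v22.
split=> // [|v v2 vQ]; first by have [] := key _ v02 v0Q'.
by have [] := key v v2 vQ.
Qed.

(** Apart from [b], all of [Q] avoids [e2], so a nonempty rest has surplus two by [nbs_C3B]; but its
    neighbours lie in [P], since [a] reaches [Q] only through [e]. *)
Lemma exceptional_tight_N e a b X : tight e a b X ->
  (forall v, v \in vs e2 -> v \in Q e X -> v = b) -> Q e X = [set b] /\ #|P X| = 1.
Proof.
move=> tX h.
have cPQ := tight_cardPQ HN tX.
have bQ := tight_b HN tX.
have E : Q e X = [set b].
  apply/eqP; rewrite eq_sym eqEsubset sub1set bQ /=; apply/subsetP=> v vQ; rewrite inE.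
  apply/negPn/negP=> vb.
  have nz : Q e X :\ b != set0 by apply/set0Pn; exists v; rewrite !in_setD1 vb.
  have sQ : Q e X :\ b \subset ~: A :\: vs e2.
    apply/subsetP=> u /setD1P[ub uQ]; rewrite in_setD (subsetP (subsetDl _ _) _ uQ) andbT.
    by apply: contra ub => u2; rewrite (h u).
  have h3 := nbs_C3B HN sQ nz.
  have : N (Q e X :\ b) \subset P X.
    apply/subsetP=> u uN.
    have := subsetP (subset_trans (nbS _ (subsetDl _ _)) (tight_NQ HN tX)) _ uN.
    rewrite in_setU1 => /orP[/eqP ua|//]; move: uN; rewrite ua.
    case/nbP=> g [x [gD /setD1P[xb /setDP[_ xN]] jx]].
    have [eg|ge] := eqVneq g e.
      rewrite eg joinsC in jx; by rewrite (joins_injr jx (t_j tX)) eqxx in xb.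
    case/negP: xN; apply: nbI (t_in tX) _; last by rewrite joinsC; exact: jx.
    by rewrite in_setU1 negb_or ge.
  have := cardsD1 b (Q e X); rewrite bQ => cQ /subset_leq_card.
  by move: cQ h3 cPQ; clear; lia.
by split=> //; rewrite cPQ E cards1.
Qed.

End Exceptional.

(** * Exceptional vertices and the lower bound *)

Definition inc (G : mgraph) (v : vert G) : {set edge G} := [set g | v \in vs g].

Lemma in_inc (G : mgraph) (v : vert G) g : (g \in inc v) = (v \in vs g).
Proof. by rewrite in_set. Qed.

Definition rinc (G : mgraph) (v : vert G) : {set edge G} := [set g in inc v | removable g].

Lemma in_rinc (G : mgraph) (v : vert G) g : (g \in rinc v) = (v \in vs g) && removable g.
Proof. by rewrite in_set in_inc. Qed.

Definition removables (G : mgraph) : {set edge G} := [set e | removable e].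

Lemma in_removables (G : mgraph) (g : edge G) : (g \in removables G) = removable g.
Proof. by rewrite in_set. Qed.

Section Degrees.
Variables (G : mgraph) (A : {set vert G}) (e1 e2 : edge G).
Hypothesis HN : nbs A e1 e2.
Implicit Types (X Y Z V S T : {set vert G}) (M : {set edge G}).
Implicit Types (e f g h : edge G) (a b c d u v w x y : vert G).
Local Notation D := [set e1; e2].
Local Notation N := (nb [set e1; e2]).
Local Notation forced1 := (forced1 e1).

Let s1 := nbs_e1 HN. Let s2 := nbs_e2 HN.
Let cr := nbs_cross HN. Let cA := nbs_card HN.
Let C1 := nbs_C1 HN. Let C2 := nbs_C2 HN. Let C3 := nbs_C3 HN.

Definition forced1b e :=
  [forall M : {set edge G}, perfect_matching M ==> (e1 \in M) ==> (e \in M)].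

Lemma forced1P e : reflect (forced1 e) (forced1b e).
Proof.
apply: (iffP forallP) => [h M pm eM|h M]; first by have := h M; rewrite pm eM.
by apply/implyP=> pm; apply/implyP; apply: h.
Qed.

Lemma e1_adm : exists2 M, perfect_matching M & e1 \in M.
Proof.
have [|||M pm dj] := @hall_pm G D (A :\: vs e1) (~: A :\: vs e2).
- rewrite disjoints_subset (subset_trans (subsetDl _ _)) //.
  by rewrite -setCS setCK subsetDl.
- by apply/eqP; rewrite -(eqn_add2r 2) (cardAe1 HN) (cardBe2 HN).
- move=> X sX; have sXA := subset_trans sX (subsetDl _ _).
  have -> : N X :&: (~: A :\: vs e2) = N X :\: vs e2.
    by rewrite setIDA (setIidPl (N_sub HN sXA)).
  apply: C2 => //; have := subset_leq_card sX; have := cardAe1 HN; clear; lia.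
exists (D :|: M); last by rewrite !inE eqxx.
have := pm_union (pm_e12 HN) pm; rewrite -(setC_DD s1 s2) [~: _ :|: _]setUC setUCr; apply.
by rewrite disjoint_sym disjoints_subset setCK subxx.
Qed.

Lemma forced1_uniq v e e' : v \in vs e -> v \in vs e' -> forced1 e -> forced1 e' -> e = e'.
Proof.
have [M pm e1M] := e1_adm => ve ve' /(_ M pm e1M) eM /(_ M pm e1M) eM'.
exact: (pm_uniq pm (in_setT v)).
Qed.

Lemma forced1_card v : #|[set g in inc v | forced1b g]| <= 1.
Proof.
rewrite leqNgt; apply/negP=> /card_gt1P[e [e' [+ + ne]]].
rewrite in_set in_inc => /andP[ve /forced1P fe]; rewrite in_set in_inc => /andP[ve' /forced1P fe'].
by case/eqP: ne; apply: (forced1_uniq ve ve').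
Qed.

Lemma inc_H a g : a \in A :\: vs e1 -> g \in inc a -> g \notin D.
Proof.
case/setDP=> aA a1; rewrite in_inc => ag; rewrite !inE negb_or.
apply/andP; split; apply/eqP=> E; first by rewrite -E ag in a1.
by have := subsetP s2 a; rewrite -E ag in_setC aA => /(_ isT).
Qed.

Definition k2edges v := [set g in inc v | ~~ removable g & ~~ forced1b g].

Lemma k2edgesP a g : a \in A :\: vs e1 -> g \in k2edges a ->
  exists b, exists X h c w, [/\ joins g a b & k2set A e1 e2 g a b X h c w].
Proof.
move=> aA; rewrite in_set => /and3P[ag nr /forced1P nf].
have gD := inc_H aA ag.
have [b j] : exists b, joins g a b by apply: vs_joins; rewrite in_inc in ag.
have aA' : a \in A by case/setDP: aA.
have [X [h [c [w k2]]]] := nonremovable_k2 HN gD j aA' nr nf.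
by exists b, X, h, c, w.
Qed.

Lemma k2edges_card a : a \in A :\: vs e1 -> #|k2edges a| <= 2.
Proof.
move=> aA; rewrite leqNgt; apply/negP=> /card_gt2P[e [e' [e'' [[k k' k''] [n1 n2 n3]]]]].
have [b [X [? [? [? [j K]]]]]] := k2edgesP aA k.
have [b' [X' [? [? [? [j' K']]]]]] := k2edgesP aA k'.
have [b'' [X'' [? [? [? [j'' K'']]]]]] := k2edgesP aA k''.
have a1 : a \notin vs e1 by case/setDP: aA.
rewrite eq_sym in n3.
exact: (three_tight HN (k2_tight K) (k2_tight K') (k2_tight K'') n1 n3 n2 a1).
Qed.

Lemma forced1_nonrem e : e != e1 -> forced1 e -> ~~ removable e.
Proof.
move=> ne fe; apply/negP=> re.
have [|M pm [e1M eM]] := removable_adm re (f := e1); first by rewrite eq_sym.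
by rewrite (fe M pm e1M) in eM.
Qed.

Lemma nb1P a v : reflect (exists2 g, g \notin D & joins g a v) (v \in N [set a]).
Proof.
apply: (iffP (nbP _ _ _)) => [[g [x [gD /set1P-> j]]]|[g gD j]]; first by exists g.
by exists g, a; rewrite inE.
Qed.

Lemma inc_ge a : #|N [set a]| <= #|inc a|.
Proof.
pose oth g := if (ends g).1 == a then (ends g).2 else (ends g).1.
rewrite (leq_trans _ (leq_imset_card oth _)) //.
apply/subset_leq_card/subsetP=> v /nb1P[g gD j]; apply/imsetP; exists g.
  by rewrite in_inc (joins_l j).
rewrite /oth; case/orP: j => /eqP E; rewrite E /= ?eqxx //.
by case: eqP.
Qed.

Lemma N1_ge3 a : a \in A :\: vs e1 -> 3 <= #|N [set a]|.
Proof.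
move=> aA; have := C3 (X := [set a]); rewrite sub1set aA -card_gt0 cards1.
exact.
Qed.

Lemma N1_ge2B b : b \notin A -> 2 <= #|N [set b]|.
Proof.
move=> bA; have := nbs_C1B HN (Y := [set b]).
rewrite sub1set inE bA -card_gt0 cards1; apply=> //.
by apply/eqP=> E; have := nbs_ge3 HN; rewrite cA -E cards1.
Qed.

Lemma inc_split a : a \in A :\: vs e1 ->
  #|inc a| = #|rinc a| + #|[set g in inc a | forced1b g]|
             + #|k2edges a|.
Proof.
move=> aA; rewrite -(cardsID [set g | removable g] (inc a)) -addnA; congr (_ + _).
  by apply: eq_card => g; rewrite !inE andbC.
rewrite -(cardsID [set g | forced1b g] (_ :\: _)); congr (_ + _).
  apply: eq_card => g; rewrite in_setI in_setD (in_set _ g) (in_set _ g) (in_set _ g) in_inc.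
  case fg: (forced1b g); rewrite ?andbF ?andbT //; case ag: (a \in vs g); rewrite ?andbF //.
  rewrite forced1_nonrem //; last exact/forced1P.
  have /(inc_H aA) : g \in inc a by rewrite in_inc.
  by rewrite !inE negb_or => /andP[].
apply: eq_card => g; rewrite !in_setD !in_set.
by case: (removable g); case: (forced1b g); rewrite ?andbF ?andbT.
Qed.

(** Here [a] forms a triangle with [e2]. [x_I] recovers [a] from [e2], and [x_Nb], [x_Nb'] leave
    each end of [e2] a single neighbour outside the triangle. *)
Record excs a b b' d e e' e'' : Prop := Excs {
  x_j : joins e a b; x_j' : joins e' a b'; x_j'' : joins e'' a d;
  x_inc : inc a = [set e; e'; e''];
  x_bb' : b != b'; x_bd : b != d; x_bd' : b' != d; x_d : d \notin vs e2;
  x_e2 : vs e2 = [set b; b'];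
  x_N : N [set a] = [set b; b'; d];
  x_Nb : #|N [set b]| = 2; x_Nb' : #|N [set b']| = 2;
  x_I : N [set b] :&: N [set b'] = [set a] }.

(** [exceptional_half] is used twice, with the two edges of [k2edges] exchanged; both sets [Qt] then
    shrink to single vertices, and these are the ends of [e2]. *)
Lemma exceptional_of_k2 a : a \in A :\: vs e1 ->
  #|k2edges a| == 2 -> #|[set g in inc a | forced1b g]| == 1 ->
  exists b b' d e e' e'', excs a b b' d e e' e'' /\ rinc a = set0.
Proof.
move=> aAe c2 c1; have [aA a1] := setDP aAe.
case/cards2P: c2 => e [e' [ne E2]]; case/cards1P: c1 => e'' E1.
have k : e \in k2edges a by rewrite E2 !inE eqxx.
have k' : e' \in k2edges a by rewrite E2 !inE eqxx orbT.
have : e'' \in [set g in inc a | forced1b g] by rewrite E1 inE.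
rewrite in_set => /andP[ie'' f''].
have eD'' := inc_H aAe ie''.
have [d j''] : exists d, joins e'' a d by apply: vs_joins; rewrite in_inc in ie''.
have [Z k1] := forced1_set HN eD'' j'' aA (elimT (forced1P _) f'').
have [b [X [g [c [w [j K]]]]]] := k2edgesP aAe k.
have [b' [X' [g' [c' [w' [j' K']]]]]] := k2edgesP aAe k'.
have ne1 : e'' != e by apply: contraTneq k => <-; rewrite inE f'' !andbF.
have ne2 : e'' != e' by apply: contraTneq k' => <-; rewrite inE f'' !andbF.
have [Na h'] := exceptional_half HN a1 ne ne1 ne2 K (k2_tight K') eD'' j'' k1.
rewrite eq_sym in ne.
have [_ h] := exceptional_half HN a1 ne ne2 ne1 K' (k2_tight K) eD'' j'' k1.
rewrite eq_sym in ne.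
have tX := k2_tight K; have tX' := k2_tight K'.
have [QE PE] := exceptional_tight_N HN tX h.
have [QE' PE'] := exceptional_tight_N HN tX' h'.
have bb' := two_tight_neq tX tX' ne.
have b2 : b \in vs e2 by have [v v2 vQ] := tight_Qe2 HN tX; rewrite -(h v v2 vQ).
have b2' : b' \in vs e2 by have [v v2 vQ] := tight_Qe2 HN tX'; rewrite -(h' v v2 vQ).
have nA v : v \in vs e2 -> v \notin A by move/(subsetP s2); rewrite inE.
have Nsub f v Y : tight A e1 e2 f a v Y -> Qt A e1 e2 f Y = [set v] -> #|Pt A Y| = 1 ->
    v \notin A -> N [set v] = a |: Pt A Y /\ #|N [set v]| = 2.
  move=> tY QY PY vA; have sN := tight_NQ HN tY; rewrite QY in sN.
  have ge2 := N1_ge2B vA.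
  have le : #|a |: Pt A Y| <= 2.
    by rewrite cardsU1 PY; case: (a \notin _).
  have E : N [set v] = a |: Pt A Y by apply/eqP; rewrite eqEcard sN (leq_trans le).
  by split=> //; apply/eqP; rewrite eqn_leq ge2 andbT E.
have [Nb cNb] := Nsub _ _ _ tX QE PE (nA _ b2).
have [Nb' cNb'] := Nsub _ _ _ tX' QE' PE' (nA _ b2').
have bd : b != d.
  apply: contraNneq ne1 => bd; apply/eqP; rewrite -bd in j''.
  exact: (tight_un tX eD'' (t_in tX) j'').
have b'd : b' != d.
  apply: contraNneq ne2 => E; apply/eqP; rewrite -E in j''.
  exact: (tight_un tX' eD'' (t_in tX') j'').
have incE : inc a = [set e; e'; e''].
  apply/eqP; rewrite eqEsubset; apply/andP; split; last first.
    rewrite !subUset !sub1set ie'' andbT.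
    by move: k k'; rewrite !in_set => /andP[-> _] /andP[-> _].
  apply/subsetP=> g0 ag; have gD := inc_H aAe ag; rewrite in_inc in ag.
  have [v jv] := vs_joins ag.
  have : v \in N [set a] by apply: nbI gD _ jv; rewrite inE.
  rewrite Na !inE => /orP[/orP[]|] /eqP E; rewrite E in jv.
  - by rewrite (tight_un tX gD (t_in tX) jv) eqxx.
  - by rewrite (tight_un tX' gD (t_in tX') jv) eqxx orbT.
  - suff -> : g0 = e'' by rewrite eqxx !orbT.
    apply/eqP; apply: contraNT (k1_un k1) => ng.
    by apply: nbI (k1_in k1) jv; rewrite in_setU1 negb_or ng.
exists b, b', d, e, e', e''; split; last first.
  apply/setP=> g0; rewrite in_rinc in_set0 -in_inc incE.
  apply/negbTE; rewrite negb_and -implybE; apply/implyP; rewrite in_setU => /orP[/set2P|/set1P->].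
    by case=> ->; [move: k | move: k']; rewrite in_set => /and3P[].
  apply: forced1_nonrem; last exact/forced1P.
  by move: eD''; rewrite !inE negb_or => /andP[].
split=> //.
- exact: k1_b k1.
- by apply/esym/eqP; rewrite eqEcard subUset !sub1set b2 b2' cards2 bb' (nbs_c2 HN).
- rewrite Nb Nb' -setUIr; have := two_tight_P HN tX tX' ne a1.
  by move/disjoint_setI0->; rewrite setU0.
Qed.

Lemma exceptional a : a \in A :\: vs e1 -> rinc a = set0 ->
  exists b b' d e e' e'', excs a b b' d e e' e''.
Proof.
move=> aAe r0.
have sp := inc_split aAe; rewrite r0 cards0 add0n in sp.
have le2 := k2edges_card aAe; have le1 := forced1_card a.
have ge3 : 3 <= #|inc a| := leq_trans (N1_ge3 aAe) (inc_ge a).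
have c2 : #|k2edges a| == 2 by apply/eqP; move: sp le1 le2 ge3; clear; lia.
have c1 : #|[set g in inc a | forced1b g]| == 1 by apply/eqP; move: sp le1 le2 ge3; clear; lia.
have [b [b' [d [e [e' [e'' [x _]]]]]]] := exceptional_of_k2 aAe c2 c1.
by exists b, b', d, e, e', e''.
Qed.

(** Three nonremovable edges would be two in [k2edges] and one forced, and [exceptional_of_k2] then
    leaves no removable edge at [a]. *)
Lemma inc_le a : a \in A :\: vs e1 -> rinc a != set0 -> #|inc a| <= #|rinc a| + 2.
Proof.
move=> aAe rn; rewrite (inc_split aAe) -addnA leq_add2l.
have le2 := k2edges_card aAe; have le1 := forced1_card a.
rewrite leqNgt; apply/negP=> gt2.
have [||b [b' [d [e [e' [e'' [_ r0]]]]]]] := exceptional_of_k2 aAe.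
- by apply/eqP; move: le1 le2 gt2; clear; lia.
- by apply/eqP; move: le1 le2 gt2; clear; lia.
by rewrite r0 eqxx in rn.
Qed.

(** Both certificates of nonremovability make [g] the only edge from their set to [b]. *)
Lemma parallel_removable a b g g' : g \notin D -> g' \notin D -> g != g' ->
  joins g a b -> joins g' a b -> a \in A -> removable g.
Proof.
move=> gD gD' ne j j' aA; apply/negPn/negP=> nr.
have [/forced1P f|/forced1P nf] := boolP (forced1b g).
  have [X k1] := forced1_set HN gD j aA f.
  case/negP: (k1_un k1); apply: nbI (k1_in k1) j'.
  by rewrite in_setU1 negb_or eq_sym ne.
have [X [h [c [w k2]]]] := nonremovable_k2 HN gD j aA nr nf.
have tX := k2_tight k2.
by rewrite (tight_un tX gD' (t_in tX) j') eqxx in ne.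
Qed.

(** In [G - e1 - e2], such a vertex is the unique common neighbour of the ends of [e2]. *)
Lemma exceptional_uniq a a0 : a \in A :\: vs e1 -> a0 \in A :\: vs e1 ->
  rinc a = set0 -> rinc a0 = set0 ->
  a = a0.
Proof.
move=> aA a0A r r0.
have [b [b' [d [e [e' [e'' x]]]]]] := exceptional aA r.
have [c [c' [d0 [f [f' [f'' x0]]]]]] := exceptional a0A r0.
have : [set a] = [set a0].
  rewrite -(x_I x) -(x_I x0); have := x_e2 x; rewrite (x_e2 x0) => E.
  have : c \in [set b; b'] by rewrite -E !inE eqxx.
  have : c' \in [set b; b'] by rewrite -E !inE eqxx orbT.
  have cc := x_bb' x0.
  by case/set2P=> Ec; case/set2P=> Ec'; move: cc; rewrite Ec Ec' ?eqxx // setIC.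
by move/setP/(_ a); rewrite !inE eqxx => /esym/eqP.
Qed.

Lemma vs2 g : #|vs g| = 2.
Proof.
have [gD|/(nbs_cross HN) c] := boolP (g \in D).
  by case/set2P: gD => ->; rewrite ?(nbs_c1 HN) ?(nbs_c2 HN).
by rewrite cards2; case: eqVneq => // E; rewrite E eqxx in c.
Qed.

Lemma sum_remdeg : \sum_(v : vert G) #|rinc v| = 2 * #|removables G|.
Proof.
transitivity (\sum_(v : vert G) \sum_(g in removables G) (v \in vs g : nat)).
  apply: eq_bigr => v _; rewrite -sum1_card big_mkcond [RHS]big_mkcond /=.
  by apply: eq_bigr => g _; rewrite in_rinc in_removables; case: (removable g); case: (v \in vs g).
rewrite exchange_big /= mulnC -sum_nat_const; apply: eq_bigr => g _.
by rewrite -(vs2 g) -sum1_card [RHS]big_mkcond /=; apply: eq_bigr => v _; case: (_ \in _).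
Qed.


End Degrees.

Definition remdeg0 (G : mgraph) := [set v : vert G | rinc v == set0].

Lemma remdeg0_half (G : mgraph) (A : {set vert G}) (e1 e2 : edge G) : nbs A e1 e2 ->
  #|remdeg0 G :&: (A :\: vs e1)| <= 1.
Proof.
move=> HN; rewrite leqNgt; apply/negP=> /card_gt1P[x [y [/setIP[rx xA] /setIP[ry yA] /eqP[]]]].
by apply: (exceptional_uniq HN) => //; apply/eqP; move: rx ry; rewrite !inE.
Qed.

Section Count.
Variables (G : mgraph) (A : {set vert G}) (e1 e2 : edge G).
Hypothesis HN : nbs A e1 e2.

Lemma remdeg0_split : #|remdeg0 G| <=
  #|remdeg0 G :&: (A :\: vs e1)| + #|remdeg0 G :&: (~: A :\: vs e2)| +
  #|remdeg0 G :&: (vs e1 :|: vs e2)|.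
Proof.
have : remdeg0 G \subset (remdeg0 G :&: (A :\: vs e1) :|: remdeg0 G :&: (~: A :\: vs e2))
   :|: remdeg0 G :&: (vs e1 :|: vs e2).
  rewrite -!setIUr -(setC_DD (nbs_e1 HN) (nbs_e2 HN)) setUCr setIT //.
move/subset_leq_card => le; apply: leq_trans le _.
by rewrite !cardsU; clear; lia.
Qed.

(** In the sum of [#|rinc v|] each vertex outside [remdeg0] contributes at least one, and [remdeg0]
    has at most 4 + 1 + 1 vertices. Equality leaves no slack in any of these counts. *)
Lemma lower_bound : #|vert G| <= 2 * #|removables G| + 6 /\
  (2 * #|removables G| + 6 = #|vert G| ->
    [/\ vs e1 :|: vs e2 \subset remdeg0 G,
        exists2 z, z \in A :\: vs e1 & z \in remdeg0 G,
        exists2 w, w \in ~: A :\: vs e2 & w \in remdeg0 G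
      & forall v : vert G, #|rinc v| <= 1]).
Proof.
pose f (v : vert G) := #|rinc v|.
have sf : \sum_v f v = 2 * #|removables G| := sum_remdeg HN.
(* The truncated predecessor is the excess over one; on [remdeg0] it is zero. *)
have fE v : f v = (v \notin remdeg0 G) + (f v).-1.
  rewrite inE -/(f v) -cards_eq0 -/(f v); by case: (f v).
have sE : 2 * #|removables G| = #|~: remdeg0 G| + \sum_v (f v).-1.
  rewrite -sf (eq_bigr _ (fun v _ => fE v)) big_split /=; congr (_ + _).
  by rewrite -sum1_card [RHS]big_mkcond /=; apply: eq_bigr => v _; rewrite in_setC; case: (v \in remdeg0 G).
have h1 := remdeg0_half HN; have h2 := remdeg0_half (nbs_sym HN).
have hs := remdeg0_split.
have c12 : #|vs e1 :|: vs e2| = 4.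
  by rewrite cardsU (disjoint_setI0 (dis12 HN)) cards0 (nbs_c1 HN) (nbs_c2 HN).
have h3 : #|remdeg0 G :&: (vs e1 :|: vs e2)| <= 4.
  by rewrite -c12 subset_leq_card // subsetIr.
have cC := cardsC (remdeg0 G).
split; first by move: sE h1 h2 h3 hs cC; clear; lia.
move=> eq.
have z0 : \sum_v (f v).-1 = 0 by move: eq sE h1 h2 h3 hs cC; clear; lia.
split.
- have cI : #|vs e1 :|: vs e2| <= #|remdeg0 G :&: (vs e1 :|: vs e2)|.
    by rewrite c12; move: eq sE h1 h2 h3 hs cC; clear; lia.
  by apply/setIidPr/eqP; rewrite eqEcard subsetIr cI.
- have : 0 < #|remdeg0 G :&: (A :\: vs e1)| by move: eq sE h1 h2 h3 hs cC; clear; lia.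
  by case/card_gt0P=> z /setIP[? ?]; exists z.
- have : 0 < #|remdeg0 G :&: (~: A :\: vs e2)| by move: eq sE h1 h2 h3 hs cC; clear; lia.
  by case/card_gt0P=> z /setIP[? ?]; exists z.
- move=> v; move/eqP: z0; rewrite sum_nat_eq0 => /forallP/(_ v) /=; rewrite -/(f v).
  by case: (f v) => // -[].
Qed.

End Count.

(** * Contracting a triangle *)

(* [G0] arises from [G] by contracting the triangle [a1 a2 a3], all of whose
   vertices have degree three, to [t]; [si] is the triangle edge opposite [ai]
   and [xi] the edge of [G0] that leaves the triangle from [ai] towards [yi]. *)
Record tricon (G G0 : mgraph) (phi : vert G -> vert G0) (psi : edge G0 -> edge G)
    (t : vert G0) (a1 a2 a3 y1 y2 y3 : vert G) (s1 s2 s3 : edge G)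
    (x1 x2 x3 : edge G0) : Prop := Tricon {
  tc_neq : uniq [:: a1; a2; a3];
  tc_t : forall v, (phi v == t) = (v \in [set a1; a2; a3]);
  tc_inj : forall u v, u \notin [set a1; a2; a3] -> phi u = phi v -> u = v;
  tc_onto : forall v0, exists v, phi v = v0;
  tc_pinj : injective psi;
  tc_pim : forall g, g \notin [set s1; s2; s3] -> exists e, psi e = g;
  tc_pnot : forall e, psi e \notin [set s1; s2; s3];
  tc_pj : forall e x y, joins (psi e) x y -> joins e (phi x) (phi y);
  tc_s1 : joins s1 a2 a3; tc_s2 : joins s2 a1 a3; tc_s3 : joins s3 a1 a2;
  tc_x1 : joins (psi x1) a1 y1; tc_x2 : joins (psi x2) a2 y2;
  tc_x3 : joins (psi x3) a3 y3;
  tc_y : [/\ y1 \notin [set a1; a2; a3], y2 \notin [set a1; a2; a3]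
           & y3 \notin [set a1; a2; a3]];
  tc_i1 : inc a1 \subset [set s2; s3; psi x1];
  tc_i2 : inc a2 \subset [set s1; s3; psi x2];
  tc_i3 : inc a3 \subset [set s1; s2; psi x3] }.

Lemma cardsU1' (T : finType) (X : {set T}) x : #|X :|: [set x]| = (x \notin X) + #|X|.
Proof. by rewrite setUC cardsU1. Qed.

Lemma set3_card (T : finType) (a b c : T) : uniq [:: a; b; c] -> #|[set a; b; c]| = 3.
Proof.
rewrite /= !inE !negb_or !andbT => /andP[/andP[n12 n13] n23].
by rewrite cardsU1' cards2 n12 !inE negb_or ![c == _]eq_sym n13 n23.
Qed.

Lemma set3_rot (T : finType) (a b c : T) : [set a; b; c] = [set b; c; a].
Proof. by rewrite -setUA setUC. Qed.

Lemma set3_swap (T : finType) (a b c : T) : [set a; b; c] = [set b; a; c].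
Proof. by rewrite [[set a; b]]setUC. Qed.

(** Together with [tricon_swap], this lets each matching argument be carried out for a single edge
    of the triangle. *)
Lemma tricon_rot G G0 phi psi t a1 a2 a3 y1 y2 y3 s1 s2 s3 x1 x2 x3 :
  @tricon G G0 phi psi t a1 a2 a3 y1 y2 y3 s1 s2 s3 x1 x2 x3 ->
  tricon phi psi t a2 a3 a1 y2 y3 y1 s2 s3 s1 x2 x3 x1.
Proof.
case=> u tt ti on pi pim pn pj j1 j2 j3 k1 k2 k3 [n1 n2 n3] i1 i2 i3.
split; rewrite -?(set3_rot a1) -?(set3_rot s1) //.
- move: u; rewrite /= !inE !negb_or !andbT => /andP[/andP[h1 h2] h3].
  by rewrite h3 eq_sym h1 eq_sym h2.
all: by rewrite 1?joinsC // set3_swap.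
Qed.

Lemma tricon_swap G G0 phi psi t a1 a2 a3 y1 y2 y3 s1 s2 s3 x1 x2 x3 :
  @tricon G G0 phi psi t a1 a2 a3 y1 y2 y3 s1 s2 s3 x1 x2 x3 ->
  tricon phi psi t a2 a1 a3 y2 y1 y3 s2 s1 s3 x2 x1 x3.
Proof.
case=> u tt ti on pi pim pn pj j1 j2 j3 k1 k2 k3 [n1 n2 n3] i1 i2 i3.
split; rewrite -?(set3_swap a1) -?(set3_swap s1) //.
- move: u; rewrite /= !inE !negb_or !andbT => /andP[/andP[h1 h2] h3].
  by rewrite eq_sym h1 h3 h2.
all: by rewrite 1?joinsC // set3_swap.
Qed.

Section Contraction.
Variables (G G0 : mgraph) (phi : vert G -> vert G0) (psi : edge G0 -> edge G).
Variables (t : vert G0) (a1 a2 a3 y1 y2 y3 : vert G) (s1 s2 s3 : edge G).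
Variables (x1 x2 x3 : edge G0).
Hypothesis TC : tricon phi psi t a1 a2 a3 y1 y2 y3 s1 s2 s3 x1 x2 x3.
Local Notation T := [set a1; a2; a3].

Lemma vs_psi e : vs e = phi @: vs (psi e).
Proof.
have j := joins_ends (psi e); rewrite (joins_vs (tc_pj TC j)) (joins_vs j).
by rewrite imsetU !imset_set1.
Qed.

Lemma psi_vs e v : v \notin T -> phi v \in vs e -> v \in vs (psi e).
Proof. by move=> vT; rewrite vs_psi => /imsetP[u uv /(tc_inj TC vT)->]. Qed.

Lemma vs_phi e v : v \in vs (psi e) -> phi v \in vs e.
Proof. by move=> h; rewrite vs_psi imset_f. Qed.

Lemma phi_T v : v \in T -> phi v = t.
Proof. by rewrite -(tc_t TC) => /eqP. Qed.

Lemma t_vs e : t \in vs e -> e \in [set x1; x2; x3].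
Proof.
rewrite vs_psi => /imsetP[v ve /esym/eqP]; rewrite (tc_t TC).
have := tc_pnot TC e; have pi := inj_eq (tc_pinj TC).
rewrite !inE !negb_or => /andP[/andP[n1 n2] n3] /orP[/orP[]|] /eqP E; rewrite E in ve.
- have := subsetP (tc_i1 TC) (psi e); rewrite in_inc ve => /(_ isT).
  by rewrite !inE (negPf n2) (negPf n3) pi /= => ->.
- have := subsetP (tc_i2 TC) (psi e); rewrite in_inc ve => /(_ isT).
  by rewrite !inE (negPf n1) (negPf n3) pi /= => ->; rewrite orbT.
- have := subsetP (tc_i3 TC) (psi e); rewrite in_inc ve => /(_ isT).
  by rewrite !inE (negPf n1) (negPf n2) pi /= => ->; rewrite !orbT.
Qed.

Lemma vs_x1 : vs x1 = [set t; phi y1].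
Proof.
by rewrite vs_psi (joins_vs (tc_x1 TC)) imsetU !imset_set1 phi_T // !inE eqxx.
Qed.

Lemma neqT : [/\ a1 != a2, a1 != a3 & a2 != a3].
Proof.
by have := tc_neq TC; rewrite /= !inE !negb_or !andbT => /andP[/andP[]].
Qed.

Lemma sT v : v \notin T -> [/\ v \notin vs s1, v \notin vs s2 & v \notin vs s3].
Proof.
rewrite (joins_vs (tc_s1 TC)) (joins_vs (tc_s2 TC)) (joins_vs (tc_s3 TC)).
by rewrite !inE !negb_or => /andP[/andP[-> ->] ->].
Qed.

Lemma psi_ex g v : v \notin T -> v \in vs g -> exists e, psi e = g.
Proof.
move=> /sT[h1 h2 h3] vg; apply: (tc_pim TC); rewrite !inE !negb_or.
by apply/andP; split; [apply/andP; split|]; apply: contraTneq vg => ->.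
Qed.

Lemma x12_neq : x1 != x2.
Proof.
have [n12 _ _] := neqT; have [yT _ _] := tc_y TC.
apply/eqP=> E; have := joins_l (tc_x2 TC); rewrite -E (joins_vs (tc_x1 TC)).
by rewrite !inE eq_sym (negPf n12) /= => /eqP E2; move: yT; rewrite -E2 !inE eqxx orbT.
Qed.

Lemma phi_cases v0 : v0 = t \/ exists2 v, v \notin T & phi v = v0.
Proof.
have [v E] := tc_onto TC v0; have [vT|vT] := boolP (v \in T); last by right; exists v.
by left; rewrite -E phi_T.
Qed.

(** [x1] is the only edge of [M0] at [t], so in the triangle the image of [M0] covers [a1] alone,
    and [s1] covers the other two vertices. *)
Lemma lift1 M0 : perfect_matching M0 -> x1 \in M0 -> perfect_matching (s1 |: psi @: M0).
Proof.
move=> pm xM; have [n12 n13 n23] := neqT; have [yT _ _] := tc_y TC.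
have tx : t \in vs x1 by rewrite vs_x1 !inE eqxx.
have Mt e v : e \in M0 -> v \in T -> v \in vs (psi e) -> e = x1.
  move=> eM vT /vs_phi; rewrite (phi_T vT) => te.
  exact: (pm_uniq pm (in_setT t) eM xM te tx).
have s1T v : v \in vs s1 -> v \in T /\ v != a1.
  by rewrite (joins_vs (tc_s1 TC)) !inE => /orP[] /eqP->; split; rewrite ?eqxx ?orbT // eq_sym.
have nx v : v \in T -> v != a1 -> v \notin vs (psi x1).
  move=> vT va; rewrite (joins_vs (tc_x1 TC)) !inE negb_or va.
  by apply: contraTneq vT => ->.
apply/pm_onP; split=> [g _|v _]; first exact: subsetT.
have [vT|vT] := boolP (v \in T); last first.
  have [e eM ve] := pm_cover pm (in_setT (phi v)).
  exists (psi e); first by rewrite in_setU1 imset_f ?orbT.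
  split; first exact: psi_vs.
  move=> g; rewrite in_setU1 => /orP[/eqP->|/imsetP[h hM ->]] vg.
    by have [] := sT vT; rewrite vg.
  by congr psi; apply: (pm_uniq pm (in_setT (phi v)) hM eM (vs_phi vg) ve).
have [E|va] := eqVneq v a1.
  exists (psi x1); first by rewrite in_setU1 imset_f ?orbT.
  split; first by rewrite E (joins_l (tc_x1 TC)).
  move=> g; rewrite in_setU1 => /orP[/eqP->|/imsetP[h hM ->]] vg.
    by have [_] := s1T _ vg; rewrite E eqxx.
  by rewrite (Mt _ _ hM vT vg).
exists s1; first by rewrite setU11.
split.
  rewrite (joins_vs (tc_s1 TC)) !inE; by move: vT va; rewrite !inE => /orP[/orP[->//|->//]|->]; rewrite ?orbT.
move=> g; rewrite in_setU1 => /orP[/eqP//|/imsetP[h hM ->]] vg.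
by have := nx _ vT va; rewrite -(Mt _ _ hM vT vg) vg.
Qed.

(** [s1] covers [a2] and [a3], which excludes the other triangle edges, so [a1] must leave by
    [psi x1]. *)
Lemma exit1 M : perfect_matching M -> s1 \in M -> psi x1 \in M.
Proof.
move=> pm sM; have [n12 n13 n23] := neqT.
have s1a2 : a2 \in vs s1 := joins_l (tc_s1 TC).
have s1a3 : a3 \in vs s1 := joins_r (tc_s1 TC).
have [g gM ag] := pm_cover pm (in_setT a1).
have := subsetP (tc_i1 TC) g; rewrite in_inc ag => /(_ isT).
have ns : a1 \notin vs s1.
  by rewrite (joins_vs (tc_s1 TC)) !inE negb_or n12.
rewrite !inE => /orP[/orP[]|] /eqP E; last by rewrite -E.
  have a3g : a3 \in vs g by rewrite E (joins_r (tc_s2 TC)).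
  by rewrite (pm_uniq pm (in_setT a3) gM sM a3g s1a3) (negPf ns) in ag.
have a2g : a2 \in vs g by rewrite E (joins_r (tc_s3 TC)).
by rewrite (pm_uniq pm (in_setT a2) gM sM a2g s1a2) (negPf ns) in ag.
Qed.

Lemma proj1 M : perfect_matching M -> s1 \in M -> perfect_matching [set e | psi e \in M].
Proof.
move=> pm sM; have xM := exit1 pm sM.
have s1a2 : a2 \in vs s1 := joins_l (tc_s1 TC).
have s1a3 : a3 \in vs s1 := joins_r (tc_s1 TC).
apply/pm_onP; split=> [g _|v0 _]; first exact: subsetT.
have [->|[v vT <-]] := phi_cases v0.
  exists x1; first by rewrite inE.
  split; first by rewrite vs_x1 !inE eqxx.
  move=> e; rewrite inE => eM /t_vs; rewrite !inE => /orP[/orP[]|] /eqP// E; rewrite E in eM.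
    have := pm_uniq pm (in_setT a2) eM sM (joins_l (tc_x2 TC)) s1a2.
    by have := tc_pnot TC x2; rewrite !inE !negb_or => /andP[/andP[/eqP]].
  have := pm_uniq pm (in_setT a3) eM sM (joins_l (tc_x3 TC)) s1a3.
  by have := tc_pnot TC x3; rewrite !inE !negb_or => /andP[/andP[/eqP]].
have [g gM vg] := pm_cover pm (in_setT v).
have [e E] := psi_ex vT vg.
rewrite -E in gM vg; exists e; first by rewrite inE.
split; first exact: vs_phi.
move=> e'; rewrite inE => eM' /(psi_vs vT) ve'; apply: (tc_pinj TC).
exact: (pm_uniq pm (in_setT v) eM' gM ve' vg).
Qed.

(* A matching leaving the triangle three times becomes one of [G0] by using [k]
   instead of [x1] and [x3]. *)
Lemma proj3 M k : x1 != x2 -> x2 != x3 -> perfect_matching M -> s1 \notin M -> s2 \notin M -> s3 \notin M ->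
  joins k (phi y1) (phi y3) ->
  perfect_matching (k |: ([set e | psi e \in M] :\: [set x1; x3])).
Proof.
move=> n12x n23x pm m1 m2 m3 jk; have [yT1 yT2 yT3] := tc_y TC.
have cov a x : inc a \subset [set s1; s2; s3; psi x] -> psi x \in M.
  move=> /subsetP si; have [g gM ag] := pm_cover pm (in_setT a).
  have := si g; rewrite in_inc ag => /(_ isT); rewrite !inE.
  by case/orP=> [/orP[/orP[]|]|] /eqP E; move: gM; rewrite E ?(negPf m1) ?(negPf m2) ?(negPf m3).
have M1 : psi x1 \in M.
  apply: (cov a1); apply: subset_trans (tc_i1 TC) _.
  by rewrite setSU // (set3_rot s1) subsetUl.
have M2 : psi x2 \in M.
  apply: (cov a2); apply: subset_trans (tc_i2 TC) _; rewrite setSU //.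
  by rewrite setSU // subsetUl.
have M3 : psi x3 \in M.
  by apply: (cov a3); apply: subset_trans (tc_i3 TC) _; rewrite setSU // subsetUl.
have t2 : t \in vs x2.
  by rewrite -(phi_T (_ : a2 \in T)) ?vs_phi ?(joins_l (tc_x2 TC)) // !inE eqxx orbT.
have px e v x y : joins (psi x) v y -> psi x \in M -> psi e \in M -> y \in vs (psi e) -> e = x.
  move=> j xM eM ve; apply: (tc_pinj TC).
  exact: (pm_uniq pm (in_setT y) eM xM ve (joins_r j)).
have tk : t \notin vs k.
  rewrite (joins_vs jk) !inE negb_or ![t == _]eq_sym !(tc_t TC).
  by rewrite yT1 yT3.
have x21 : x2 \notin [set x1; x3] by rewrite !inE negb_or eq_sym n12x n23x.
apply/pm_onP; split=> [g _|v0 _]; first exact: subsetT.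
have [->|[v vT <-]] := phi_cases v0.
  exists x2; first by rewrite in_setU1 in_setD x21 inE M2 orbT.
  split=> // e; rewrite in_setU1 => /orP[/eqP->|]; first by rewrite (negPf tk).
  by case/setDP=> _ n13' /t_vs; move: n13'; rewrite !inE negb_or => /andP[/negPf-> /negPf->];
     rewrite orbF => /eqP.
have [/set2P vy|vy] := boolP (v \in [set y1; y3]).
  exists k; first by rewrite setU11.
  split; first by rewrite (joins_vs jk); case: vy => ->; rewrite !inE eqxx ?orbT.
  move=> e; rewrite in_setU1 => /orP[/eqP//|/setDP[]]; rewrite inE => eM ne.
  move=> /(psi_vs vT) ve; case/negP: ne; case: vy => E; rewrite E in ve.
    by rewrite (px _ _ _ _ (tc_x1 TC) M1 eM ve) !inE eqxx.
  by rewrite (px _ _ _ _ (tc_x3 TC) M3 eM ve) !inE eqxx orbT.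
have [g gM vg] := pm_cover pm (in_setT v).
have [e E] := psi_ex vT vg.
rewrite -E in gM vg.
have aT : [/\ a1 \in T, a2 \in T & a3 \in T] by rewrite !inE !eqxx !orbT.
case: aT => a1T a2T a3T.
exists e.
  suff ne : e \notin [set x1; x3] by rewrite in_setU1 in_setD ne inE gM orbT.
  move: vy; rewrite !inE !negb_or => /andP[v1 v3].
  apply/andP; split; apply: contraTneq vg => ->.
    rewrite (joins_vs (tc_x1 TC)) !inE negb_or v1 andbT.
    by apply: contraNneq vT => ->.
  rewrite (joins_vs (tc_x3 TC)) !inE negb_or v3 andbT.
  by apply: contraNneq vT => ->.
split; first exact: vs_phi.
move=> e'; rewrite in_setU1 => /orP[/eqP->|/setDP[]].
  rewrite (joins_vs jk) !inE => vk; case/negP: vy; rewrite !inE.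
  by case/orP: vk => /eqP /(tc_inj TC vT)->; rewrite eqxx ?orbT.
rewrite inE => eM' _ /(psi_vs vT) ve'; apply: (tc_pinj TC).
exact: (pm_uniq pm (in_setT v) eM' gM ve' vg).
Qed.

End Contraction.

Section ContractionNbs.
Variables (G G0 : mgraph) (phi : vert G -> vert G0) (psi : edge G0 -> edge G).
Variables (t : vert G0) (a1 a2 w y1 y2 y3 : vert G) (s1 s2 e1 e2 h : edge G).
Variables (x1 x2 x3 f2 : edge G0) (A : {set vert G}).
Hypothesis TC : tricon phi psi t a1 a2 w y1 y2 y3 s1 s2 e1 x1 x2 x3.
Hypothesis HN : nbs A e1 e2.
Hypothesis wA : w \notin A.
Hypothesis we2 : w \notin vs e2.
Hypothesis f2E : psi f2 = e2.
Hypothesis hD : h \notin [set e1; e2].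
Hypothesis jh : joins h y1 y3.
Hypothesis ge4 : 4 <= #|A|.
Local Notation T := [set a1; a2; w].
Local Notation D := [set e1; e2].
Local Notation N := (nb [set e1; e2]).
Local Notation N0 := (nb [set x3; f2]).

Let C1 := nbs_C1 HN. Let C2 := nbs_C2 HN. Let C3 := nbs_C3 HN.

Lemma tn_e1 : vs e1 = [set a1; a2].
Proof. exact: joins_vs (tc_s3 TC). Qed.

Lemma tn_a : a1 \in A /\ a2 \in A.
Proof.
by have := nbs_e1 HN; rewrite tn_e1 subUset !sub1set => /andP[].
Qed.

Lemma tn_x3D : psi x3 \notin D.
Proof.
have := tc_pnot TC x3; rewrite !inE !negb_or => /andP[_ ->] /=.
apply: contraNneq we2 => <-; exact: joins_l (tc_x3 TC).
Qed.

Lemma tn_y3 : y3 \in A.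
Proof. by rewrite (cross_joins (nbs_cross HN) tn_x3D (tc_x3 TC)). Qed.

Lemma tn_wN v g : g \notin D -> joins g v w -> v \in [set a1; a2; y3].
Proof.
move=> gD j; have := subsetP (tc_i3 TC) g; rewrite in_inc (joins_r j) => /(_ isT).
rewrite joinsC in j; rewrite !inE => /orP[/orP[]|] /eqP E; rewrite E in j.
- by have j' := tc_s1 TC; rewrite joinsC in j'; rewrite (joins_injr j j') eqxx orbT.
- by have j' := tc_s2 TC; rewrite joinsC in j'; rewrite (joins_injr j j') eqxx.
- by rewrite (joins_injr j (tc_x3 TC)) eqxx !orbT.
Qed.

Lemma tn_wN' (X : {set vert G}) : a1 \notin X -> a2 \notin X -> y3 \notin X -> w \notin N X.
Proof.
move=> n1 n2 n3; apply/negP=> /nbP[g [x [gD xX j]]].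
have := tn_wN gD j; rewrite !inE => /orP[/orP[]|] /eqP E; move: xX; rewrite E.
- by rewrite (negPf n1).
- by rewrite (negPf n2).
- by rewrite (negPf n3).
Qed.

Lemma tn_N1 : N [set a1] \subset [set w; y1].
Proof.
apply/subsetP=> v /nb1P[g gD j].
have := subsetP (tc_i1 TC) g; rewrite in_inc (joins_l j) => /(_ isT).
rewrite !inE => /orP[/orP[]|] /eqP E; rewrite ?E in j gD.
- by rewrite (joins_injr j (tc_s2 TC)) eqxx.
- by rewrite !inE eqxx in gD.
- by rewrite (joins_injr j (tc_x1 TC)) eqxx orbT.
Qed.

(** Both ends of [e1] collapse to [t], which stays in the class of [A], and [w] leaves the other
    class. The edge [x3] now has both ends in [A0] and takes over the role of [e1]. *)
Definition A0 := phi @: A.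

Lemma tn_A0 v : v \notin T -> (phi v \in A0) = (v \in A).
Proof.
move=> vT; apply/imsetP/idP=> [[u uA /(tc_inj TC vT)->]//|vA]; by exists v.
Qed.

Lemma tn_T v : v \in A -> v \notin [set a1; a2] -> v \notin T.
Proof.
move=> vA; rewrite !inE !negb_or => ->; by apply: contraNneq wA => <-.
Qed.

Lemma tn_TB v : v \notin A -> v != w -> v \notin T.
Proof.
have [i1 i2] := tn_a; move=> vA vw; rewrite !inE !negb_or vw andbT.
by apply/andP; split; apply: contraNneq vA => ->.
Qed.

Lemma tn_phit v : v \notin T -> phi v != t.
Proof. by rewrite (tc_t TC). Qed.

Lemma tn_tA0 : t \in A0.
Proof.
have [i1 _] := tn_a; apply/imsetP; exists a1 => //.
by rewrite (phi_T TC) // !inE eqxx.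
Qed.

Lemma tn_card (K : {set vert G}) : [disjoint K & T] -> #|phi @: K| = #|K|.
Proof.
move=> dj; apply: card_in_imset => u v uK _; apply: (tc_inj TC).
by rewrite (disjointFr dj uK).
Qed.

Lemma tn_A0C : ~: A0 = phi @: (~: A :\ w).
Proof.
apply/setP=> v0; rewrite in_setC; have [->|[v vT <-]] := phi_cases TC v0.
  rewrite tn_tA0; apply/esym/negbTE/imsetP=> -[v /setD1P[vw]]; rewrite inE => vA /eqP.
  by rewrite eq_sym (negPf (tn_phit (tn_TB vA vw))).
rewrite (tn_A0 vT); apply/idP/imsetP=> [vA|[u /setD1P[_]]].
  exists v => //; rewrite !inE vA andbT; apply: contraNneq vT => ->.
  by rewrite !inE eqxx orbT.
by rewrite inE => uA /(tc_inj TC vT)->.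
Qed.

Lemma tn_cardC : #|~: A0| + 1 = #|A|.
Proof.
rewrite tn_A0C tn_card.
  have := cardsD1 w (~: A); rewrite inE wA -(nbs_card HN); clear; lia.
rewrite disjoints_subset; apply/subsetP=> v /setD1P[vw]; rewrite !in_setC => vA.
exact: tn_TB.
Qed.

Lemma tn_split : A = a1 |: (a2 |: (A :\: vs e1)).
Proof.
have [i1 i2] := tn_a; apply/setP=> v; rewrite tn_e1 !inE.
have [->|_] := eqVneq v a1 => //; by have [->|_] := eqVneq v a2.
Qed.

Lemma tn_cardA : #|A0| + 1 = #|A|.
Proof.
have E : A0 = t |: phi @: (A :\: vs e1).
  rewrite /A0 {1}tn_split !imsetU !imset_set1 !(phi_T TC) ?setUA ?setUid //;
  by rewrite !inE eqxx ?orbT.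
have dj : [disjoint A :\: vs e1 & T].
  rewrite disjoints_subset; apply/subsetP=> v /setDP[vA]; rewrite tn_e1 in_setC.
  exact: tn_T.
rewrite E cardsU1 (tn_card dj).
have -> : t \notin phi @: (A :\: vs e1).
  apply/imsetP=> -[v vA /eqP]; rewrite eq_sym (tc_t TC).
  by rewrite (disjointFr dj vA).
by rewrite -(cardAe1 HN) /=; clear; lia.
Qed.

Lemma tn_f2 : vs f2 = phi @: vs e2.
Proof. by rewrite (vs_psi TC) f2E. Qed.

Lemma tn_e2T : [disjoint vs e2 & T].
Proof.
rewrite disjoints_subset; apply/subsetP=> v v2; rewrite in_setC.
apply: tn_TB; first by have := subsetP (nbs_e2 HN) _ v2; rewrite inE.
by apply: contraNneq we2 => <-.
Qed.

Section Pre.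
Variable X0 : {set vert G0}.
Hypothesis sX0 : X0 \subset A0.

Let X := [set v in A | phi v \in X0].

Lemma tn_inX v : (v \in X) = (v \in A) && (phi v \in X0).
Proof. by rewrite inE. Qed.

Lemma tn_XA : X \subset A.
Proof. by apply/subsetP=> v; rewrite tn_inX => /andP[]. Qed.

Lemma tn_imX : phi @: X = X0.
Proof.
apply/setP=> v0; apply/imsetP/idP=> [[v]|v0X]; first by rewrite tn_inX => /andP[_ +] ->.
have /imsetP[v vA E] := subsetP sX0 _ v0X.
by exists v; rewrite // tn_inX vA -E.
Qed.

Lemma tn_XnA : X0 != A0 -> X != A.
Proof. by apply: contraNneq => E; rewrite -tn_imX E. Qed.

Lemma tn_at : t \notin X0 -> X \subset A :\: vs e1.
Proof.
move=> tX; apply/subsetP=> v; rewrite tn_inX tn_e1 in_setD => /andP[vA vX].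
rewrite vA andbT; apply: contraTN vX => v12.
by rewrite (phi_T TC) // inE v12.
Qed.

(** Within [A], only [a1] and [a2] are identified. *)
Lemma tn_cardX : #|X| = (t \in X0) + #|X0|.
Proof.
have [tX|tX] := boolP (t \in X0); last first.
  rewrite -[in RHS]tn_imX tn_card // disjoints_subset; apply/subsetP=> v vX.
  have := subsetP (tn_at tX) _ vX; rewrite tn_e1 in_setC => /setDP[]; exact: tn_T.
have [i1 i2] := tn_a; have [n12 _ _] := neqT TC.
have aX a : a \in [set a1; a2] -> a \in X.
  move=> aa; rewrite tn_inX (phi_T TC) ?tX ?andbT; last by rewrite inE aa.
  by apply: (subsetP (nbs_e1 HN)); rewrite tn_e1.
have a1X : a1 \in X by apply: aX; rewrite !inE eqxx.
have a2X : a2 \in X by apply: aX; rewrite !inE eqxx orbT.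
rewrite (cardsD1 a1 X) a1X -tn_imX; congr (_ + _).
have -> : phi @: X = phi @: (X :\ a1).
  rewrite -{1}(setD1K a1X) imsetU imset_set1; apply/setUidPr; rewrite sub1set.
  have -> : phi a1 = phi a2 by rewrite !(phi_T TC) // !inE eqxx ?orbT.
  by apply: imset_f; rewrite !inE eq_sym n12 -tn_inX a2X.
apply/esym/card_in_imset => u v /setD1P[u1 uX] /setD1P[v1 vX] E.
have [uT|uT] := boolP (u \in T); last exact: (tc_inj TC uT E).
have [vT|vT] := boolP (v \in T); last by apply/esym/(tc_inj TC vT).
have TE z : z \in T -> z != a1 -> z \in X -> z = a2.
  rewrite !inE => /orP[/orP[/eqP->|/eqP->//]|/eqP->]; rewrite ?eqxx // => _.
  by rewrite (negPf wA).
by rewrite (TE u) // (TE v).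
Qed.

(** Apart from [w], neighbours of [X] survive the contraction, so the bounds for [X] pass to [X0] up
    to a loss of one. *)
Lemma tn_NK (K : {set vert G}) : K \subset N X -> w \notin K ->
  phi @: K \subset N0 X0 /\ #|phi @: K| = #|K|.
Proof.
move=> sK wK; have KA v : v \in K -> v \notin A.
  by move/(subsetP sK)/(subsetP (N_sub HN tn_XA)); rewrite inE.
have KT v : v \in K -> v \notin T.
  by move=> vK; apply: tn_TB (KA _ vK) _; apply: contraNneq wK => <-.
split; last first.
  by apply: tn_card; rewrite disjoints_subset; apply/subsetP=> v /KT; rewrite in_setC.
apply/subsetP=> _ /imsetP[v vK ->].
have /nbP[g [x [gD xX j]]] := subsetP sK _ vK.
have [e E] := psi_ex TC (KT _ vK) (joins_r j).
move: xX; rewrite tn_inX => /andP[xA xX].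
rewrite -E in j; apply: nbI xX (tc_pj TC j).
rewrite !inE negb_or; apply/andP; split; last first.
  by apply: contraNneq gD => ee; rewrite -E ee f2E !inE eqxx orbT.
apply/eqP=> ee; rewrite ee in j.
have := joins_l (tc_x3 TC); rewrite (joins_vs j) !inE => /orP[]/eqP wE.
  by rewrite -wE (negPf wA) in xA.
by rewrite wE vK in wK.
Qed.

End Pre.

Lemma tn_C1 (X0 : {set vert G0}) : X0 \subset A0 -> X0 != set0 -> X0 != A0 ->
  #|X0| < #|N0 X0|.
Proof.
move=> sX nz nA; pose X := [set v in A | phi v \in X0].
have sK : N X :\ w \subset N X := subsetDl _ _.
have wK : w \notin N X :\ w by rewrite in_setD1 eqxx.
have [/subset_leq_card le E] := tn_NK (X0 := X0) sK wK; rewrite E in le.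
have cX := tn_cardX sX; rewrite -/X in cX.
have cw := cardsD1 w (N X).
have nzX : X != set0.
  by rewrite -card_gt0 cX addn_gt0 [X in _ || X]card_gt0 nz orbT.
(* If [t] is in [X0], the extra vertex of [X] pays for [w]; otherwise [X] avoids [e1] and the
   surplus two of [nbs_C3] does. *)
have [tX|tX] := boolP (t \in X0); rewrite ?tX ?(negPf tX) in cX.
  have := C1 (tn_XA _) nzX (tn_XnA sX nA); rewrite -/X.
  by move: cX cw le; case: (w \in _) => /=; clear; lia.
have := C3 (tn_at tX) nzX; rewrite -/X.
by move: cX cw le; case: (w \in _) => /=; clear; lia.
Qed.

Lemma tn_C2 (X0 : {set vert G0}) : X0 \subset A0 -> #|X0| + 2 <= #|A0| ->
  #|X0| <= #|N0 X0 :\: vs f2|.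
Proof.
move=> sX leX; pose X := [set v in A | phi v \in X0].
pose K := N X :\: vs e2 :\ w.
have sK : K \subset N X by rewrite (subset_trans (subsetDl _ _)) ?subsetDl.
have wK : w \notin K by rewrite in_setD1 eqxx.
have [sim cim] := tn_NK (X0 := X0) sK wK.
have le : #|K| <= #|N0 X0 :\: vs f2|.
  rewrite -cim; apply/subset_leq_card/subsetP=> v0 v0K.
  rewrite in_setD (subsetP sim) // andbT tn_f2.
  case/imsetP: v0K => v /setD1P[vw /setDP[vN v2]] ->.
  apply/imsetP=> -[u u2 /esym E].
  have uT : u \notin T by rewrite (disjointFr tn_e2T u2).
  by rewrite -(tc_inj TC uT E) u2 in v2.
have cX := tn_cardX sX; rewrite -/X in cX.
have cA0 := tn_cardA.
have cw := cardsD1 w (N X :\: vs e2); rewrite -/K in cw.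
have [tX|tX] := boolP (t \in X0); rewrite ?tX ?(negPf tX) in cX.
  have := C2 (tn_XA X0); rewrite -/X => /(_ ltac:(move: cX leX cA0; clear; lia)).
  by move: cX cw le; case: (w \in _) => /=; clear; lia.
have sXe := tn_at tX; rewrite -/X in sXe.
have [n1 n2] : a1 \notin X /\ a2 \notin X.
  by split; apply/negP=> /(subsetP sXe); rewrite tn_e1 !inE eqxx ?orbT.
(* If [y3] is in [X], then [X] sees [w], and no extra vertex pays for it. Adding [a1] to [X]
   supplies one without a new neighbour: [y3] already sees [w], and it sees [y1] through the rung
   [h]. *)
have [yX|yX] := boolP (y3 \in X).
  have [i1 _] := tn_a.
  have sX1 : a1 |: X \subset A by rewrite subUset sub1set i1 tn_XA.
  have c1 : #|a1 |: X| = #|X|.+1 by rewrite cardsU1 n1.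
  have := C2 sX1; rewrite c1 => /(_ ltac:(move: cX leX cA0; clear; lia)).
  have -> : N (a1 |: X) = N X.
    rewrite nbU; apply/setUidPr; apply: subset_trans tn_N1 _; rewrite subUset !sub1set.
    apply/andP; split; first by apply: nbI tn_x3D yX _; rewrite joinsC (tc_x3 TC).
    by apply: nbI hD yX _; rewrite joinsC.
  by move: cX cw le; case: (w \in _) => /=; clear; lia.
have wN : w \notin N X :\: vs e2 by rewrite in_setD negb_and tn_wN' ?orbT.
have := C2 (tn_XA X0); rewrite -/X => /(_ ltac:(move: cX leX cA0; clear; lia)).
by move: cX cw le; rewrite (negPf wN) /=; clear; lia.
Qed.

Lemma tn_vsx3 : vs x3 = [set t; phi y3].
Proof. exact: vs_x1 (tricon_rot (tricon_rot TC)). Qed.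

(** Avoiding the ends of [x3] keeps [a1], [a2] and [y3] out of [X], so [w] is not among its
    neighbours and nothing is lost. *)
Lemma tn_C3 (X0 : {set vert G0}) : X0 \subset A0 :\: vs x3 -> X0 != set0 ->
  #|X0| + 2 <= #|N0 X0|.
Proof.
rewrite tn_vsx3 setDE subsetI => /andP[sX s3] nz; pose X := [set v in A | phi v \in X0].
have tX : t \notin X0 by apply/negP=> /(subsetP s3); rewrite !inE eqxx.
have yX : y3 \notin X.
  by rewrite (tn_inX X0); apply/negP=> /andP[_ /(subsetP s3)]; rewrite !inE eqxx orbT.
have sXe := tn_at tX; rewrite -/X in sXe.
have [n1 n2] : a1 \notin X /\ a2 \notin X.
  by split; apply/negP=> /(subsetP sXe); rewrite tn_e1 !inE eqxx ?orbT.
have [/subset_leq_card le E] := tn_NK (X0 := X0) (subxx _) (tn_wN' n1 n2 yX).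
rewrite E -/X in le.
have cX := tn_cardX sX; rewrite -/X (negPf tX) add0n in cX.
have nzX : X != set0 by rewrite -card_gt0 cX card_gt0.
have := C3 sXe nzX; move: cX le; clear; lia.
Qed.

Lemma contraction_nbs : nbs A0 x3 f2.
Proof.
split.
- rewrite tn_vsx3 subUset !sub1set tn_tA0 tn_A0 ?tn_y3 //.
  by case: (tc_y TC).
- rewrite tn_A0C tn_f2; apply/imsetS/subsetP=> v v2; rewrite in_setD1 (subsetP (nbs_e2 HN)) // andbT.
  by apply: contraNneq we2 => <-.
- rewrite tn_vsx3 cards2 eq_sym tn_phit //; by case: (tc_y TC).
- by rewrite tn_f2 tn_card ?tn_e2T // (nbs_c2 HN).
- move=> e; rewrite !inE negb_or => /andP[ex ef].
  have pD : psi e \notin D.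
    have := tc_pnot TC e; rewrite !inE !negb_or => /andP[_ ->] /=.
    by rewrite -f2E (inj_eq (tc_pinj TC)).
  have [u [v [j uA vA]]] := edge_ends HN pD.
  have vw : v != w.
    apply/eqP=> vw; have := subsetP (tc_i3 TC) (psi e); rewrite in_inc -vw (joins_r j) => /(_ isT).
    have := tc_pnot TC e; rewrite !inE !negb_or => /andP[/andP[/negPf-> /negPf->] _] /=.
    by rewrite (inj_eq (tc_pinj TC)) (negPf ex).
  have pv : phi v \notin A0 by rewrite tn_A0 // tn_TB.
  have pu : phi u \in A0 by apply: imset_f.
  by case/orP: (tc_pj TC j) => /eqP->; rewrite /= pu (negPf pv).
- by apply/eqP; rewrite -(eqn_add2r 1) tn_cardA tn_cardC.
- by have := tn_cardA; move: ge4; clear; lia.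
- exact: tn_C1.
- exact: tn_C2.
- exact: tn_C3.
Qed.

End ContractionNbs.

(** * Equality in the bound *)

(* The triangle [a1 a2 w] through [e1] with its three outgoing edges [gi]. *)
Record wdata (G : mgraph) (A : {set vert G}) (e1 e2 : edge G)
    (a1 a2 w y1 y2 y3 : vert G) (s1 s2 g1 g2 g3 : edge G) : Prop := Wdata {
  wd_w : w \in ~: A :\: vs e2;
  wd_e1 : joins e1 a1 a2;
  wd_a : [/\ a1 \in A, a2 \in A & a1 != a2];
  wd_s1 : joins s1 a2 w; wd_s2 : joins s2 a1 w;
  wd_g1 : joins g1 a1 y1; wd_g2 : joins g2 a2 y2; wd_g3 : joins g3 w y3;
  wd_D : [/\ s1 \notin [set e1; e2], s2 \notin [set e1; e2], g1 \notin [set e1; e2],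
             g2 \notin [set e1; e2] & g3 \notin [set e1; e2]];
  wd_y : [/\ y1 != w, y2 != w, y1 != y2, y3 != a1 & y3 != a2];
  wd_N1 : nb [set e1; e2] [set a1] = [set w; y1];
  wd_N2 : nb [set e1; e2] [set a2] = [set w; y2];
  wd_N3 : nb [set e1; e2] [set w] = [set a1; a2; y3];
  wd_i1 : inc a1 \subset [set s2; e1; g1];
  wd_i2 : inc a2 \subset [set s1; e1; g2];
  wd_i3 : inc w \subset [set s1; s2; g3] }.

Lemma wdata_swap G A e1 e2 a1 a2 w y1 y2 y3 s1 s2 g1 g2 g3 :
  @wdata G A e1 e2 a1 a2 w y1 y2 y3 s1 s2 g1 g2 g3 ->
  wdata A e1 e2 a2 a1 w y2 y1 y3 s2 s1 g2 g1 g3.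
Proof.
case=> ? j [? ? n] ? ? ? ? ? [? ? ? ? ?] [? ? ny ? ?] ? ? N3 ? ? i3.
split=> //.
- by rewrite joinsC.
- by split; rewrite // eq_sym.
- by split; rewrite // eq_sym.
- by rewrite N3 [[set a1; a2]]setUC.
- by rewrite [[set s2; s1]]setUC.
Qed.

Lemma vs_eq_joins (G : mgraph) (g : edge G) x y : vs g = [set x; y] -> joins g x y.
Proof.
move=> E; have : x \in vs g by rewrite E !inE eqxx.
case/vs_joins=> z j; suff -> : y = z by [].
move: E; rewrite (joins_vs j) => /setP E.
have := E y; have := E z; rewrite !inE !eqxx !orbT => /esym h /orP[]/eqP// yx.
by move: h; rewrite -yx orbb => /eqP.
Qed.

Section EqData.
Variables (G : mgraph) (A : {set vert G}) (e1 e2 : edge G).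
Hypothesis HN : nbs A e1 e2.
Hypothesis R0 : vs e1 :|: vs e2 \subset remdeg0 G.
Local Notation D := [set e1; e2].
Local Notation N := (nb [set e1; e2]).

Lemma remdeg0P (v : vert G) g : v \in remdeg0 G -> v \in vs g -> ~~ removable g.
Proof.
rewrite inE => /eqP r vg; apply/negP=> rg; move/setP/(_ g): r.
by rewrite in_rinc vg rg in_set0.
Qed.

Lemma simple_at a b g g' : a \in remdeg0 G -> g \notin D -> g' \notin D ->
  joins g a b -> joins g' a b -> g = g'.
Proof.
move=> a0 gD gD' j j'; apply/eqP/negPn/negP=> ne.
have := remdeg0P a0 (joins_l j); case/negP.
have [aA|aA] := boolP (a \in A).
  exact: (parallel_removable HN gD gD' ne j j').
rewrite joinsC in j; rewrite joinsC in j'.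
exact: (parallel_removable HN gD gD' ne j j' (joinsA HN gD j aA)).
Qed.

(** [w] is exceptional for the opposite class, which gives the triangle with [e1]. The ends of [e1]
    meet no removable edge, hence no parallel edges, so they have only three edges each. *)
Lemma wdata_exists w : w \in ~: A :\: vs e2 -> w \in remdeg0 G ->
  exists a1 a2 y1 y2 y3 s1 s2 g1 g2 g3, wdata A e1 e2 a1 a2 w y1 y2 y3 s1 s2 g1 g2 g3.
Proof.
move=> wB w0.
have [|a1 [a2 [y3 [s2 [s1 [g3]]]]]] := exceptional (nbs_sym HN) wB.
  by apply/eqP; move: w0; rewrite inE.
case=> j2 j1 j3 incw n12 n1 n2 y3n e1E; rewrite [[set e2; e1]]setUC => Nw c1 c2 NI.
have [wB' we2] := setDP wB.
have wA : w \notin A by move: wB'; rewrite inE.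
have aA a : a \in vs e1 -> a \in A by apply: (subsetP (nbs_e1 HN)).
have a1A : a1 \in A by apply: aA; rewrite e1E !inE eqxx.
have a2A : a2 \in A by apply: aA; rewrite e1E !inE eqxx orbT.
have wD g : g \in inc w -> g \notin D.
  move=> gw; have := inc_H (nbs_sym HN) wB gw; by rewrite setUC.
have s1D : s1 \notin D by apply: wD; rewrite incw !inE eqxx orbT.
have s2D : s2 \notin D by apply: wD; rewrite incw !inE eqxx.
have g3D : g3 \notin D by apply: wD; rewrite incw !inE eqxx !orbT.
have other a : w \in N [set a] -> #|N [set a]| = 2 -> exists2 y, y != w & N [set a] = [set w; y].
  move=> wN c; have := cardsD1 w (N [set a]); rewrite wN c => -[] /esym/eqP/cards1P[y E].
  exists y; last by rewrite -(setD1K wN) E.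
  by have : y \in [set y] := set11 y; rewrite -E => /setD1P[].
have wN : w \in N [set a1] :&: N [set a2] by rewrite NI inE.
have [wN1 wN2] := setIP wN.
have [y1 y1w N1] := other _ wN1 c1; have [y2 y2w N2] := other _ wN2 c2.
have [g1 g1D j4] : exists2 g, g \notin D & joins g a1 y1.
  by apply/nb1P; rewrite N1 !inE eqxx orbT.
have [g2 g2D j5] : exists2 g, g \notin D & joins g a2 y2.
  by apply/nb1P; rewrite N2 !inE eqxx orbT.
have incA a b y s g : a \in vs e1 -> vs e1 = [set a; b] -> N [set a] = [set w; y] ->
    s \notin D -> joins s w a -> g \notin D -> joins g a y -> inc a \subset [set s; e1; g].
  move=> a1' E1 Na sD js gD jg; apply/subsetP=> k; rewrite in_inc => ak.
  have a0 : a \in remdeg0 G by apply: (subsetP R0); rewrite in_setU a1'.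
  have [kD|kD] := boolP (k \in D).
    case/set2P: kD => E; first by rewrite E !inE eqxx orbT.
    by have := subsetP (nbs_e2 HN) a; rewrite -E ak in_setC aA // => /(_ isT).
  have [v jk] := vs_joins ak.
  have : v \in N [set a] by apply: nbI kD _ jk; rewrite inE.
  rewrite Na => /set2P[] E; rewrite E in jk.
    by rewrite joinsC in js; rewrite (simple_at a0 kD sD jk js) !inE eqxx.
  by rewrite (simple_at a0 kD gD jk jg) !inE eqxx !orbT.
exists a1, a2, y1, y2, y3, s1, s2, g1, g2, g3; split=> //; rewrite 1?joinsC //.
- by rewrite joinsC; apply: vs_eq_joins.
- split=> //; last 2 first.
  + by rewrite eq_sym.
  + by rewrite eq_sym.
  apply/eqP=> E; have : y1 \in N [set a1] :&: N [set a2].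
    by rewrite in_setI N1 N2 E !inE eqxx orbT.
  by rewrite NI inE (negPf y1w).
- apply: (incA a1 a2 y1) => //; by rewrite e1E !inE eqxx.
- apply: (incA a2 a1 y2) => //; [by rewrite e1E !inE eqxx orbT | by rewrite setUC].
- by rewrite incw [[set s2; s1]]setUC.
Qed.

End EqData.

Section Equality.
Variables (G : mgraph) (A : {set vert G}) (e1 e2 : edge G).
Variables (a1 a2 w y1 y2 y3 : vert G) (s1 s2 g1 g2 g3 : edge G).
Hypothesis HN : nbs A e1 e2.
Hypothesis R0 : vs e1 :|: vs e2 \subset remdeg0 G.
Hypothesis Hz : exists2 z, z \in A :\: vs e1 & z \in remdeg0 G.
Hypothesis Hd : forall v : vert G, #|rinc v| <= 1.
Hypothesis ge4 : 4 <= #|A|.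
Hypothesis W : wdata A e1 e2 a1 a2 w y1 y2 y3 s1 s2 g1 g2 g3.
Implicit Types (X V : {set vert G}) (M : {set edge G}).
Local Notation D := [set e1; e2].
Local Notation N := (nb [set e1; e2]).

Let HS := nbs_sym HN.
Let C1 := nbs_C1 HN. Let C2 := nbs_C2 HN. Let C3 := nbs_C3 HN.

Lemma eq_e1 : vs e1 = [set a1; a2].
Proof. exact: joins_vs (wd_e1 W). Qed.

Lemma eq_wA : w \notin A.
Proof. by have /setDP[] := wd_w W; rewrite inE. Qed.

Lemma eq_yA : [/\ y1 \notin A, y2 \notin A & y3 \in A].
Proof.
have [i1 i2 _] := wd_a W; have [_ _ d1 d2 d3] := wd_D W.
rewrite (joinsB HN d1 (wd_g1 W)) // (joinsB HN d2 (wd_g2 W)) //; split=> //.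
by have j := wd_g3 W; rewrite joinsC in j; apply: (joinsA HN d3 j eq_wA).
Qed.

(** Each tight set at [b] leaves out an end of [e1]; this end is adjacent to [w], so [w] would lie
    in both sets [Pt], but these are disjoint. *)
Lemma k2B_le1 b : b \in ~: A :\: vs e2 -> b != w -> #|k2edges e2 b| <= 1.
Proof.
move=> bB bw; rewrite leqNgt; apply/negP=> /card_gt1P[e [e' [k k' ne]]].
have [v [X [? [? [? [j K]]]]]] := k2edgesP HS bB k.
have [v' [X' [? [? [? [j' K']]]]]] := k2edgesP HS bB k'.
have b2 : b \notin vs e2 by case/setDP: bB.
have tX := k2_tight K; have tX' := k2_tight K'.
have dQ := two_tight_Q HS tX tX' ne b2; have dP := two_tight_P HS tX tX' ne b2.
have wP x f Y u : tight (~: A) e2 e1 f b u Y -> x \in vs e1 ->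
    x \in Qt (~: A) e2 e1 f Y -> w \in Pt (~: A) Y.
  move=> tY x1 xQ; have : w \in b |: Pt (~: A) Y.
    apply: (subsetP (tight_NQ HS tY)); rewrite [[set e2; e1]]setUC.
    apply: (subsetP (nbS _ (_ : [set x] \subset _))); first by rewrite sub1set.
    by move: x1; rewrite eq_e1 => /set2P[] ->; rewrite ?(wd_N1 W) ?(wd_N2 W) !inE eqxx.
  by rewrite in_setU1 eq_sym (negPf bw).
have [x x1 xQ] := tight_Qe2 HS tX; have [x' x1' xQ'] := tight_Qe2 HS tX'.
by have := disjointFr dP (wP _ _ _ _ tX x1 xQ); rewrite (wP _ _ _ _ tX' x1' xQ').
Qed.

Lemma forced12 g : forced1 e2 g -> forced1 e1 g.
Proof. by move=> f M pm e1M; apply: f => //; apply: (pm_e1_e2 HN). Qed.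

(** [b] has at least three edges, of which at most one is removable and at most one is in [k2edges],
    so one is forced. A neighbour [c] other than the forced partner and the prescribed [a] lies
    outside [V], because the forced edge is the only one from [V] to [b]. *)
Lemma k1_at b a : b \in ~: A :\: vs e2 -> b != w ->
  exists V, [/\ V \subset A :\: vs e1, #|N V| = #|V| + 2, vs e2 \subset N V,
    b \in N V & exists c g, [/\ g \notin D, joins g c b, c != a & c \notin V]].
Proof.
move=> bB bw.
have bA : b \notin A by case/setDP: bB; rewrite inE.
have [g] : exists g, g \in [set g in inc b | forced1b e2 g].
  apply/set0Pn; rewrite -card_gt0.
  have := inc_split HS bB; have := Hd b; have := k2B_le1 bB bw.
  have := leq_trans (N1_ge3 HS bB) (inc_ge _ _ b); clear; lia.
rewrite in_set => /andP[ig /forced1P fg].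
have gD : g \notin D by rewrite setUC; apply: (inc_H HS bB ig).
rewrite in_inc in ig; have [v j] := vs_joins ig; rewrite joinsC in j.
have vA := joinsA HN gD j bA.
have [V [sV vV cV e2V _ un]] := forced1_set HN gD j vA (forced12 fg).
exists V; split=> //; first exact: nbI gD vV j.
have ge3 := N1_ge3 HS bB; rewrite [[set e2; e1]]setUC in ge3.
have [c cN ncav] : exists2 c, c \in N [set b] & c \notin [set a; v].
  apply/subsetPn; apply/negP=> /subset_leq_card; rewrite cards2.
  by move: ge3; case: (_ != _); clear; lia.
move: ncav; rewrite !inE negb_or => /andP[ca cv].
case/nb1P: cN => g' gD' j'; rewrite joinsC in j'.
exists c, g'; split=> //; apply: contra un => cV'; apply: (nbI _ cV' j').
rewrite in_setU1 negb_or gD' andbT; apply: contraNneq cv => E; rewrite E in j'.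
by rewrite (joins_inj j' j).
Qed.

(** Either [g] meets [e2], or it takes [b] away from [V], which then has too few neighbours left.
    The vertex [a] is prescribed so that one particular neighbour of [b] can be ruled out. *)
Lemma blocked b a : b \notin A -> b != w ->
  exists c g, [/\ g \notin D, joins g c b, c != a &
    forall M, perfect_matching M -> e1 \in M -> g \notin M].
Proof.
move=> bA bw; have [b2|b2] := boolP (b \in vs e2).
  have ge2 := N1_ge2B HN bA.
  have [c cN ca] : exists2 c, c \in N [set b] & c \notin [set a].
    apply/subsetPn; apply/negP=> /subset_leq_card; rewrite cards1.
    by move: ge2; clear; lia.
  case/nb1P: cN => g gD j; rewrite joinsC in j.
  exists c, g; split=> //; first by move: ca; rewrite inE.
  move=> M pm e1M; apply/negP=> gM.
  have E := pm_uniq pm (in_setT b) gM (pm_e1_e2 HN pm e1M) (joins_r j) b2.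
  by move: gD; rewrite E !inE eqxx orbT.
have bB : b \in ~: A :\: vs e2 by rewrite in_setD b2 inE.
have [V [sV cV e2V bV [c [g [gD j ca cnV]]]]] := k1_at a bB bw.
exists c, g; split=> // M pm e1M; apply/negP=> gM.
have e2M := pm_e1_e2 HN pm e1M.
have : #|V| <= #|N V :\: vs e2 :\ b|.
  apply: (pm_card pm) => [|k x v kM xV jk]; first exact: subsetT.
  have /setDP[xA x1] := subsetP sV _ xV.
  have kD : k \notin D.
    rewrite !inE negb_or; apply/andP; split; apply/eqP=> E; rewrite E in jk.
      by rewrite (joins_l jk) in x1.
    by have := subsetP (nbs_e2 HN) _ (joins_l jk); rewrite inE xA.
  rewrite in_setD1 in_setD (nbI kD xV jk) andbT; apply/andP; split.
    apply: contraNneq cnV => E; rewrite E in jk.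
    have Ek := pm_uniq pm (in_setT b) kM gM (joins_r jk) (joins_r j); rewrite Ek in jk.
    by rewrite (joins_inj j jk).
  apply/negP=> v2; have E := pm_uniq pm (in_setT v) kM e2M (joins_r jk) v2.
  by move: kD; rewrite E !inE eqxx orbT.
have := cardsD1 b (N V :\: vs e2); rewrite in_setD b2 bV /=.
rewrite [in X in X -> _]cardsD (setIidPr e2V) cV (nbs_c2 HN); clear; lia.
Qed.

Lemma N_wN X : a1 \notin X -> a2 \notin X -> y3 \notin X -> w \notin N X.
Proof.
move=> n1 n2 n3; apply/negP=> /nbP[g [x [gD xX j]]].
have : x \in N [set w] by apply/nb1P; exists g; rewrite // joinsC.
rewrite (wd_N3 W) !inE => /orP[/orP[]|] /eqP E; move: xX; rewrite E.
- by rewrite (negPf n1).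
- by rewrite (negPf n2).
- by rewrite (negPf n3).
Qed.

Lemma eq_N12 X : N (X :|: [set a1; a2]) = N X :|: [set w; y1; y2].
Proof.
rewrite !nbU (wd_N1 W) (wd_N2 W); move: (N X) => Y; apply/setP=> v; rewrite !inE.
by case: (v \in Y); case: (v == w); case: (v == y1).
Qed.

(* The forced edges at [y1] and [y2] yield tight sets [V] and [V'] whose
   neighbourhoods contain [e2].  Adding the triangle to their union, or to their
   intersection, violates [nbs_C2] unless almost all of [A] is covered, and the
   only vertex that can be left over is [y3]. *)
Lemma adj_y3 : y3 \in N [set y1] \/ y3 \in N [set y2].
Proof.
have [i1 i2 n12] := wd_a W; have [y1w y2w y12 y31 y32] := wd_y W.
have [yA1 yA2 yA3] := eq_yA.
case: (boolP (y3 \in N [set y1])) => [|n1]; first by left.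
case: (boolP (y3 \in N [set y2])) => [|n2]; first by right.
exfalso.
have c12 V : V \subset A :\: vs e1 -> #|V :|: [set a1; a2]| = #|V| + 2.
  move=> sV; rewrite cardsUD cards2 n12 (_ : V :\: [set a1; a2] = V) //.
  apply/setDidPl; rewrite -eq_e1 disjoints_subset.
  by apply: subset_trans sV _; rewrite setDE subsetIr.
have sA V : V \subset A :\: vs e1 -> V :|: [set a1; a2] \subset A.
  by move=> sV; rewrite subUset (subset_trans sV (subsetDl _ _)) -eq_e1 (nbs_e1 HN).
(* Adding [a1] and [a2] to [V] brings only [w] as a new neighbour, so the size condition of [nbs_C2]
   must fail; if [y3] is in [V], even [w] is not new and [nbs_C1] leaves only the whole of [A]. *)
have big V : V \subset A :\: vs e1 -> #|N V| <= #|V| + 2 -> vs e2 \subset N V ->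
    y1 \in N V -> y2 \in N V ->
    #|A| <= #|V| + 3 /\ (y3 \in V -> V :|: [set a1; a2] = A).
  move=> sV cV e2V h1 h2.
  have E : N (V :|: [set a1; a2]) = N V :|: [set w].
    rewrite eq_N12; apply/eqP; rewrite eqEsubset; apply/andP; split.
      by rewrite !subUset !sub1set !in_setU h1 h2 set11 subsetUl !orbT.
    by rewrite setUS // -setUA subsetUl.
  split.
    rewrite leqNgt; apply/negP=> lt.
    have := C2 (sA V sV); rewrite (c12 V sV) E => /(_ ltac:(move: lt; clear; lia)).
    have sD : (N V :|: [set w]) :\: vs e2 \subset (N V :\: vs e2) :|: [set w].
      by rewrite setDUl setUS // subsetDl.
    have cD := cardsD (N V) (vs e2); rewrite (setIidPr e2V) (nbs_c2 HN) in cD.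
    have := subset_leq_card sD; rewrite cardsU1'.
    by case: (w \notin _) => /=; move: cD cV; clear; lia.
  move=> y3V; apply/eqP/negPn/negP=> nA.
  have nz : V :|: [set a1; a2] != set0 by apply/set0Pn; exists a1; rewrite !inE eqxx orbT.
  have := C1 (sA V sV) nz nA; rewrite (c12 V sV) E (setUidPl _).
    by move: cV; clear; lia.
  rewrite sub1set; apply/(nbP _ _ _); have [_ _ _ _ d3] := wd_D W.
  by exists g3, y3; rewrite joinsC (wd_g3 W).
have y3n c g b : g \notin D -> joins g c b -> y3 \notin N [set b] -> c != y3.
  by move=> gD j; apply: contraNneq => <-; apply/nb1P; exists g; rewrite // joinsC.
have cA c g b : g \notin D -> joins g c b -> b \notin A -> c \in A.
  by move=> gD j; apply: (joinsA HN gD j).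
have ca2 c g : g \notin D -> joins g c y1 -> c != a2.
  move=> gD j; apply: contraNneq y12 => E; rewrite E in j.
  have : y1 \in N [set a2] by apply/nb1P; exists g.
  by rewrite (wd_N2 W) !inE (negPf y1w) => /eqP->.
have ca1 c g : g \notin D -> joins g c y2 -> c != a1.
  move=> gD j; apply: contraNneq y12 => E; rewrite E in j.
  have : y2 \in N [set a1] by apply/nb1P; exists g.
  by rewrite (wd_N1 W) !inE (negPf y2w) => /eqP->.
have only V c : V \subset A :\: vs e1 -> #|N V| <= #|V| + 2 -> vs e2 \subset N V ->
    y1 \in N V -> y2 \in N V -> c \in A -> c \notin V -> c != a1 -> c != a2 -> c = y3.
  move=> sV cV e2V h1 h2 cAA cV' c1 c2; have [le3 yV] := big V sV cV e2V h1 h2.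
  have cZ : c \notin V :|: [set a1; a2] by rewrite !inE !negb_or cV' c1.
  have yV' : y3 \notin V.
    by apply/negP=> /yV E; rewrite E cAA in cZ.
  have yZ : y3 \notin V :|: [set a1; a2] by rewrite !inE !negb_or yV' y31.
  apply/eqP/negPn/negP=> cy.
  have : (V :|: [set a1; a2]) :|: [set c; y3] \subset A.
    by rewrite subUset sA // subUset !sub1set cAA.
  move/subset_leq_card; rewrite cardsUD (_ : _ :\: [set c; y3] = V :|: [set a1; a2]).
    by rewrite c12 // cards2 cy; move: le3; clear; lia.
  apply/setDidPl; rewrite disjoint_sym disjoints_subset subUset !sub1set !in_setC.
  by rewrite cZ yZ.
have in2 y : y \notin A -> y \notin vs e2 -> y \in ~: A :\: vs e2 by move=> h1 h2; rewrite in_setD h2 inE.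
have [y1e|y1e] := boolP (y1 \in vs e2); have [y2e|y2e] := boolP (y2 \in vs e2).
(* Here [a1] and [a2] would see only [w] outside [e2], against [nbs_C2]. *)
- have := C2 (sA set0 (sub0set _)); rewrite (c12 set0 (sub0set _)) cards0 add0n.
  move=> /(_ ge4); rewrite eq_N12 nb0 set0U.
  have : [set w; y1; y2] :\: vs e2 \subset [set w].
    apply/subsetP=> v /setDP[+ v2]; rewrite !inE => /orP[/orP[//|]|] /eqP E; move: v2; rewrite E.
      by rewrite y1e.
    by rewrite y2e.
  by move/subset_leq_card; rewrite cards1; clear; lia.
- have [V [sV cV e2V bV [c [g [gD j cn cnV]]]]] := k1_at a2 (in2 _ yA2 y2e) y2w.
  have h1 : y1 \in N V by apply: (subsetP e2V).
  have := only V c sV (eq_leq cV) e2V h1 bV (cA _ _ _ gD j yA2) cnV (ca1 _ _ gD j) cn.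
  by apply/eqP; apply: y3n gD j n2.
- have [V [sV cV e2V bV [c [g [gD j cn cnV]]]]] := k1_at a1 (in2 _ yA1 y1e) y1w.
  have h2 : y2 \in N V by apply: (subsetP e2V).
  have := only V c sV (eq_leq cV) e2V bV h2 (cA _ _ _ gD j yA1) cnV cn (ca2 _ _ gD j).
  by apply/eqP; apply: y3n gD j n1.
have [V [sV cV e2V bV [c [g [gD j cn cnV]]]]] := k1_at a1 (in2 _ yA1 y1e) y1w.
have [V' [sV' cV' e2V' bV' [c' [g' [gD' j' cn' cnV']]]]] := k1_at a2 (in2 _ yA2 y2e) y2w.
have hs := nb_submod D V V'; have cUI := cardsUI V V'.
have cNI := cardsUI (N V) (N V'); rewrite -nbU in cNI.
have sI2 : vs e2 \subset N V :&: N V' by rewrite subsetI e2V.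
have leI2 := subset_leq_card sI2; rewrite (nbs_c2 HN) in leI2.
have sU : V :|: V' \subset A :\: vs e1 by rewrite subUset sV.
have sIe : V :&: V' \subset A :\: vs e1 := subset_trans (subsetIl _ _) sV.
(* When the intersection is empty, the two ends of [e2], counted in both neighbourhoods, replace the
   surplus of the intersection. *)
have cU : #|N (V :|: V')| <= #|V :|: V'| + 2.
  have [I0|nI] := eqVneq (V :&: V') set0.
    by move: cUI; rewrite I0 cards0; move: cNI leI2 cV cV'; clear; lia.
  by have := C3 sIe nI; move: hs cUI cV cV'; clear; lia.
have sVU : N V \subset N (V :|: V') by rewrite nbS ?subsetUl.
have sVU' : N V' \subset N (V :|: V') by rewrite nbS ?subsetUr.
have e2U := subset_trans e2V sVU.
have b1U := subsetP sVU _ bV; have b2U := subsetP sVU' _ bV'.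
(* Outside the union [c] would be the left-over vertex [y3], which is not adjacent to [y1]; likewise
   for [c'] and [y2]. *)
have cI : c \in V'.
  apply/negPn/negP=> cV2; have cU' : c \notin V :|: V' by rewrite inE negb_or cnV.
  have := only _ c sU cU e2U b1U b2U (cA _ _ _ gD j yA1) cU' cn (ca2 _ _ gD j).
  by apply/eqP; apply: y3n gD j n1.
have cI' : c' \in V.
  apply/negPn/negP=> cV2; have cU' : c' \notin V :|: V' by rewrite inE negb_or cnV' andbT.
  have := only _ c' sU cU e2U b1U b2U (cA _ _ _ gD' j' yA2) cU' (ca1 _ _ gD' j') cn'.
  by apply/eqP; apply: y3n gD' j' n2.
have b1I : y1 \in N V :&: N V' by rewrite in_setI bV (nbI gD cI j).
have b2I : y2 \in N V :&: N V' by rewrite in_setI bV' (nbI gD' cI' j').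
have nzU : V :|: V' != set0 by apply/set0Pn; exists c; rewrite inE cI orbT.
have leU := C3 sU nzU.
have [I0|nI] := eqVneq (V :&: V') set0.
  have : vs e2 :|: [set y1] \subset N V :&: N V' by rewrite subUset sI2 sub1set.
  move/subset_leq_card; rewrite setUC cardsU1 y1e (nbs_c2 HN).
  by move: cUI; rewrite I0 cards0; move: cNI leU cV cV'; clear; lia.
have leI := C3 sIe nI.
have EI : N (V :&: V') = N V :&: N V'.
  apply/eqP; rewrite eqEcard nbI_sub /=.
  by move: cNI leU cUI cV cV' leI; clear; lia.
have cIe : #|N (V :&: V')| <= #|V :&: V'| + 2.
  by rewrite EI; move: cNI leU cUI cV cV'; clear; lia.
have [le3 _] := big _ sIe cIe (eq_ind_r (fun X => vs e2 \subset X) sI2 EI)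
   (eq_ind_r (fun X => y1 \in X) b1I EI) (eq_ind_r (fun X => y2 \in X) b2I EI).
(* The intersection together with [a1], [a2], [c] and [c'] has one vertex more than [le3] allows. *)
have cc : c != c' by apply: contraNneq cnV => ->.
have : (V :&: V' :|: [set a1; a2]) :|: [set c; c'] \subset A.
  by rewrite subUset sA // subUset !sub1set (cA _ _ _ gD j yA1) (cA _ _ _ gD' j' yA2).
move/subset_leq_card; rewrite cardsUD (_ : _ :\: [set c; c'] = V :&: V' :|: [set a1; a2]).
  by rewrite c12 // cards2 cc; move: le3; clear; lia.
apply/setDidPl; rewrite disjoint_sym disjoints_subset subUset !sub1set !in_setC !inE.
rewrite (negPf cnV) (negPf cnV') !andbF /= (negPf cn) (negPf cn').
by rewrite (negPf (ca2 _ _ gD j)) (negPf (ca1 _ _ gD' j')).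
Qed.

End Equality.

Lemma e2_nonremovable (G : mgraph) (A : {set vert G}) e1 e2 : nbs A e1 e2 ->
  ~~ removable e2.
Proof.
move=> HN; apply/negP=> /removable_adm /(_ (e1_neq_e2 HN)) [M pm [e1M]].
by rewrite (pm_e1_e2 HN pm e1M).
Qed.

Lemma e1_nonremovable (G : mgraph) (A : {set vert G}) e1 e2 : nbs A e1 e2 ->
  ~~ removable e1.
Proof. by move/nbs_sym/e2_nonremovable. Qed.

(** * The rung next to the triangle *)

Section Rung.
Variables (G : mgraph) (A : {set vert G}) (e1 e2 : edge G).
Variables (a1 a2 w y1 y2 y3 : vert G) (s1 s2 g1 g2 g3 h : edge G).
Hypothesis HN : nbs A e1 e2.
Hypothesis R0 : vs e1 :|: vs e2 \subset remdeg0 G.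
Hypothesis Hz : exists2 z, z \in A :\: vs e1 & z \in remdeg0 G.
Hypothesis Hd : forall v : vert G, #|rinc v| <= 1.
Hypothesis ge4 : 4 <= #|A|.
Hypothesis W : wdata A e1 e2 a1 a2 w y1 y2 y3 s1 s2 g1 g2 g3.
Hypothesis hD : h \notin [set e1; e2].
Hypothesis jh : joins h y1 y3.
Local Notation D := [set e1; e2].
Local Notation N := (nb [set e1; e2]).

(** As an end of [e2], [y1] would see only [a1] and [y3] outside [e2], by the exceptional vertex of
    [A]. Then [A] without [a1], [a2], [y3] would miss both [w] and [y1], one neighbour too many for
    [nbs_C3]. *)
Lemma rung_y1 : y1 \notin vs e2.
Proof.
have [i1 i2 n12] := wd_a W; have [y1w y2w y12 y31 y32] := wd_y W.
have [yA1 yA2 yA3] := eq_yA HN W.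
apply/negP=> y1e; case: Hz => z zA z0.
have [|b [b' [d [? [? [? x]]]]]] := exceptional HN zA.
  by apply/eqP; move: z0; rewrite inE.
have c2 : #|N [set y1]| = 2.
  by move: y1e; rewrite (x_e2 x) => /set2P[] ->; [apply: (x_Nb x)|apply: (x_Nb' x)].
have E : N [set y1] = [set a1; y3].
  apply/esym/eqP; rewrite eqEcard c2 cards2 eq_sym y31 andbT subUset !sub1set.
  have [_ _ d1 _ _] := wd_D W.
  apply/andP; split; apply/nb1P; last by exists h.
  by exists g1; rewrite // joinsC (wd_g1 W).
pose X := A :\: [set a1; a2; y3].
have c3 : #|[set a1; a2; y3]| = 3.
  by rewrite cardsU1' cards2 n12 !inE negb_or y31 y32.
have s3 : [set a1; a2; y3] \subset A by rewrite !subUset !sub1set i1 i2.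
have cX : #|X| + 3 = #|A|.
  by rewrite cardsD (setIidPr s3) c3; have := subset_leq_card s3; rewrite c3; clear; lia.
have sX : X \subset A :\: vs e1 by rewrite (eq_e1 W) setDS // subsetUl.
have nz : X != set0 by rewrite -card_gt0; move: cX ge4; clear; lia.
have := nbs_C3 HN sX nz.
have nX v : v \in [set a1; a2; y3] -> v \notin X by move=> vv; rewrite in_setD vv.
have wX : w \notin N X by apply: (N_wN W); apply: nX; rewrite !inE eqxx ?orbT.
have yX : y1 \notin N X.
  apply/negP=> /nbP[g [v [gD vX j]]].
  have : v \in N [set y1] by apply/nb1P; exists g; rewrite // joinsC.
  by rewrite E => /set2P[] Ev; move: vX; rewrite Ev; apply/negP/nX; rewrite !inE eqxx ?orbT.
have : N X :|: [set w; y1] \subset ~: A.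
  rewrite subUset (N_sub HN) ?subsetDl //= subUset !sub1set !inE yA1 andbT.
  exact: eq_wA W.
move/subset_leq_card; rewrite cardsUD cards2 eq_sym y1w -(nbs_card HN).
rewrite (_ : _ :\: _ = N X); first by move: cX; clear; lia.
apply/setDidPl; rewrite disjoint_sym disjoints_subset subUset !sub1set !in_setC.
by rewrite wX yX.
Qed.

Lemma g3_forced : forced1 e1 g3.
Proof.
move=> M pm e1M; have [g gM wg] := pm_cover pm (in_setT w).
have [i1 i2 n12] := wd_a W; have wA := eq_wA W.
have := subsetP (wd_i3 W) g; rewrite in_inc wg => /(_ isT); rewrite !inE => /orP[/orP[]|] /eqP E.
- have := pm_uniq pm (in_setT a2) gM e1M; rewrite E (joins_l (wd_s1 W)) (joins_r (wd_e1 W)).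
  move=> /(_ isT isT) E1; have := joins_r (wd_s1 W); rewrite E1 => h1.
  by have := subsetP (nbs_e1 HN) _ h1; rewrite (negPf wA).
- have := pm_uniq pm (in_setT a1) gM e1M; rewrite E (joins_l (wd_s2 W)) (joins_l (wd_e1 W)).
  move=> /(_ isT isT) E1; have := joins_r (wd_s2 W); rewrite E1 => h1.
  by have := subsetP (nbs_e1 HN) _ h1; rewrite (negPf wA).
- by rewrite -E.
Qed.

(** Otherwise [g1] and [h] would both be in [k2edges] at [y1], against [k2B_le1]: neither is forced,
    since [g1] meets [e1] and [h] meets the forced edge [g3] at [y3]. *)
Lemma rung_removable : removable h.
Proof.
have [i1 i2 n12] := wd_a W; have [y1w y2w y12 y31 y32] := wd_y W.
have [yA1 yA2 yA3] := eq_yA HN W; have [_ _ d1 _ d3] := wd_D W.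
apply/negPn/negP=> nr.
have y1B : y1 \in ~: A :\: vs e2 by rewrite in_setD rung_y1 inE.
have a1e : a1 \in vs e1 by rewrite (eq_e1 W) !inE eqxx.
have := k2B_le1 HN W y1B y1w; rewrite leqNgt; case/negP; apply/card_gt1P.
exists g1, h; split.
- rewrite in_set in_inc (joins_r (wd_g1 W)) /=; apply/andP; split.
    by apply: (remdeg0P (v := a1)); [apply: (subsetP R0); rewrite in_setU a1e | apply: joins_l (wd_g1 W)].
  apply/negP=> /forced1P /(forced12 HN) f; have [M pm e1M] := e1_adm HN.
  have E := pm_uniq pm (in_setT a1) (f M pm e1M) e1M (joins_l (wd_g1 W)) a1e.
  by move: d1; rewrite E !inE eqxx.
- rewrite in_set in_inc (joins_l jh) nr /=.
  apply/negP=> /forced1P /(forced12 HN) f.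
  have E := forced1_uniq HN (joins_r jh) (joins_r (wd_g3 W)) f g3_forced.
  by have := wd_g3 W; rewrite -E => j; rewrite (joins_inj jh j) eqxx in y1w.
- apply: contraNneq y31 => E; have := wd_g1 W; rewrite E joinsC => j.
  by rewrite (joins_injr jh j).
Qed.

(** The rung is the only removable edge at [y3], so [inc_le] bounds the degree of [y3] by three. *)
Lemma rung_inc : exists y k, [/\ y \notin A, y != w, y != y1, joins k y3 y &
  inc y3 \subset [set g3; h; k]].
Proof.
have [i1 i2 n12] := wd_a W; have [y1w y2w y12 y31 y32] := wd_y W.
have [yA1 yA2 yA3] := eq_yA HN W; have [_ _ d1 _ d3] := wd_D W.
have yB : y3 \in A :\: vs e1 by rewrite in_setD yA3 (eq_e1 W) !inE negb_or y31 y32.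
have rn : rinc y3 != set0.
  by apply/set0Pn; exists h; rewrite in_rinc (joins_r jh) rung_removable.
have le3 : #|inc y3| <= 3 by apply: leq_trans (inc_le HN yB rn) _; have := Hd y3; clear; lia.
have ge3 := N1_ge3 HN yB.
have [y yN yn] : exists2 y, y \in N [set y3] & y \notin [set w; y1].
  apply/subsetPn; apply/negP=> /subset_leq_card; rewrite cards2 eq_sym y1w.
  by move: ge3; clear; lia.
case/nb1P: yN => k kD jk; move: yn; rewrite !inE negb_or => /andP[yw yy1].
exists y, k; split=> //; first exact: (joinsB HN kD jk).
have ng : g3 != h.
  apply: contraNneq y1w => E; have := wd_g3 W; rewrite E => j; apply/eqP; exact: joins_inj jh j.
have jh' : joins h y3 y1 by rewrite joinsC.
have jg : joins g3 y3 w by rewrite joinsC (wd_g3 W).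
have nk : k \notin [set g3; h].
  rewrite !inE negb_or; apply/andP; split; apply/eqP=> E; rewrite E in jk.
    by rewrite (joins_injr jk jg) eqxx in yw.
  by rewrite (joins_injr jk jh') eqxx in yy1.
have : [set g3; h; k] == inc y3.
  rewrite eqEcard cardsU1' cards2 ng nk le3 andbT !subUset !sub1set !in_inc.
  by rewrite (joins_l jg) (joins_l jh') (joins_l jk).
by move/eqP->.
Qed.

End Rung.

(** * Removable edges under the contraction *)

Section Lifts.
Variables (G G0 : mgraph) (phi : vert G -> vert G0) (psi : edge G0 -> edge G).
Variables (t : vert G0) (a1 a2 a3 y1 y2 y3 : vert G) (s1 s2 s3 : edge G).
Variables (x1 x2 x3 : edge G0).
Hypothesis TC : tricon phi psi t a1 a2 a3 y1 y2 y3 s1 s2 s3 x1 x2 x3.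

Lemma t_cover M0 : perfect_matching M0 -> [\/ x1 \in M0, x2 \in M0 | x3 \in M0].
Proof.
move=> pm; have [x xM /(t_vs TC)] := pm_cover pm (in_setT t).
by rewrite !inE => /orP[/orP[]|] /eqP E; rewrite E in xM; [constructor 1|constructor 2|constructor 3].
Qed.

Lemma lift2 M0 : perfect_matching M0 -> x2 \in M0 -> perfect_matching (s2 |: psi @: M0).
Proof. exact: lift1 (tricon_rot TC) _. Qed.

Lemma lift3 M0 : perfect_matching M0 -> x3 \in M0 -> perfect_matching (s3 |: psi @: M0).
Proof. exact: lift1 (tricon_rot (tricon_rot TC)) _. Qed.

Lemma proj2 M : perfect_matching M -> s2 \in M -> perfect_matching [set e | psi e \in M].
Proof. exact: proj1 (tricon_rot TC) _. Qed.

Lemma proj_s3 M : perfect_matching M -> s3 \in M -> perfect_matching [set e | psi e \in M].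
Proof. exact: proj1 (tricon_rot (tricon_rot TC)) _. Qed.

Lemma in_lift s (M0 : {set edge G0}) e : s \in [set s1; s2; s3] -> (psi e \in s |: psi @: M0) = (e \in M0).
Proof.
move=> ss; rewrite in_setU1 (mem_imset _ _ (tc_pinj TC)).
by case: eqP => // E; have := tc_pnot TC e; rewrite E ss.
Qed.

Lemma lift_any M0 : perfect_matching M0 -> exists2 M, perfect_matching M &
  (forall e, (psi e \in M) = (e \in M0)) /\
  [/\ x1 \in M0 -> s1 \in M, x2 \in M0 -> s2 \in M & x3 \in M0 -> s3 \in M].
Proof.
move=> pm.
have tx x : x \in [set x1; x2; x3] -> t \in vs x.
  case/setUP=> [/set2P[]|/set1P] ->.
  - by rewrite (vs_x1 TC) !inE eqxx.
  - by rewrite (vs_x1 (tricon_rot TC)) !inE eqxx.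
  - by rewrite (vs_x1 (tricon_rot (tricon_rot TC))) !inE eqxx.
have un x x' : x \in [set x1; x2; x3] -> x' \in [set x1; x2; x3] -> x \in M0 -> x' \in M0 -> x = x'.
  by move=> i i' xM xM'; apply: (pm_uniq pm (in_setT t) xM xM' (tx _ i) (tx _ i')).
have d12 := x12_neq TC; have d23 := x12_neq (tricon_rot TC).
have d13 : x1 != x3 by rewrite eq_sym; apply: x12_neq (tricon_rot (tricon_rot TC)).
have i1 : x1 \in [set x1; x2; x3] by rewrite !inE eqxx.
have i2 : x2 \in [set x1; x2; x3] by rewrite !inE eqxx orbT.
have i3 : x3 \in [set x1; x2; x3] by rewrite !inE eqxx !orbT.
have [xM|xM|xM] := t_cover pm.
- exists (s1 |: psi @: M0); first exact: (lift1 TC).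
  split; first by move=> e; rewrite in_lift // !inE eqxx.
  split=> [|x|x]; first by rewrite setU11.
    by have := d12; rewrite (un _ _ i1 i2 xM x) eqxx.
  by have := d13; rewrite (un _ _ i1 i3 xM x) eqxx.
- exists (s2 |: psi @: M0); first exact: lift2.
  split; first by move=> e; rewrite in_lift // !inE eqxx orbT.
  split=> [x||x]; [|by rewrite setU11|].
    by have := d12; rewrite (un _ _ i1 i2 x xM) eqxx.
  by have := d23; rewrite (un _ _ i2 i3 xM x) eqxx.
- exists (s3 |: psi @: M0); first exact: lift3.
  split; first by move=> e; rewrite in_lift // !inE eqxx !orbT.
  split=> [x|x|]; last by rewrite setU11.
    by have := d13; rewrite (un _ _ i1 i3 x xM) eqxx.
  by have := d23; rewrite (un _ _ i2 i3 x xM) eqxx.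
Qed.

Lemma tc_card : #|vert G0| + 2 = #|vert G|.
Proof.
have cT := set3_card (tc_neq TC).
have E : [set: vert G0] = t |: phi @: ~: [set a1; a2; a3].
  apply/setP=> v0; rewrite in_setT in_setU1; have [->|[v vT <-]] := phi_cases TC v0.
    by rewrite eqxx.
  by rewrite imset_f ?orbT // in_setC.
have c := cardsC [set a1; a2; a3]; rewrite cT in c.
rewrite -cardsT E cardsU1 card_in_imset; last first.
  by move=> u v uT _; apply: (tc_inj TC); rewrite in_setC in uT.
suff -> : t \notin phi @: ~: [set a1; a2; a3] by move: c => /=; clear; lia.
apply/imsetP=> -[v]; rewrite in_setC => vT /eqP; rewrite eq_sym (tc_t TC).
exact/negP.
Qed.

End Lifts.

Section Counting.
Variables (G G0 : mgraph) (phi : vert G -> vert G0) (psi : edge G0 -> edge G).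
Variables (t : vert G0) (a1 a2 w y1 y2 y3 : vert G) (s1 s2 e1 e2 : edge G).
Variables (x1 x2 x3 f2 h0 : edge G0) (A : {set vert G}).
Hypothesis TC : tricon phi psi t a1 a2 w y1 y2 y3 s1 s2 e1 x1 x2 x3.
Hypothesis HN : nbs A e1 e2.
Hypothesis wA : w \notin A.
Hypothesis we2 : w \notin vs e2.
Hypothesis f2E : psi f2 = e2.
Hypothesis hD : psi h0 \notin [set e1; e2].
Hypothesis jh : joins (psi h0) y1 y3.
Hypothesis ge4 : 4 <= #|A|.
Local Notation D := [set e1; e2].
Local Notation N := (nb [set e1; e2]).

Let HN0 : nbs (A0 phi A) x3 f2 := contraction_nbs TC HN wA we2 f2E hD jh ge4.
Let TC2 := tricon_rot TC.
Let TC3 := tricon_rot TC2.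

Lemma x_vs : [/\ vs x1 = [set t; phi y1], vs x2 = [set t; phi y2] & vs x3 = [set t; phi y3]].
Proof. by split; [exact: vs_x1 TC | exact: vs_x1 TC2 | exact: vs_x1 TC3]. Qed.

Lemma t_in_x x : x \in [set x1; x2; x3] -> t \in vs x.
Proof.
have [v1 v2 v3] := x_vs.
by case/setUP=> [/set2P[]|/set1P] ->; rewrite ?v1 ?v2 ?v3 !inE eqxx.
Qed.

Lemma h0_x x : x \in [set x1; x2; x3] -> h0 != x.
Proof.
move/t_in_x=> tx; apply: contraTneq tx => <-.
have [yT1 _ yT3] := tc_y TC.
rewrite (joins_vs (tc_pj TC jh)) !inE negb_or ![t == _]eq_sym !(tc_t TC).
by rewrite yT1 yT3.
Qed.

Lemma x_in : [/\ x1 \in [set x1; x2; x3], x2 \in [set x1; x2; x3] & x3 \in [set x1; x2; x3]].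
Proof. by rewrite !inE !eqxx !orbT. Qed.

(** [h0] meets both [x1] and [x3], so a perfect matching through [h0] covers [t] by [x2]. *)
Lemma x2_nonremovable : ~~ removable x2.
Proof.
have [i1 i2 i3] := x_in; have [v1 v2 v3] := x_vs.
apply/negP=> /removable_adm /(_ (h0_x i2)) [M0 pm [hM xM]].
have jh0 := tc_pj TC jh.
have [xM1|xM2|xM3] := t_cover TC pm.
- have := h0_x i1; have px : phi y1 \in vs x1 by rewrite v1 !inE eqxx orbT.
  by rewrite (pm_uniq pm (in_setT (phi y1)) hM xM1 (joins_l jh0) px) eqxx.
- by rewrite xM2 in xM.
- have := h0_x i3; have px : phi y3 \in vs x3 by rewrite v3 !inE eqxx orbT.
  by rewrite (pm_uniq pm (in_setT (phi y3)) hM xM3 (joins_r jh0) px) eqxx.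
Qed.

(** Perfect matchings of [G0] avoiding [e] are lifted; a triangle edge is reached by lifting one
    through the corresponding edge at [t]. *)
Lemma lift_removable e : removable e -> e \notin [set x1; x2; x3] -> removable (psi e).
Proof.
move=> re ex; have [i1 i2 i3] := x_in.
have ne x : x \in [set x1; x2; x3] -> x != e by apply: contraTneq => ->.
have nD : psi e \notin D.
  have := tc_pnot TC e; rewrite !inE !negb_or => /andP[_ ->] /=.
  rewrite -f2E (inj_eq (tc_pinj TC)); apply: contraTneq re => ->.
  exact: (e2_nonremovable HN0).
apply: (removable_intro HN nD) => f fe.
have [fs|fs] := boolP (f \in [set s1; s2; e1]); last first.
  have [f0 E] := tc_pim TC fs; subst f.
  have [|M0 pm [fM eM]] := removable_adm re (f := f0).
    by apply: contraNneq fe => ->.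
  have [M pmM [inM _]] := lift_any TC pm.
  by exists M => //; rewrite !inM.
have go x : x \in [set x1; x2; x3] -> (forall (M0 : {set edge G0}) (M : {set edge G}), x \in M0 ->
    [/\ x1 \in M0 -> s1 \in M, x2 \in M0 -> s2 \in M & x3 \in M0 -> e1 \in M] -> f \in M) ->
    exists2 M, perfect_matching M & f \in M /\ psi e \notin M.
  move=> ix hx; have [M0 pm [xM eM]] := removable_adm re (ne x ix).
  have [M pmM [inM sM]] := lift_any TC pm.
  by exists M => //; rewrite inM; split=> //; apply: (hx M0 M xM sM).
move: fs; rewrite !inE => /orP[/orP[]|] /eqP E.
- by apply: (go x1 i1) => M0 M xM [h _ _]; rewrite E; apply: h.
- by apply: (go x2 i2) => M0 M xM [_ h _]; rewrite E; apply: h.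
- by apply: (go x3 i3) => M0 M xM [_ _ h]; rewrite E; apply: h.
Qed.

Section Descent.
Variables (g1 g2 : edge G).
Hypothesis R0 : vs e1 :|: vs e2 \subset remdeg0 G.
Hypothesis Hz : exists2 z, z \in A :\: vs e1 & z \in remdeg0 G.
Hypothesis Hd : forall v : vert G, #|rinc v| <= 1.
Hypothesis W : wdata A e1 e2 a1 a2 w y1 y2 y3 s1 s2 g1 g2 (psi x3).

Lemma blocked_lift b a : b \notin A -> b != w -> exists c g0,
  [/\ joins (psi g0) c b, c != a, c \in A & forall M0, perfect_matching M0 -> x3 \in M0 -> g0 \notin M0].
Proof.
move=> bA bw; have [c [g [gD j ca blk]]] := blocked HN Hd W a bA bw.
have bT : b \notin [set a1; a2; w].
  have [i1 i2 _] := wd_a W; rewrite !inE !negb_or bw andbT.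
  by apply/andP; split; apply: contraNneq bA => ->.
have [g0 E] := psi_ex TC bT (joins_r j).
exists c, g0; rewrite E; split=> //; first exact: (joinsA HN gD j bA).
move=> M0 pm xM; have := blk _ (lift3 TC pm xM); rewrite setU11 => /(_ isT).
by rewrite -E (in_lift TC) // !inE eqxx !orbT.
Qed.

(** A blocked edge [g0] at [y2] excludes [x3], and it excludes [x2] by meeting it at [y2], so every
    perfect matching through [g0] covers [t] by [x1]. *)
Lemma x1_nonremovable : ~~ removable x1.
Proof.
have [i1 i2 i3] := x_in; have [v1 v2 v3] := x_vs.
have [y1w y2w y12 y31 y32] := wd_y W; have [yA1 yA2 yA3] := eq_yA HN W.
have [ia1 ia2 n12] := wd_a W.
have [c [g0 [j ca cA blk]]] := blocked_lift a2 yA2 y2w.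
have ne : g0 != x1.
  apply: contraNneq y12 => E; rewrite E in j.
  have := joins_r j; rewrite (joins_vs (tc_x1 TC)) !inE => /orP[]/eqP E2; last by rewrite E2.
  by rewrite E2 ia1 in yA2.
apply/negP=> /removable_adm /(_ ne) [M0 pm [gM xM]].
have [xM1|xM2|xM3] := t_cover TC pm.
- by rewrite xM1 in xM.
- have px : phi y2 \in vs x2 by rewrite v2 !inE eqxx orbT.
  have E := pm_uniq pm (in_setT (phi y2)) gM xM2 (joins_r (tc_pj TC j)) px.
  by rewrite E in j; rewrite (joins_inj j (tc_x2 TC)) eqxx in ca.
- by have := blk _ pm xM3; rewrite gM.
Qed.

(** [y3] has three edges. A blocked edge [g0] at its third neighbour [y] excludes [x3] and the edge
    from [y3] to [y], so only the rung is left for [y3]. *)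
Lemma h0_nonremovable : ~~ removable h0.
Proof.
have [i1 i2 i3] := x_in; have [v1 v2 v3] := x_vs.
have [yA1 yA2 yA3] := eq_yA HN W.
have [y [k [yA yw yy1 jk inc3]]] := rung_inc HN R0 Hz Hd ge4 W hD jh.
have [c [g0 [j ca cA blk]]] := blocked_lift y3 yA yw.
have ne : g0 != h0.
  apply/eqP=> E; rewrite E in j.
  have := joins_r j; rewrite (joins_vs jh) !inE (negPf yy1) /= => /eqP E2.
  by rewrite E2 yA3 in yA.
apply/negP=> /removable_adm /(_ ne) [M0 pm [gM hM]].
have [_ _ yT3] := tc_y TC.
have [e eM ye] := pm_cover pm (in_setT (phi y3)).
have ye' := psi_vs TC yT3 ye.
have := subsetP inc3 (psi e); rewrite in_inc ye' => /(_ isT).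
rewrite !inE => /orP[/orP[]|] /eqP E.
- by have := blk _ pm; rewrite -(tc_pinj TC E) eM gM => /(_ isT).
- by rewrite -(tc_pinj TC E) eM in hM.
have yk : phi y \in vs e by apply: (vs_phi TC); rewrite E (joins_r jk).
have Eg := pm_uniq pm (in_setT (phi y)) gM eM (joins_r (tc_pj TC j)) yk.
by rewrite Eg E in j; rewrite (joins_inj j jk) eqxx in ca.
Qed.

Lemma descent : #|removables G0| < #|removables G|.
Proof.
have [i1 i2 i3] := x_in.
have hr := rung_removable HN R0 Hz ge4 W hD jh.
rewrite (cardsD1 (psi h0)) in_removables hr ltnS -(card_imset _ (tc_pinj TC)).
apply/subset_leq_card/subsetP=> g /imsetP[e re ->]; rewrite in_removables in re.
rewrite in_setD1 in_removables (inj_eq (tc_pinj TC)); apply/andP; split.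
  by apply: contraTneq re => ->; apply: h0_nonremovable.
apply: lift_removable => //; apply/negP=> /setUP[/set2P[]|/set1P] E; move: re; rewrite E; apply/negP.
- exact: x1_nonremovable.
- exact: x2_nonremovable.
- exact: (e1_nonremovable HN0).
Qed.

End Descent.

Section Ascent.
Hypothesis nx1 : ~~ removable x1.

Lemma exits M : perfect_matching M ->
  [/\ s1 \in M -> psi x1 \in M, s2 \in M -> psi x2 \in M & e1 \in M -> psi x3 \in M].
Proof.
by move=> pm; split; [apply: (exit1 TC pm) | apply: (exit1 TC2 pm) | apply: (exit1 TC3 pm)].
Qed.

Lemma x_uniq M0 x x' : perfect_matching M0 -> x \in [set x1; x2; x3] ->
  x' \in [set x1; x2; x3] -> x \in M0 -> x' \in M0 -> x = x'.
Proof.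
by move=> pm i i' xM xM'; apply: (pm_uniq pm (in_setT t) xM xM' (t_in_x i) (t_in_x i')).
Qed.

Lemma x1_neq : x1 != x2 /\ x1 != x3.
Proof.
by split; [exact: x12_neq TC | rewrite eq_sym; exact: x12_neq TC3].
Qed.

(** A perfect matching using a triangle edge restricts to [G0]; one leaving the triangle three times
    is rerouted through [h0] and then contains neither [x1] nor [x3]. This is why [f0] must differ
    from them. *)
Lemma proj_cases M f0 : perfect_matching M -> psi f0 \in M -> f0 \notin [set x1; x3] ->
  exists2 M0, perfect_matching M0 & [/\ f0 \in M0,
     forall e, e \in M0 -> e = h0 \/ psi e \in M & s1 \notin M -> x1 \notin M0].
Proof.
move=> pm fM fx; have [i1 i2 i3] := x_in; have [q1 q2 q3] := exits pm.
have [n2 n3] := x1_neq.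
have ex : perfect_matching [set e | psi e \in M] -> (s1 \notin M -> x1 \notin [set e | psi e \in M]) ->
    exists2 M0, perfect_matching M0 & [/\ f0 \in M0,
     forall e, e \in M0 -> e = h0 \/ psi e \in M & s1 \notin M -> x1 \notin M0].
  move=> pm0 nx; exists [set e | psi e \in M] => //; split=> //; first by rewrite inE.
  by move=> e; rewrite inE; right.
have /orP[m1|m1] := orbN (s1 \in M).
  by apply: (ex (proj1 TC pm m1)); rewrite m1.
have /orP[m2|m2] := orbN (s2 \in M).
  have pm0 := proj2 TC pm m2; apply: (ex pm0) => _; apply/negP=> xM.
  have xM2 : x2 \in [set e | psi e \in M] by rewrite inE q2.
  by have := n2; rewrite (x_uniq pm0 i1 i2 xM xM2) eqxx.
have /orP[m3|m3] := orbN (e1 \in M).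
  have pm0 := proj_s3 TC pm m3; apply: (ex pm0) => _; apply/negP=> xM.
  have xM3 : x3 \in [set e | psi e \in M] by rewrite inE q3.
  by have := n3; rewrite (x_uniq pm0 i1 i3 xM xM3) eqxx.
exists (h0 |: ([set e | psi e \in M] :\: [set x1; x3])).
  exact: (proj3 TC n2 (x12_neq TC2) pm m1 m2 m3 (tc_pj TC jh)).
split.
- by rewrite in_setU1 in_setD fx inE fM orbT.
- by move=> e; rewrite in_setU1 => /orP[/eqP|/setDP[]]; [left | rewrite inE; right].
- by move=> _; rewrite in_setU1 in_setD eq_sym (negPf (h0_x i1)) !inE eqxx.
Qed.

(** Perfect matchings avoiding [s1] project to ones avoiding [x1], so if [s1] were removable, [x1]
    would be too. *)
Lemma s1_nonremovable : ~~ removable s1.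
Proof.
have [i1 i2 i3] := x_in; have [n2 n3] := x1_neq.
apply: contra nx1 => rs.
have nD : x1 \notin [set x3; f2].
  rewrite !inE negb_or n3 /=; apply/eqP=> E.
  have := joins_l (tc_x1 TC); rewrite E f2E => /(subsetP (nbs_e2 HN)); rewrite inE.
  have [a1A _] := tn_a TC HN; by rewrite a1A.
apply: (removable_intro HN0 nD) => f0 fx.
(* [proj_cases] need not keep [x3]; instead, a perfect matching through [e1] projects to one through
   [x3]. *)
have [E|f3] := eqVneq f0 x3.
  have [M pm eM] := e1_adm HN; have [_ _ q3] := exits pm.
  have pm0 := proj_s3 TC pm eM.
  have xM3 : x3 \in [set e | psi e \in M] by rewrite inE q3.
  exists [set e | psi e \in M] => //; rewrite E; split=> //; apply/negP=> xM.
  by have := n3; rewrite (x_uniq pm0 i1 i3 xM xM3) eqxx.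
have ne : psi f0 != s1.
  by apply/eqP=> E; have := tc_pnot TC f0; rewrite E !inE eqxx.
have [M pm [fM sM]] := removable_adm rs ne.
have [|M0 pm0 [fM0 _ nxM]] := proj_cases pm fM; first by rewrite !inE negb_or fx.
by exists M0 => //; split=> //; apply: nxM.
Qed.

(** The rung [psi h0] covers [y1] and [y3], which closes the exits at [a1] and [w]. As [e1] and [s1]
    meet at [a2], only [s2] can cover both [a1] and [w]. *)
Lemma s2_nonremovable : ~~ removable s2.
Proof.
have [n12 n13 n23] := neqT TC; have [yT1 yT2 yT3] := tc_y TC.
have aT : [/\ a1 \in [set a1; a2; w], a2 \in [set a1; a2; w] & w \in [set a1; a2; w]].
  by rewrite !inE !eqxx !orbT.
case: aT => aT1 aT2 aT3.
have hn v : v \in [set a1; a2; w] -> v \notin vs (psi h0).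
  move=> vT; rewrite (joins_vs jh) !inE negb_or.
  by apply/andP; split; apply: contraTneq vT => ->.
have ne : psi h0 != s2 by have := tc_pnot TC h0; apply: contraNneq => ->; rewrite !inE eqxx orbT.
apply/negP=> /removable_adm /(_ ne) [M pm [hM sM]].
have [g gM ag] := pm_cover pm (in_setT a1).
have := subsetP (tc_i1 TC) g; rewrite in_inc ag => /(_ isT); rewrite !inE => /orP[/orP[]|] /eqP E.
- by rewrite -E gM in sM.
- have [k kM wk] := pm_cover pm (in_setT w); rewrite E in gM.
  have := subsetP (tc_i3 TC) k; rewrite in_inc wk => /(_ isT); rewrite !inE => /orP[/orP[]|] /eqP Ek.
  + have := pm_uniq pm (in_setT a2) kM gM; rewrite Ek (joins_l (tc_s1 TC)) (joins_r (tc_s3 TC)).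
    move=> /(_ isT isT) E1; have := joins_r (tc_s1 TC); rewrite E1 (joins_vs (tc_s3 TC)).
    by rewrite !inE eq_sym (negPf n13) eq_sym (negPf n23).
  + by rewrite -Ek kM in sM.
  + have := pm_uniq pm (in_setT y3) kM hM; rewrite Ek (joins_r (tc_x3 TC)) (joins_r jh).
    by move=> /(_ isT isT) E1; have := hn w aT3; rewrite -E1 (joins_l (tc_x3 TC)).
- have := pm_uniq pm (in_setT y1) gM hM; rewrite E (joins_r (tc_x1 TC)) (joins_l jh).
  by move=> /(_ isT isT) E1; have := hn a1 aT1; rewrite -E1 (joins_l (tc_x1 TC)).
Qed.

Lemma exit_nonremovable x : x \in [set x1; x2; x3] -> ~~ removable (psi x).
Proof.
have go s x' : s \in [set s1; s2; e1] -> (forall M, perfect_matching M -> s \in M -> psi x' \in M) ->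
    ~~ removable (psi x').
  move=> ss hx; have ne : s != psi x' by have := tc_pnot TC x'; apply: contraNneq => <-.
  apply/negP=> /removable_adm /(_ ne) [M pm [sM]]; by rewrite (hx M pm sM).
case/setUP=> [/set2P[]|/set1P] ->.
- by apply: (go s1) => [|M pm]; [rewrite !inE eqxx | have [q _ _] := exits pm].
- by apply: (go s2) => [|M pm]; [rewrite !inE eqxx orbT | have [_ q _] := exits pm].
- by apply: (go e1) => [|M pm]; [rewrite !inE eqxx !orbT | have [_ _ q] := exits pm].
Qed.

Lemma proj_removable e : removable (psi e) -> e != h0 -> removable e.
Proof.
move=> re eh; have [i1 i2 i3] := x_in.
have ex : e \notin [set x1; x2; x3] by apply: contraL re; apply: exit_nonremovable.
have nD : e \notin [set x3; f2].
  rewrite !inE negb_or; apply/andP; split; first by apply: contraNneq ex => ->.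
  by apply: contraTneq re => ->; rewrite f2E; apply: (e2_nonremovable HN).
apply: (removable_intro HN0 nD) => f0 fe.
have go s : s \in [set s1; s2; e1] -> (forall M, perfect_matching M -> s \in M ->
     perfect_matching [set k | psi k \in M] /\ psi f0 \in M) ->
    exists2 M0, perfect_matching M0 & f0 \in M0 /\ e \notin M0.
  move=> ss hs; have ne : s != psi e by have := tc_pnot TC e; apply: contraNneq => <-.
  have [M pm [sM eM]] := removable_adm re ne; have [pm0 fM] := hs M pm sM.
  by exists [set k | psi k \in M]; rewrite // !inE.
have [fx|fx] := boolP (f0 \in [set x1; x2; x3]).
  case/setUP: fx => [/set2P[]|/set1P] E.
  - apply: (go s1) => [|M pm sM]; first by rewrite !inE eqxx.
    by split; [apply: (proj1 TC pm sM) | rewrite E; have [q _ _] := exits pm; apply: q].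
  - apply: (go s2) => [|M pm sM]; first by rewrite !inE eqxx orbT.
    by split; [apply: (proj2 TC pm sM) | rewrite E; have [_ q _] := exits pm; apply: q].
  - apply: (go e1) => [|M pm sM]; first by rewrite !inE eqxx !orbT.
    by split; [apply: (proj_s3 TC pm sM) | rewrite E; have [_ _ q] := exits pm; apply: q].
have ne : psi f0 != psi e by rewrite (inj_eq (tc_pinj TC)).
have [M pm [fM eM]] := removable_adm re ne.
have [|M0 pm0 [fM0 hM0 _]] := proj_cases pm fM.
  by move: fx; rewrite !inE !negb_or => /andP[/andP[-> _] ->].
exists M0 => //; split=> //; apply/negP=> /hM0[E|eM']; first by rewrite E eqxx in eh.
by rewrite eM' in eM.
Qed.

Lemma ascent : #|removables G| <= #|removables G0| + 1.
Proof.
rewrite -(card_imset _ (tc_pinj TC)).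
have : removables G \subset psi h0 |: psi @: removables G0.
  apply/subsetP=> g; rewrite in_removables => rg; rewrite in_setU1.
  have [gs|gs] := boolP (g \in [set s1; s2; e1]).
    case/setUP: gs => [/set2P[]|/set1P] E; move: rg; rewrite E.
    - by rewrite (negPf s1_nonremovable).
    - by rewrite (negPf s2_nonremovable).
    - by rewrite (negPf (e1_nonremovable HN)).
  have [e E] := tc_pim TC gs; rewrite -E in rg *; rewrite (inj_eq (tc_pinj TC)).
  case: eqVneq => //= eh; apply: imset_f; rewrite in_removables; exact: proj_removable.
move/subset_leq_card; rewrite cardsU1; case: (_ \notin _) => /=; clear; lia.
Qed.

End Ascent.

End Counting.

(** * Isomorphisms, contractions and splicing with K4 *)

Section Iso.
Variables (G H : mgraph) (f : vert G -> vert H) (g : edge G -> edge H).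
Hypothesis I : iso_map f g.

Lemma iso_joins e u v : joins e u v -> joins (g e) (f u) (f v).
Proof.
case: I => _ [_ h]; case: (h e) => E; case/orP=> /eqP Ee; rewrite Ee /= in E.
- by rewrite /joins E eqxx.
- by rewrite /joins E eqxx orbT.
- by rewrite /joins E eqxx orbT.
- by rewrite /joins E eqxx.
Qed.

Lemma iso_joinsV e u v : joins (g e) (f u) (f v) -> joins e u v.
Proof.
case: I => /bij_inj fi [_ h] j.
have j' := iso_joins (joins_ends e).
have : f u \in vs (g e) := joins_l j.
rewrite (joins_vs j') => /set2P[] /fi E; rewrite E in j *.
  by rewrite -(fi _ _ (joins_injr j' j)) joins_ends.
by rewrite joinsC in j'; rewrite -(fi _ _ (joins_injr j' j)) joinsC joins_ends.
Qed.

End Iso.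

Section IsoSgraph.
Variables (n : nat) (r : nat -> nat -> bool) (H : mgraph) (f : vert H -> 'I_n).
Hypothesis bf : bijective f.
Hypothesis adj : forall u v, f u < f v -> adjb u v = r (f u) (f v).
Hypothesis noloop : forall e u v, @joins H e u v -> u != v.
Hypothesis simple : forall e e' u v, @joins H e u v -> joins e' u v -> e = e'.

(** [sgraph] stores each edge as an increasing pair, so for a loopless graph without parallel edges
    a vertex bijection respecting adjacency extends to the edges. *)
Lemma iso_sgraph : exists g, @iso_map H (sgraph n r) f g.
Proof.
have [f' fK f'K] := bf.
pose pr (e : edge H) := let i := f (ends e).1 in let j := f (ends e).2 in
   if i < j then (i, j) else (j, i).
have prP e : ((pr e).1 < (pr e).2) && r (pr e).1 (pr e).2.
  have jE := joins_ends e.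
  have ne : f (ends e).1 != f (ends e).2 by rewrite (inj_eq (can_inj fK)) (noloop jE).
  rewrite /pr /=; have [lt|le] := ltnP (f (ends e).1) (f (ends e).2) => /=.
    by rewrite lt -adj //; apply/adjbP; exists e.
  have lt : f (ends e).2 < f (ends e).1 by rewrite ltn_neqAle le andbT eq_sym.
  by rewrite lt -adj //; apply/adjbP; exists e; rewrite joinsC.
pose g e : edge (sgraph n r) := exist _ (pr e) (prP e).
have prJ e u v : joins e u v -> f u < f v -> pr e = (f u, f v).
  move=> j lt; rewrite /pr; case/orP: j => /eqP -> /=; first by rewrite lt.
  by rewrite ltnNge ltnW.
have ex (p : edge (sgraph n r)) : exists e, joins e (f' (val p).1) (f' (val p).2).
  by apply/adjbP; have /andP[lt rp] := valP p; rewrite adj !f'K.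
pose g' p := xchoose (ex p).
have g'P p : joins (g' p) (f' (val p).1) (f' (val p).2) := xchooseP (ex p).
have gK : cancel g' g.
  move=> p; apply: val_inj => /=; have /andP[lt _] := valP p.
  by rewrite (prJ _ _ _ (g'P p)) ?f'K // -surjective_pairing.
exists g; split=> //; split.
  exists g' => // e; apply: simple (g'P (g e)) _.
  rewrite /= /pr; case: ifP => _ /=; rewrite !fK ?joins_ends //.
  by rewrite joinsC joins_ends.
by move=> e; rewrite /= /pr; case: ifP => _; [left|right].
Qed.

End IsoSgraph.

(** The part of [tricon] that concerns [G] alone. It is obtained from [wdata] in one direction and
    from a splicing in the other, and yields [tricon] for any graph isomorphic to the
    contraction. *)
Record tridata (G : mgraph) (a1 a2 a3 y1 y2 y3 : vert G)
    (s1 s2 s3 k1 k2 k3 : edge G) : Prop := Tridata {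
  td_neq : uniq [:: a1; a2; a3];
  td_s1 : joins s1 a2 a3; td_s2 : joins s2 a1 a3; td_s3 : joins s3 a1 a2;
  td_k1 : joins k1 a1 y1; td_k2 : joins k2 a2 y2; td_k3 : joins k3 a3 y3;
  td_y : [/\ y1 \notin [set a1; a2; a3], y2 \notin [set a1; a2; a3]
           & y3 \notin [set a1; a2; a3]];
  td_i1 : inc a1 \subset [set s2; s3; k1];
  td_i2 : inc a2 \subset [set s1; s3; k2];
  td_i3 : inc a3 \subset [set s1; s2; k3] }.

Section Contract.
Variables (G : mgraph) (a1 a2 a3 y1 y2 y3 : vert G) (s1 s2 s3 k1 k2 k3 : edge G).
Hypothesis TD : tridata a1 a2 a3 y1 y2 y3 s1 s2 s3 k1 k2 k3.
Local Notation T := [set a1; a2; a3].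

Lemma td_inT v : v \in T -> [\/ v = a1, v = a2 | v = a3].
Proof. by rewrite !inE => /orP[/orP[]|] /eqP; [constructor 1|constructor 2|constructor 3]. Qed.

Lemma td_a : [/\ a1 \in T, a2 \in T & a3 \in T].
Proof. by rewrite !inE !eqxx !orbT. Qed.

Lemma td_touch e v : v \in T -> v \in vs e -> e \in [set s1; s2; s3; k1; k2; k3].
Proof.
move=> /td_inT[] -> ; rewrite -in_inc.
- by move/(subsetP (td_i1 TD)); rewrite !inE => /orP[/orP[]|] ->; rewrite ?orbT.
- by move/(subsetP (td_i2 TD)); rewrite !inE => /orP[/orP[]|] ->; rewrite ?orbT.
- by move/(subsetP (td_i3 TD)); rewrite !inE => /orP[/orP[]|] ->; rewrite ?orbT.
Qed.

Lemma td_out e : e \notin [set s1; s2; s3] -> ~~ (((ends e).1 \in T) && ((ends e).2 \in T)).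
Proof.
move=> es; apply/negP=> /andP[h1 h2].
have vT v : v \in vs e -> v \in T by case/set2P=> ->.
have e1 : (ends e).1 \in vs e by rewrite !inE eqxx.
have [n1 n2 n3] := td_y TD.
have := td_touch h1 e1; rewrite -!setUA setUA setUA in_setU (negPf es) /=.
case/setUP=> [/set1P E|/set2P[] E]; subst e.
- by case/negP: n1; apply: vT; apply: joins_r (td_k1 TD).
- by case/negP: n2; apply: vT; apply: joins_r (td_k2 TD).
- by case/negP: n3; apply: vT; apply: joins_r (td_k3 TD).
Qed.

Lemma td_in e : e \in [set s1; s2; s3] -> ((ends e).1 \in T) && ((ends e).2 \in T).
Proof.
move=> es; suff s : vs e \subset T by move: s; rewrite subUset !sub1set.
have [i1 i2 i3] := td_a.
by case/setUP: es => [/set2P[]|/set1P] ->; rewrite ?(joins_vs (td_s1 TD))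
  ?(joins_vs (td_s2 TD)) ?(joins_vs (td_s3 TD)) subUset !sub1set ?i1 ?i2 ?i3.
Qed.

Lemma td_kout v y e : joins e v y -> y \notin T -> ~~ (((ends e).1 \in T) && ((ends e).2 \in T)).
Proof.
by move=> j yT; case/orP: j => /eqP -> /=; rewrite (negPf yT) ?andbF.
Qed.

Variables (G0 : mgraph) (f : vert (contract T) -> vert G0) (g : edge (contract T) -> edge G0).
Hypothesis If : iso_map f g.

Lemma tricon_of_iso : exists phi psi x1 x2 x3,
  @tricon G G0 phi psi (f None) a1 a2 a3 y1 y2 y3 s1 s2 s3 x1 x2 x3 /\
  [/\ psi x1 = k1, psi x2 = k2 & psi x3 = k3].
Proof.
have [n1 n2 n3] := td_y TD; have [i1 i2 i3] := td_a.
have [bf [bg _]] := If; have [g' gK g'K] := bg; have [f' fK f'K] := bf.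
pose io (v : vert G) : vert (contract T) := insub v.
pose x1 := g (Sub k1 (td_kout (td_k1 TD) n1)).
pose x2 := g (Sub k2 (td_kout (td_k2 TD) n2)).
pose x3 := g (Sub k3 (td_kout (td_k3 TD) n3)).
have E1 : val (g' x1) = k1 by rewrite gK SubK.
have E2 : val (g' x2) = k2 by rewrite gK SubK.
have E3 : val (g' x3) = k3 by rewrite gK SubK.
exists (fun v => f (io v)), (fun e => val (g' e)), x1, x2, x3; split; last by split.
split; rewrite ?E1 ?E2 ?E3; try by case: TD.
- move=> v; rewrite (inj_eq (can_inj fK)) /io; case: insubP => [u|]; last by rewrite negbK => ->.
  by move=> /negPf->.
- move=> u v uT /(can_inj fK); rewrite /io (insubT (fun v => v \notin T) uT).
  by case: insubP => // w _ <- [<-].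
- move=> v0; case E: (f' v0) => [u|].
    exists (val u); rewrite /io valK -E f'K //.
  by exists a1; rewrite /io insubN ?negbK // -E f'K.
- by move=> e e' /val_inj /(can_inj g'K).
- move=> e es; exists (g (Sub e (td_out es))); by rewrite gK SubK.
- by move=> e; apply/negP=> /td_in; apply/negP; apply: (valP (g' e)).
- move=> e x y j; rewrite -[e]g'K; apply: (iso_joins If).
  by case/orP: j => /eqP E; rewrite /joins /= E eqxx ?orbT.
Qed.

End Contract.

Section Splice.
Variables (G : mgraph) (a1 a2 a3 y1 y2 y3 : vert G) (s1 s2 s3 k1 k2 k3 : edge G).
Hypothesis TD : tridata a1 a2 a3 y1 y2 y3 s1 s2 s3 k1 k2 k3.
Local Notation T := [set a1; a2; a3].
Local Notation C := (contract (~: T)).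

Let io (v : vert G) : vert C := insub v.
(** The triangle vertices are numbered from one; zero stands for the contracted complement. *)
Let num (v : vert G) : nat := if v \in T then (index v [:: a1; a2; a3]).+1 else 0.
Let f (o : vert C) : 'I_4 := if o is Some u then inord (num (val u)) else ord0.

Lemma num_lt v : num v < 4.
Proof.
rewrite /num; case: ifP => // vT; have : v \in [:: a1; a2; a3].
  by move: vT; rewrite !inE orbA.
by rewrite -index_mem.
Qed.

Lemma f_io v : f (io v) = num v :> nat.
Proof.
rewrite /io /f; case: insubP => [u|]; first by move=> _ <-; rewrite inordK // num_lt.
by rewrite in_setC negbK /num; case: (v \in T).
Qed.

Lemma num_vals : [/\ num a1 = 1, num a2 = 2 & num a3 = 3].
Proof.
have := td_neq TD; rewrite /= !inE !negb_or !andbT => /andP[/andP[n12 n13] n23].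
have [i1 i2 i3] := td_a a1 a2 a3.
by rewrite /num i1 i2 i3 /= !eqxx (negPf n12) (negPf n13) (negPf n23).
Qed.

Lemma num_out y : y \notin T -> num y = 0.
Proof. by rewrite /num => /negPf->. Qed.

Lemma f_bij : bijective f.
Proof.
have fin : injective f.
  have numS (v : vert G) : v \notin ~: T -> num v = (index v [:: a1; a2; a3]).+1.
    by rewrite in_setC negbK /num => ->.
  have mT (v : vert G) : v \notin ~: T -> v \in [:: a1; a2; a3].
    by rewrite in_setC negbK !inE orbA.
  have fS (u : {v | v \notin ~: T}) : f (Some u) = (index (val u) [:: a1; a2; a3]).+1 :> nat.
    by rewrite /f inordK ?num_lt // numS // (valP u).
  move=> [u|] [v|] // E; have := congr1 (@nat_of_ord 4) E; rewrite ?fS //.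
  move/succn_inj => E'; congr Some; apply: val_inj.
  by rewrite -(nth_index a1 (mT _ (valP u))) E' nth_index // mT // (valP v).
apply: inj_card_bij => //; rewrite card_ord card_option card_sig.
rewrite (_ : #|_| = 3) // -(set3_card (td_neq TD)); apply: eq_card => v.
by rewrite [LHS]inE [v \in ~: _]in_setC negbK.
Qed.

Lemma io_joins (e : edge C) x z : joins (val e) x z -> joins e (io x) (io z).
Proof. by case/orP=> /eqP E; rewrite /joins /= E eqxx ?orbT. Qed.

Lemma C_label (e : edge C) : exists x z, joins (val e) x z /\
  ((val e, num x, num z) \in [:: (s1, 2, 3); (s2, 1, 3); (s3, 1, 2); (k1, 1, 0); (k2, 2, 0); (k3, 3, 0)]).
Proof.
have [n1 n2 n3] := num_vals; have [o1 o2 o3] := td_y TD.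
have := valP e; rewrite negb_and !in_setC !negbK => h.
have : val e \in [set s1; s2; s3; k1; k2; k3].
  by case/orP: h => h; apply: (td_touch TD h); rewrite !inE eqxx ?orbT.
rewrite !inE => /orP[/orP[/orP[/orP[/orP[]|]|]|]|] /eqP ->.
- by exists a2, a3; split; [exact: td_s1 TD | rewrite n2 n3 !inE !eqxx ?orbT].
- by exists a1, a3; split; [exact: td_s2 TD | rewrite n1 n3 !inE !eqxx ?orbT].
- by exists a1, a2; split; [exact: td_s3 TD | rewrite n1 n2 !inE !eqxx ?orbT].
- by exists a1, y1; split; [exact: td_k1 TD | rewrite n1 (num_out o1) !inE !eqxx ?orbT].
- by exists a2, y2; split; [exact: td_k2 TD | rewrite n2 (num_out o2) !inE !eqxx ?orbT].
- by exists a3, y3; split; [exact: td_k3 TD | rewrite n3 (num_out o3) !inE !eqxx ?orbT].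
Qed.

Lemma joins_sum (H : mgraph) (e : edge H) (F : vert H -> nat) u v x z :
  joins e u v -> joins e x z -> F u + F v = F x + F z.
Proof.
by case/orP=> /eqP E; case/orP=> /eqP; rewrite E => -[-> ->] //; rewrite addnC.
Qed.

Lemma K4_of_triangle : exists g, @iso_map C K4 f g /\ f None = ord0.
Proof.
have [g I] : exists g, @iso_map C (sgraph 4 (fun _ _ => true)) f g; last by exists g.
apply: iso_sgraph; first exact: f_bij.
- have fi : injective f := bij_inj f_bij.
  have [i1 i2 i3] := td_a a1 a2 a3; have [n1 n2 n3] := num_vals; have [o1 o2 o3] := td_y TD.
  move=> u v lt; apply/adjbP.
  have inC e x y : joins e x y -> x \in T -> ~~ (((ends e).1 \in ~: T) && ((ends e).2 \in ~: T)).
    by move=> j xT; case/orP: j => /eqP -> /=; rewrite !in_setC xT ?andbF.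
  have go e x z : joins e x z -> x \in T -> num x = f u -> num z = f v -> exists e' : edge C, joins e' u v.
    move=> j xT E1 E2; exists (Sub e (inC _ _ _ j xT) : edge C).
    have -> : u = io x by apply: fi; apply: val_inj; rewrite /= f_io E1.
    have -> : v = io z by apply: fi; apply: val_inj; rewrite /= f_io E2.
    exact: io_joins.
  have go' e x z : joins e x z -> x \in T -> num x = f v -> num z = f u -> exists e' : edge C, joins e' u v.
    move=> j xT E1 E2; exists (Sub e (inC _ _ _ j xT) : edge C).
    have -> : v = io x by apply: fi; apply: val_inj; rewrite /= f_io E1.
    have -> : u = io z by apply: fi; apply: val_inj; rewrite /= f_io E2.
    rewrite joinsC; exact: io_joins.
  have := ltn_ord (f v); move: lt; case Eu: (nat_of_ord (f u)) => [|[|[|[|i]]]];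
    case Ev: (nat_of_ord (f v)) => [|[|[|[|j]]]] // _ _.
  + by apply: (go' _ _ _ (td_k1 TD) i1); rewrite ?Eu ?Ev ?n1 ?num_out.
  + by apply: (go' _ _ _ (td_k2 TD) i2); rewrite ?Eu ?Ev ?n2 ?num_out.
  + by apply: (go' _ _ _ (td_k3 TD) i3); rewrite ?Eu ?Ev ?n3 ?num_out.
  + by apply: (go _ _ _ (td_s3 TD) i1); rewrite ?Eu ?Ev ?n1 ?n2.
  + by apply: (go _ _ _ (td_s2 TD) i1); rewrite ?Eu ?Ev ?n1 ?n3.
  + by apply: (go _ _ _ (td_s1 TD) i2); rewrite ?Eu ?Ev ?n2 ?n3.
- move=> e u v j; have [x [z [jx mem]]] := C_label e.
  apply/eqP=> E; rewrite E in j.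
  (* The sums [2 ^ i + 2 ^ j] tell unordered pairs apart, so an edge is compared with its label by
     evaluation; a loop would give a single power of two. *)
  have := joins_sum (fun o => 2 ^ f o) j (io_joins jx); rewrite /= !f_io.
  move: mem; rewrite !inE !xpair_eqE; case: (f v) => [[|[|[|[|i]]]] // Hi];
  do ![case/orP]; case/andP=> /andP[_ /eqP->] /eqP-> //.
- move=> e e' u v j j'; apply: val_inj.
  have [x [z [jx mem]]] := C_label e; have [x' [z' [jx' mem']]] := C_label e'.
  have := joins_sum (fun o => 2 ^ f o) j (io_joins jx).
  rewrite (joins_sum (fun o => 2 ^ f o) j' (io_joins jx')) /= !f_io.
  move: mem mem'; rewrite !inE !xpair_eqE.
  by do ![case/orP]; case/andP=> /andP[/eqP-> /eqP->] /eqP->;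
     do ![case/orP]; case/andP=> /andP[/eqP-> /eqP->] /eqP->.
Qed.

Lemma splicing_of_triangle : @splicing G (contract T) None K4 ord0.
Proof.
exists T; split; last first.
  by have [g [I E]] := K4_of_triangle; exists f, g.
exists id, id; split=> //; split; [by exists id | split; [by exists id | by left; rewrite -surjective_pairing]].
Qed.

End Splice.

Lemma K4_joins (i j : vert K4) : i != j -> exists e : edge K4, joins e i j.
Proof.
move=> ne; have [lt|ge] := ltnP i j.
  have P : ((i, j).1 < (i, j).2) && true by rewrite lt.
  by exists (Sub (i, j) P : edge K4); rewrite /joins /= eqxx.
have P : ((j, i).1 < (j, i).2) && true by rewrite andbT ltn_neqAle ge andbT eq_sym.
by exists (Sub (j, i) P : edge K4); rewrite /joins /= eqxx orbT.
Qed.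

Lemma K4_simple (e e' : edge K4) i j : joins e i j -> joins e' i j -> e = e'.
Proof.
move=> h h'; apply: val_inj; have /andP[lt _] := valP e; have /andP[lt' _] := valP e'.
move: h h' lt lt'; rewrite /joins /=.
case/orP=> /eqP ->; case/orP=> /eqP -> //= l1 l2; by have := ltn_trans l1 l2; rewrite ltnn.
Qed.

Lemma K4_noloop (e : edge K4) i : ~~ joins e i i.
Proof.
apply/negP; rewrite /joins orbb => /eqP E; have /andP[lt _] := valP e.
by move: lt; rewrite (E : val e = _) ltnn.
Qed.

(** The contraction of the complement of [X] is [K4], one vertex of which is the contracted one; so
    [X] has three vertices, pairwise joined once and each with one edge to the outside. *)
Lemma splicing_tricon (H G0 : mgraph) (u : vert G0) (w : vert K4) : splicing H u w ->
  exists phi psi a1 a2 a3 y1 y2 y3 s1 s2 s3 x1 x2 x3,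
    @tricon H G0 phi psi u a1 a2 a3 y1 y2 y3 s1 s2 s3 x1 x2 x3.
Proof.
case=> X [[f [g [I Eu]]] [f' [g' [I' _]]]].
have [bf [bg _]] := I'; have [q qK Kq] := bg; have fi := bij_inj bf.
pose C := contract (~: X).
pose io (v : vert H) : vert C := insub v.
have ioN v : (io v == None) = (v \notin X).
  rewrite /io; case: insubP => [z|]; first by rewrite in_setC negbK => ->.
  by rewrite in_setC negbK => ->.
have io_inj a b : a \in X -> io a = io b -> a = b.
  move=> aX; have aX' : a \notin ~: X by rewrite in_setC negbK.
  by rewrite /io (insubT (fun v => v \notin ~: X) aX'); case: insubP => // z _ <- [<-].
have c3 : #|X| = 3.
  have := bij_eq_card bf; rewrite card_ord card_option card_sig => -[E].
  by rewrite -E; apply: eq_card => v; rewrite [RHS]inE in_setC negbK.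
have [a1 [a2 [a3 [[X1 X2 X3] [n12 n23 n31]]]]] := card_gt2P (eq_leq (esym c3)).
have un : uniq [:: a1; a2; a3] by rewrite /= !inE negb_or n12 n23 eq_sym n31.
have EX : X = [set a1; a2; a3].
  apply/esym/eqP; rewrite eqEcard set3_card // c3 andbT.
  by rewrite !subUset !sub1set X1 X2 X3.
have Cj (o o' : vert C) : o != o' -> exists e, joins e o o'.
  move=> ne; have [|e j] := K4_joins (i := f' o) (j := f' o'); first by rewrite (inj_eq fi).
  by exists (q e); apply: (iso_joinsV I'); rewrite Kq.
have Cs (e e' : edge C) o o' : joins e o o' -> joins e' o o' -> e = e'.
  move=> /(iso_joins I') j /(iso_joins I') j'; exact: (bij_inj bg (K4_simple j j')).
have Cn (e : edge C) o : ~~ joins e o o.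
  by apply/negP=> /(iso_joins I'); apply/negP/K4_noloop.
have ioJ (e : edge C) x z : joins (val e) x z -> joins e (io x) (io z).
  by case/orP=> /eqP E; rewrite /joins /= E eqxx ?orbT.
have inner a b : a \in X -> b \in X -> a != b -> exists e : edge C, joins (val e) a b.
  move=> aX bX ab; have [|e j] := Cj (io a) (io b).
    by apply: contraNneq ab => /(io_inj _ _ aX)->.
  exists e; have := j; have je := ioJ e _ _ (joins_ends (val e)).
  have : io a \in vs e := joins_l j.
  rewrite (joins_vs je) => /set2P[] /(io_inj _ _ aX) E; rewrite E.
    move=> j2; have := joins_injr je j2; move=> /esym /(io_inj _ _ bX) ->; exact: joins_ends.
  rewrite joinsC in je; move=> j2; have := joins_injr je j2.
  by move=> /esym /(io_inj _ _ bX) ->; rewrite joinsC joins_ends.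
have outer a : a \in X -> exists (e : edge C) y, y \notin X /\ joins (val e) a y.
  move=> aX; have [|e j] := Cj (io a) None; first by rewrite ioN aX.
  have je := ioJ e _ _ (joins_ends (val e)).
  have : io a \in vs e := joins_l j.
  rewrite (joins_vs je) => /set2P[] /(io_inj _ _ aX) E; rewrite E in j.
    exists e, (ends (val e)).2; rewrite E joins_ends -ioN; split=> //.
    by rewrite (joins_injr je j).
  rewrite joinsC in je; exists e, (ends (val e)).1; rewrite E joinsC joins_ends -ioN; split=> //.
  by rewrite (joins_injr je j).
have [n12' n13' n23'] : [/\ a1 != a2, a1 != a3 & a2 != a3] by rewrite n12 n23 eq_sym n31.
have [s1 j1] := inner _ _ X2 X3 n23'.
have [s2 j2] := inner _ _ X1 X3 n13'.
have [s3 j3] := inner _ _ X1 X2 n12'.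
have [k1 [y1 [o1 l1]]] := outer _ X1.
have [k2 [y2 [o2 l2]]] := outer _ X2.
have [k3 [y3 [o3 l3]]] := outer _ X3.
have incP a k : a \in X -> k \in inc a -> exists2 e : edge C, val e = k &
    exists2 v, joins k a v & [\/ v = a1, v = a2, v = a3 | v \notin X].
  move=> aX; rewrite in_inc => ak; have [v j] := vs_joins ak.
  have P : ~~ (((ends k).1 \in ~: X) && ((ends k).2 \in ~: X)).
    by case/orP: j => /eqP -> /=; rewrite !in_setC aX ?andbF.
  exists (Sub k P); rewrite ?SubK //; exists v => //.
  have [vX|vX] := boolP (v \in X); last by constructor 4.
  by move: vX; rewrite EX !inE => /orP[/orP[]|] /eqP; [constructor 1|constructor 2|constructor 3].
have same (e e' : edge C) a v v' : joins (val e) a v -> joins (val e') a v' -> io v = io v' -> val e = val e'.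
  move=> /ioJ j /ioJ j' E; rewrite E in j; by rewrite (Cs _ _ _ _ j j').
have loop (e : edge C) a : joins (val e) a a -> False.
  by move=> /ioJ; apply/negP/Cn.
have oN v v' : v \notin X -> v' \notin X -> io v = io v' by rewrite -!ioN => /eqP-> /eqP->.
have TD : tridata a1 a2 a3 y1 y2 y3 (val s1) (val s2) (val s3) (val k1) (val k2) (val k3).
  split=> //; rewrite -?EX //.
  - apply/subsetP=> k /(incP _ _ X1) [e <- [v j]] [] E; rewrite ?E in j; rewrite !inE.
    + by case: (loop _ _ j).
    + by rewrite (same _ _ _ _ _ j j3 erefl) eqxx orbT.
    + by rewrite (same _ _ _ _ _ j j2 erefl) eqxx.
    + by rewrite (same _ _ _ _ _ j l1 (oN _ _ E o1)) eqxx !orbT.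
  - apply/subsetP=> k /(incP _ _ X2) [e <- [v j]] [] E; rewrite ?E in j; rewrite !inE.
    + by rewrite joinsC in j3; rewrite (same _ _ _ _ _ j j3 erefl) eqxx orbT.
    + by case: (loop _ _ j).
    + by rewrite (same _ _ _ _ _ j j1 erefl) eqxx.
    + by rewrite (same _ _ _ _ _ j l2 (oN _ _ E o2)) eqxx !orbT.
  - apply/subsetP=> k /(incP _ _ X3) [e <- [v j]] [] E; rewrite ?E in j; rewrite !inE.
    + by rewrite joinsC in j2; rewrite (same _ _ _ _ _ j j2 erefl) eqxx orbT.
    + by rewrite joinsC in j1; rewrite (same _ _ _ _ _ j j1 erefl) eqxx.
    + by case: (loop _ _ j).
    + by rewrite (same _ _ _ _ _ j l3 (oN _ _ E o3)) eqxx !orbT.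
clear -TD I Eu EX; subst X.
have [phi [psi [x1 [x2 [x3 [TC _]]]]]] := tricon_of_iso TD I; rewrite Eu in TC.
by do 14 eexists; exact: TC.
Qed.

(** * The prism *)

Lemma iso_pm (G H : mgraph) (f : vert G -> vert H) (g : edge G -> edge H) M :
  iso_map f g -> perfect_matching M -> perfect_matching (g @: M).
Proof.
move=> I pm; have [[f' fK f'K] [bg _]] := I; have gi := bij_inj bg.
have vsI e : vs (g e) = f @: vs e.
  have j := joins_ends e.
  by rewrite (joins_vs (iso_joins I j)) (joins_vs j) imsetU !imset_set1.
have inI e v : (v \in vs (g e)) = (f' v \in vs e).
  by rewrite vsI -{1}[v]f'K mem_imset //; apply: can_inj fK.
apply/pm_onP; split=> [e _|v _]; first exact: subsetT.
have [e eM ve] := pm_cover pm (in_setT (f' v)).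
exists (g e); first exact: imset_f.
split; first by rewrite inI.
move=> _ /imsetP[h hM ->]; rewrite inI => vh; congr g.
exact: (pm_uniq pm (in_setT (f' v)) hM eM vh ve).
Qed.

Definition o6 i (lt : i < 6) : 'I_6 := Ordinal lt.

Definition prism_edges : seq (edge C6bar) :=
  [:: exist _ (@o6 0 isT, @o6 2 isT) isT; exist _ (@o6 0 isT, @o6 3 isT) isT;
      exist _ (@o6 0 isT, @o6 4 isT) isT; exist _ (@o6 1 isT, @o6 3 isT) isT;
      exist _ (@o6 1 isT, @o6 4 isT) isT; exist _ (@o6 1 isT, @o6 5 isT) isT;
      exist _ (@o6 2 isT, @o6 4 isT) isT; exist _ (@o6 2 isT, @o6 5 isT) isT;
      exist _ (@o6 3 isT, @o6 5 isT) isT].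

Lemma prism_edges_all (e : edge C6bar) : e \in prism_edges.
Proof.
case: e => [[[i Hi] [j Hj]] P].
have E (u v : edge C6bar) : (val u).1 = (val v).1 :> nat -> (val u).2 = (val v).2 :> nat -> u = v.
  move=> h1 h2; apply: val_inj; case: (val u) (val v) h1 h2 => [a b] [c d] /= h1 h2.
  by congr (_, _); apply: val_inj.
suff /hasP[v vin /andP[/eqP h1 /eqP h2]] :
    has (fun v : edge C6bar => (nat_of_ord (val v).1 == i) && (nat_of_ord (val v).2 == j)) prism_edges.
  by rewrite -(E v (exist _ (Ordinal Hi, Ordinal Hj) P) h1 h2).
clear E; move: P => /=.
by do 6?[case: i Hi => [|i] Hi //]; do 6?[case: j Hj => [|j] Hj //].
Qed.

Lemma prism_edges_uniq : uniq prism_edges.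
Proof. by []. Qed.

Lemma prism_pm_count M (v : vert C6bar) : perfect_matching M ->
  count (fun e => (e \in M) && incident e v) prism_edges = 1.
Proof.
case/andP=> _ /forall_inP/(_ v (in_setT v))/eqP <-.
rewrite -size_filter -(card_uniqP (filter_uniq _ prism_edges_uniq)).
by apply: eq_card => e; rewrite mem_filter prism_edges_all andbT !inE.
Qed.

(** A triangle edge of the prism lies in a single perfect matching: itself, the parallel edge of the
    other triangle, and the rung between the two remaining vertices. So every edge is forced by a
    suitable triangle edge. *)
Lemma prism_forced (e : edge C6bar) : exists2 f, f != e &
  forall M, perfect_matching M -> f \in M -> e \in M.
Proof.
(* [F] lists, for each position in [prism_edges], the position of a triangle edge forcing that
   edge. *)
pose F := [:: 8; 6; 3; 2; 0; 6; 5; 2; 0].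
suff h : forall i, i < 9 -> forall M, perfect_matching M ->
   nth e prism_edges (nth 0 F i) \in M -> nth e prism_edges i \in M.
  have := prism_edges_all e; rewrite -index_mem => lt.
  exists (nth e prism_edges (nth 0 F (index e prism_edges))).
    rewrite -{3}(nth_index e (prism_edges_all e)) nth_uniq ?prism_edges_uniq //.
      by move: (index _ _) lt => [|[|[|[|[|[|[|[|[|]]]]]]]]].
    by move: (index _ _) lt => [|[|[|[|[|[|[|[|[|]]]]]]]]].
  by move=> M pm /(h _ lt M pm); rewrite nth_index ?prism_edges_all.
move=> i lt M pm.
(* A perfect matching becomes nine booleans with one equation per vertex, and all cases are
   evaluated. *)
pose b := [seq e \in M | e <- prism_edges].
have zc (p q : pred (edge C6bar)) s : count (fun e => p e && q e) s =
    count (fun c => c.1 && c.2) (zip (map p s) (map q s)).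
  by elim: s => //= x s ->.
have hb v : count (fun c => c.1 && c.2) (zip b [seq incident e v | e <- prism_edges]) = 1.
  by rewrite -(prism_pm_count v pm) zc.
have nb j : j < 9 -> (nth e prism_edges j \in M) = nth false b j.
  by move=> jl; rewrite (nth_map e).
have sb : size b = 9 by [].
have Fl : nth 0 F i < 9 by move: lt; clear; case: i => [|[|[|[|[|[|[|[|[|]]]]]]]]].
rewrite !nb //; move: (hb (@o6 0 isT)) (hb (@o6 1 isT)) (hb (@o6 2 isT))
  (hb (@o6 3 isT)) (hb (@o6 4 isT)) (hb (@o6 5 isT)).
have -> : [seq incident e (@o6 0 isT : vert C6bar) | e <- prism_edges] =
  [:: true; true; true; false; false; false; false; false; false] by [].
have -> : [seq incident e (@o6 1 isT : vert C6bar) | e <- prism_edges] =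
  [:: false; false; false; true; true; true; false; false; false] by [].
have -> : [seq incident e (@o6 2 isT : vert C6bar) | e <- prism_edges] =
  [:: true; false; false; false; false; false; true; true; false] by [].
have -> : [seq incident e (@o6 3 isT : vert C6bar) | e <- prism_edges] =
  [:: false; true; false; true; false; false; false; false; true] by [].
have -> : [seq incident e (@o6 4 isT : vert C6bar) | e <- prism_edges] =
  [:: false; false; true; false; true; false; true; false; false] by [].
have -> : [seq incident e (@o6 5 isT : vert C6bar) | e <- prism_edges] =
  [:: false; false; false; false; false; true; false; true; true] by [].
move: b sb lt {hb nb Fl}; rewrite {}/F; clear => b.
case: b => [|b0 [|b1 [|b2 [|b3 [|b4 [|b5 [|b6 [|b7 [|b8 [|? ?]]]]]]]]]] //= _.
case: i => [|[|[|[|[|[|[|[|[|]]]]]]]]] //= _.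
all: by case: b0; case: b1; case: b2; case: b3; case: b4; case: b5; case: b6; case: b7; case: b8.
Qed.

Lemma prism_rem (G : mgraph) : isomorphic G C6bar -> #|removables G| = 0.
Proof.
case=> f [g I]; apply/eqP; rewrite cards_eq0 -subset0; apply/subsetP=> e; rewrite in_removables => re.
have [_ [[g' gK g'K] _]] := I.
have [k ne hk] := prism_forced (g e).
have ne' : g' k != e by apply: contraNneq ne => <-; rewrite g'K.
have [M pm [kM eM]] := removable_adm re ne'.
have := hk _ (iso_pm I pm); rewrite -{1}(g'K k) !(mem_imset _ _ (can_inj gK)) kM => /(_ isT).
by rewrite (negPf eM).
Qed.

Section Prism.
Variables (G : mgraph) (A : {set vert G}) (e1 e2 : edge G).
Variables (a1 a2 w y1 y2 y3 : vert G) (s1 s2 g1 g2 g3 : edge G).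
Hypothesis HN : nbs A e1 e2.
Hypothesis R0 : vs e1 :|: vs e2 \subset remdeg0 G.
Hypothesis Hz : exists2 z, z \in A :\: vs e1 & z \in remdeg0 G.
Hypothesis W : wdata A e1 e2 a1 a2 w y1 y2 y3 s1 s2 g1 g2 g3.
Hypothesis c3 : #|A| = 3.
Local Notation D := [set e1; e2].
Local Notation N := (nb [set e1; e2]).

Lemma prism_of_nbs : isomorphic G C6bar.
Proof.
have [i1 i2 n12] := wd_a W; have [y1w y2w y12 y31 y32] := wd_y W.
have [yA1 yA2 yA3] := eq_yA HN W; have wA := eq_wA W.
have /setDP[_ we2] := wd_w W; have e1E := eq_e1 W.
have y3e : y3 \in A :\: vs e1 by rewrite in_setD yA3 e1E !inE negb_or y31 y32.
have AE : A = [set a1; a2; y3].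
  apply/esym/eqP; rewrite eqEcard !subUset !sub1set i1 i2 yA3 c3 set3_card //=.
  by rewrite !inE negb_or n12 ![_ == y3]eq_sym y31 y32.
have BE : ~: A = [set w; y1; y2].
  apply/esym/eqP; rewrite eqEcard !subUset !sub1set !in_setC wA yA1 yA2 -(nbs_card HN) c3 set3_card //=.
  by rewrite !inE negb_or y12 ![w == _]eq_sym y1w y2w.
have e2E : vs e2 = [set y1; y2].
  apply/eqP; rewrite eqEcard (nbs_c2 HN) cards2 y12 andbT; apply/subsetP=> v v2.
  have := subsetP (nbs_e2 HN) _ v2; rewrite BE -setUA in_setU1 => /orP[/eqP E|//].
  by rewrite -E v2 in we2.
have N3 : N [set y3] = ~: A.
  apply/eqP; rewrite eqEcard (N_sub HN) ?sub1set //= -(nbs_card HN) c3.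
  exact: (N1_ge3 HN y3e).
have y30 : y3 \in remdeg0 G.
  case: Hz => z zA z0; suff <- : z = y3 by [].
  by move: zA; rewrite in_setD e1E AE !inE negb_or => /andP[/andP[/negPf-> /negPf->]] /= /eqP.
have A0 a : a \in A -> a \in remdeg0 G.
  rewrite AE in_setU -e1E => /orP[h|/set1P->//].
  by apply: (subsetP R0); rewrite in_setU h.
have simple (e e' : edge G) u v : joins e u v -> joins e' u v -> e = e'.
  move=> j j'; have vE : vs e = vs e' by rewrite (joins_vs j) (joins_vs j').
  have dD k k' : k \in D -> vs k = vs k' -> k = k'.
    move=> kD E; have [k'D|k'D] := boolP (k' \in D).
      have ne : vs e1 != vs e2.
        apply: contraNneq yA1 => E2; apply: (subsetP (nbs_e1 HN)).
        by rewrite E2 e2E !inE eqxx.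
      case/set2P: kD => Ek; case/set2P: k'D => Ek'; rewrite Ek Ek' // in E *.
        by rewrite E eqxx in ne.
      by rewrite E eqxx in ne.
    have [x [z [jx xA zA]]] := edge_ends HN k'D.
    have hx : x \in vs k by rewrite E (joins_l jx).
    have hz : z \in vs k by rewrite E (joins_r jx).
    case/set2P: kD => Ek; rewrite Ek in hx hz.
      by have := subsetP (nbs_e1 HN) _ hz; rewrite (negPf zA).
    by have := subsetP (nbs_e2 HN) _ hx; rewrite inE xA.
  have [eD|eD] := boolP (e \in D); first exact: dD.
  have [eD'|eD'] := boolP (e' \in D); first by apply/esym/dD.
  have [uA|uA] := boolP (u \in A); first exact: (simple_at HN (A0 _ uA) eD eD' j j').
  rewrite joinsC in j; rewrite joinsC in j'.
  exact: (simple_at HN (A0 _ (joinsA HN eD j uA)) eD eD' j j').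
have noloop (e : edge G) u v : joins e u v -> u != v.
  move=> j; have := vs2 HN e; rewrite (joins_vs j) cards2; by case: eqP.
(* The cyclic order in which consecutive vertices are nonadjacent: the triangle on [e1] takes the
   even positions, that on [e2] the odd ones. *)
pose sq := [:: a1; y2; w; y1; a2; y3].
have nAB a b : a \in A -> b \notin A -> a != b by move=> h; apply: contraNneq => <-.
have usq : uniq sq.
  rewrite /= !inE !negb_or.
  rewrite (nAB a1 y2) // (nAB a1 w) // (nAB a1 y1) // n12 [a1 == _]eq_sym y31.
  rewrite y2w [y2 == y1]eq_sym y12 [y2 == a2]eq_sym (nAB a2 y2) // [y2 == y3]eq_sym (nAB y3 y2) //.
  rewrite [w == y1]eq_sym y1w [w == a2]eq_sym (nAB a2 w) // [w == y3]eq_sym (nAB y3 w) //.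
  rewrite [y1 == a2]eq_sym (nAB a2 y1) // [y1 == y3]eq_sym (nAB y3 y1) //.
  by rewrite eq_sym y32.
have msq v : v \in sq.
  have : v \in A :|: ~: A by rewrite setUCr in_setT.
  rewrite BE AE !inE => /orP[/orP[/orP[]|]|/orP[/orP[]|]] ->; rewrite ?orbT //.
have card6 : #|vert G| = 6 by rewrite -(cardsC A) -(nbs_card HN) c3.
pose f v : 'I_6 := inord (index v sq).
have fE v : f v = index v sq :> nat.
  by rewrite inordK //; have := msq v; rewrite -index_mem.
have fnth v : v = nth a1 sq (f v) by rewrite fE nth_index.
have fi : injective f by move=> u v E; rewrite (fnth u) (fnth v) E.
have bf : bijective f by apply: inj_card_bij => //; rewrite card_ord card6.
have pos u v : (exists k : edge G, joins k u v) -> adjb u v = true by move=> h; apply/adjbP.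
have edgeNC a b : b \in N [set a] -> exists k : edge G, joins k b a.
  by case/nb1P=> k _ j; exists k; rewrite joinsC.
have negAA u v : u \in A -> v \in A -> v \notin vs e1 -> adjb u v = false.
  move=> uA vA v1; apply/negbTE/negP=> /adjbP[k j].
  have [kD|kD] := boolP (k \in D); last by have := joinsB HN kD j uA; rewrite vA.
  case/set2P: kD => E; rewrite E in j; first by rewrite (joins_r j) in v1.
  by have := subsetP (nbs_e2 HN) _ (joins_r j); rewrite inE vA.
have negBB u v : u \notin A -> v \notin A -> (u == w) || (v == w) -> adjb u v = false.
  move=> uA vA uvw; apply/negbTE/negP=> /adjbP[k j].
  have [kD|kD] := boolP (k \in D); last by have := joinsA HN kD j vA; rewrite (negPf uA).
  case/set2P: kD => E; rewrite E in j.
    by have := subsetP (nbs_e1 HN) _ (joins_r j); rewrite (negPf vA).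
  by case/negP: we2; case/orP: uvw => /eqP <-; [apply: joins_l j | apply: joins_r j].
have adjC u v : @adjb G u v = adjb v u.
  by apply/adjbP/adjbP=> -[k j]; exists k; rewrite joinsC.
have negAB a b : a \in A -> b \notin A -> b \notin N [set a] -> adjb a b = false.
  move=> aA bA nN; apply/negbTE/negP=> /adjbP[k j]; case/negP: nN; apply/nb1P; exists k => //.
  apply/negP=> /set2P[] E; rewrite E in j.
    by have := subsetP (nbs_e1 HN) _ (joins_r j); rewrite (negPf bA).
  by have := subsetP (nbs_e2 HN) _ (joins_l j); rewrite inE aA.
have adj u v : f u < f v -> adjb u v = ~~ ((f v - f u == 1) || (f v - f u == 5)).
  rewrite [in LHS](fnth u) [in LHS](fnth v); move: (f u) (f v) => [i Hi] [j Hj] /=.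
  have [y3w y3y1 y3y2] : [/\ w \in N [set y3], y1 \in N [set y3] & y2 \in N [set y3]].
    by rewrite N3 !in_setC.
  do 6?[case: i Hi => [|i] Hi //]; do 6?[case: j Hj => [|j] Hj //]; move=> _ /=.
  - by apply: negAB => //; rewrite (wd_N1 W) !inE negb_or y2w eq_sym y12.
  - by apply: pos; exists s2; apply: wd_s2 W.
  - by apply: pos; exists g1; apply: wd_g1 W.
  - by apply: pos; exists e1; apply: wd_e1 W.
  - by apply: negAA => //; case/setDP: y3e.
  - by apply: negBB => //; rewrite eqxx orbT.
  - by apply: pos; exists e2; apply: vs_eq_joins; rewrite e2E setUC.
  - by apply: pos; exists g2; rewrite joinsC; apply: wd_g2 W.
  - by apply: pos; apply: edgeNC.
  - by apply: negBB => //; rewrite eqxx.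
  - by apply: pos; exists s1; rewrite joinsC; apply: wd_s1 W.
  - by apply: pos; apply: edgeNC.
  - by rewrite adjC; apply: negAB => //; rewrite (wd_N2 W) !inE negb_or y1w y12.
  - by apply: pos; apply: edgeNC.
  - by apply: negAA => //; case/setDP: y3e.
have [g I] := @iso_sgraph 6 (fun i j => ~~ ((j - i == 1) || (j - i == 5))) G f bf adj noloop simple.
by exists f, g.
Qed.

End Prism.

(** * Induction along tri-ladders *)

Lemma tridata_of_wdata (G : mgraph) A e1 e2 (a1 a2 w y1 y2 y3 : vert G) s1 s2 g1 g2 g3 :
  nbs A e1 e2 -> wdata A e1 e2 a1 a2 w y1 y2 y3 s1 s2 g1 g2 g3 ->
  tridata a1 a2 w y1 y2 y3 s1 s2 e1 g1 g2 g3.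
Proof.
move=> HN W.
have [i1 i2 n12] := wd_a W; have [y1w y2w y12 y31 y32] := wd_y W.
have [yA1 yA2 yA3] := eq_yA HN W; have wA := eq_wA W.
have nAB a b : a \in A -> b \notin A -> a != b by move=> h; apply: contraNneq => <-.
split; try by case: W.
- by rewrite /= !inE !negb_or n12 !nAB.
- split; rewrite !inE !negb_or.
  + by rewrite [y1 == a1]eq_sym [y1 == a2]eq_sym !(nAB _ y1) // y1w.
  + by rewrite [y2 == a1]eq_sym [y2 == a2]eq_sym !(nAB _ y2) // y2w.
  + by rewrite y31 y32 nAB.
Qed.

Lemma nbs_vert (G : mgraph) A e1 e2 : @nbs G A e1 e2 -> #|vert G| = 2 * #|A|.
Proof. by move=> HN; rewrite -(cardsC A) -(nbs_card HN) addnn mul2n. Qed.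

(** The contraction loses two vertices and at least one removable edge, so its own lower bound
    forces equality there as well. *)
Theorem triladder_of_equality (G : mgraph) A e1 e2 : @nbs G A e1 e2 ->
  2 * #|removables G| + 6 = #|vert G| -> triladder G.
Proof.
have [n] := ubnP #|vert G|; elim: n => // n IH in G A e1 e2 *; rewrite ltnS => le HN eq.
have [_ /(_ eq) [R0 Hz [w wB w0] Hd]] := lower_bound HN.
have [a1 [a2 [y1 [y2 [y3 [s1 [s2 [g1 [g2 [g3 W]]]]]]]]]] := wdata_exists HN R0 wB w0.
have := nbs_ge3 HN; rewrite leq_eqVlt => /orP[/eqP c3|ge4].
  by apply: triladder_base; apply: (prism_of_nbs HN R0 Hz W (esym c3)).
wlog adj : a1 a2 y1 y2 s1 s2 g1 g2 W / y3 \in nb [set e1; e2] [set y1].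
  move=> wl; have [h|h] := adj_y3 HN Hd ge4 W; first exact: (wl _ _ _ _ _ _ _ _ W h).
  exact: (wl _ _ _ _ _ _ _ _ (wdata_swap W) h).
have [h hD jh] := elimT (nb1P _ _ _ _) adj.
have TD := tridata_of_wdata HN W.
have I : @iso_map (contract [set a1; a2; w]) (contract [set a1; a2; w]) id id.
  by split; [exists id | split; [exists id | left; rewrite -surjective_pairing]].
have [phi [psi [x1 [x2 [x3 [TC [E1 E2 E3]]]]]]] := tricon_of_iso TD I.
have wA := eq_wA W; have /setDP[_ we2] := wd_w W.
have [yA1 yA2 yA3] := eq_yA HN W.
have [h0 Eh] : exists h0, psi h0 = h by have [yT _ _] := tc_y TC; apply: (psi_ex TC yT (joins_l jh)).
have [f2 Ef] : exists f2, psi f2 = e2.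
  apply: (tc_pim TC); have [d1 d2 _ _ _] := wd_D W.
  rewrite !inE !negb_or eq_sym [e2 == e1]eq_sym (e1_neq_e2 HN) andbT.
  apply/andP; split; first by apply: contraNneq d1 => ->; rewrite !inE eqxx orbT.
  by apply: contraNneq d2 => <-; rewrite !inE eqxx orbT.
subst h g3.
have HN0 := contraction_nbs TC HN wA we2 Ef hD jh ge4.
have lt := descent TC HN wA we2 Ef hD jh ge4 R0 Hz Hd W.
have cG := tc_card TC.
have [lb _] := lower_bound HN0.
have [n1 n2 n3] := td_y TD.
apply: (triladder_step (u := None : vert (contract [set a1; a2; w])) (w := ord0 : vert K4)).
- apply: (IH _ _ _ _ _ HN0); first by move: le cG; clear; lia.
  by move: lb lt eq cG; clear; lia.
(* The triangle at [t] consists of [x1], [x3] and the rung [h0]. *)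
- exists (phi y1), (phi y3).
  have [v1 v2 v3] := x_vs TC.
  have t1 := tc_t TC y1; have t3 := tc_t TC y3.
  have j1 := tc_pj TC (tc_x1 TC); have j3 := tc_pj TC (tc_x3 TC); have jh0 := tc_pj TC jh.
  have [ia1 _ ia3] := td_a a1 a2 w.
  rewrite (phi_T TC ia1) in j1; rewrite (phi_T TC ia3) in j3.
  repeat (apply/andP; split).
  + by rewrite eq_sym t1.
  + apply/eqP=> E; have := tc_inj TC n1 E => E'.
    by rewrite E' yA3 in yA1.
  + by rewrite eq_sym t3.
  + by apply/adjbP; exists x1.
  + by apply/adjbP; exists h0.
  + by apply/adjbP; exists x3.
- exact: splicing_of_triangle TD.
Qed.

Lemma triladder_card G : triladder G -> 6 <= #|vert G|.
Proof.
elim=> {G} [G [f [g [bf _]]]|G0 H u w _ IH _ /splicing_tricon].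
  by rewrite (bij_eq_card bf) card_ord.
case=> phi [psi [a1 [a2 [a3 [y1 [y2 [y3 [s1 [s2 [s3 [x1 [x2 [x3 TC]]]]]]]]]]]]].
by rewrite -(tc_card TC) (leq_trans IH) ?leq_addr.
Qed.

Section AscentStep.
Variables (G G0 : mgraph) (phi : vert G -> vert G0) (psi : edge G0 -> edge G) (t : vert G0).

Lemma psi_joins a1 a2 a3 y1 y2 y3 s1 s2 s3 x1 x2 x3 e y y' :
  tricon phi psi t a1 a2 a3 y1 y2 y3 s1 s2 s3 x1 x2 x3 ->
  y \notin [set a1; a2; a3] -> y' \notin [set a1; a2; a3] ->
  joins e (phi y) (phi y') -> joins (psi e) y y'.
Proof.
move=> TC yT yT' j; have [z jz] := vs_joins (psi_vs TC yT (joins_l j)).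
by rewrite (tc_inj TC yT' (joins_injr j (tc_pj TC jz))).
Qed.

Hypothesis IH : forall A e1 e2, @nbs G0 A e1 e2 -> 2 * #|removables G0| + 6 <= #|vert G0|.

(** [IH] and the lower bound give equality for [G0], where [t] is an end of the distinguished edge
    [x3]. So no edge at [t] is removable, in particular not [x1], as [ascent] requires. *)
Lemma ascent_rung a1 a2 w y1 y2 y3 s1 s2 e1 e2 x1 x2 x3 h0 f2 A :
  tricon phi psi t a1 a2 w y1 y2 y3 s1 s2 e1 x1 x2 x3 -> nbs A e1 e2 ->
  w \notin A -> w \notin vs e2 -> psi f2 = e2 -> joins (psi h0) y1 y3 -> 4 <= #|A| ->
  2 * #|removables G| + 6 <= #|vert G|.
Proof.
move=> TC HN wA we2 Ef jh ge4.
have yA3 := tn_y3 TC HN wA we2.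
have hD : psi h0 \notin [set e1; e2].
  have := tc_pnot TC h0; rewrite !inE !negb_or => /andP[_ ->] /=.
  apply/eqP=> E; have := subsetP (nbs_e2 HN) _ (_ : y3 \in vs e2).
  by rewrite -E (joins_r jh) inE yA3 => /(_ isT).
have HN0 := contraction_nbs TC HN wA we2 Ef hD jh ge4.
have le := IH HN0; have [lb eqp] := lower_bound HN0.
have /eqp[R0 _ _ _] : 2 * #|removables G0| + 6 = #|vert G0| by apply/eqP; rewrite eqn_leq le lb.
have nx1 : ~~ removable x1.
  apply: (remdeg0P (v := t)); last by rewrite (vs_x1 TC) !inE eqxx.
  by apply: (subsetP R0); rewrite in_setU (tn_vsx3 TC) !inE eqxx.
have := ascent TC HN wA we2 Ef hD jh ge4 nx1; have := tc_card TC.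
by move: le; clear; lia.
Qed.

(** The triangle of [G0] at [t] joins two of [phi y1], [phi y2], [phi y3]. A pair containing
    [phi y3] gives a rung; the remaining pair is impossible. *)
Lemma ascent_step a1 a2 w y1 y2 y3 s1 s2 e1 e2 x1 x2 x3 A :
  tricon phi psi t a1 a2 w y1 y2 y3 s1 s2 e1 x1 x2 x3 -> nbs A e1 e2 ->
  in_triangle t -> 6 <= #|vert G0| -> 2 * #|removables G| + 6 <= #|vert G|.
Proof.
move=> TC HN [p [q /and5P[tp pq tq ap /andP[apq aq]]]] ge6.
have [i1 i2] := tn_a TC HN; have [n12 n13 n23] := neqT TC.
have e1E := tn_e1 TC; have [yT1 yT2 yT3] := tc_y TC.
have ge4 : 4 <= #|A|.
  by have := tc_card TC; rewrite (nbs_vert HN); move: ge6; clear; lia.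
have e2A v : v \in vs e2 -> v \notin A by move/(subsetP (nbs_e2 HN)); rewrite inE.
have s1D : s1 \notin [set e1; e2].
  rewrite !inE negb_or; apply/andP; split; apply/eqP=> E.
    have := joins_r (tc_s1 TC); rewrite E e1E !inE eq_sym (negPf n13) /= eq_sym.
    by rewrite (negPf n23).
  by have := e2A a2; rewrite -E (joins_l (tc_s1 TC)) i2 => /(_ isT).
have wA : w \notin A := joinsB HN s1D (tc_s1 TC) i2.
have s2e2 : s2 != e2.
  by apply/eqP=> E; have := e2A a1; rewrite -E (joins_l (tc_s2 TC)) i1 => /(_ isT).
have s1e2 : s1 != e2 by move: s1D; rewrite !inE negb_or => /andP[].
have [f2 Ef] : exists f2, psi f2 = e2.
  apply: (tc_pim TC).
  by rewrite !inE !negb_or ![e2 == _]eq_sym s1e2 s2e2 (e1_neq_e2 HN).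
(* Otherwise [e2] is the third edge at [w], and all other neighbours of [w] are ends of [e1],
   against the dual of [nbs_C2]. *)
have we2 : w \notin vs e2.
  apply/negP=> we; have : e2 \in inc w by rewrite in_inc.
  move/(subsetP (tc_i3 TC)); rewrite !inE eq_sym (negPf s1e2) eq_sym (negPf s2e2) /= => /eqP E.
  have HS := nbs_sym HN; have := nbs_C2 HS (X := [set w]).
  rewrite sub1set inE wA cards1 -(nbs_card HN) => /(_ isT).
  rewrite (leq_trans _ ge4) // => /(_ isT) /card_gt0P[v /setDP[]].
  rewrite setUC => /nb1P[g gD j] /negP[]; rewrite e1E.
  have := subsetP (tc_i3 TC) g; rewrite in_inc (joins_l j) => /(_ isT).
  rewrite -E !inE => /orP[/orP[]|] /eqP Eg; rewrite Eg in j gD.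
  - by have js := tc_s1 TC; rewrite joinsC in js; rewrite (joins_injr j js) eqxx orbT.
  - by have js := tc_s2 TC; rewrite joinsC in js; rewrite (joins_injr j js) eqxx.
  - by rewrite !inE eqxx orbT in gD.
have nbr z : adjb t z -> [\/ z = phi y1, z = phi y2 | z = phi y3].
  case/adjbP=> e j; have := t_vs TC (joins_l j).
  have [T1 T2 T3] := td_a a1 a2 w.
  case/setUP=> [/set2P[]|/set1P] E; rewrite E in j.
  - constructor 1; have := tc_pj TC (tc_x1 TC); rewrite (phi_T TC T1); exact: joins_injr j.
  - constructor 2; have := tc_pj TC (tc_x2 TC); rewrite (phi_T TC T2); exact: joins_injr j.
  - constructor 3; have := tc_pj TC (tc_x3 TC); rewrite (phi_T TC T3); exact: joins_injr j.
have [h0 jh] := elimT (adjbP _ _) apq.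
have jhC : joins h0 q p by rewrite joinsC.
have case13 h : joins h (phi y1) (phi y3) -> 2 * #|removables G| + 6 <= #|vert G|.
  by move=> j; apply: (ascent_rung TC HN wA we2 Ef (psi_joins TC yT1 yT3 j) ge4).
have case23 h : joins h (phi y2) (phi y3) -> 2 * #|removables G| + 6 <= #|vert G|.
  move=> j; apply: (ascent_rung (tricon_swap TC) HN wA we2 Ef (psi_joins TC yT2 yT3 j) ge4).
(* Such an edge joins two vertices outside [A], so it is [e2]; then [a1] and [a2] see only [w]
   outside [e2], against [nbs_C2]. *)
have case12 h : joins h (phi y1) (phi y2) -> False.
  move=> /(psi_joins TC yT1 yT2) j.
  have yA a y x : joins (psi x) a y -> a \in A -> y \notin A.
    move=> jx aA; apply: (joinsB HN _ jx aA).
    have := tc_pnot TC x; rewrite !inE !negb_or => /andP[_ ->] /=.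
    by apply/eqP=> E; have := e2A a; rewrite -E (joins_l jx) aA => /(_ isT).
  have yA1 := yA _ _ _ (tc_x1 TC) i1; have yA2 := yA _ _ _ (tc_x2 TC) i2.
  have E : vs e2 = [set y1; y2].
    have [hD|hD] := boolP (psi h \in [set e1; e2]); last first.
      by have := joinsA HN hD j yA2; rewrite (negPf yA1).
    case/set2P: hD => E; last by rewrite -E (joins_vs j).
    by have := tc_pnot TC h; rewrite E !inE eqxx !orbT.
  have sA : [set a1; a2] \subset A by rewrite subUset !sub1set i1 i2.
  have := nbs_C2 HN sA; rewrite cards2 n12 => /(_ ge4).
  have : nb [set e1; e2] [set a1; a2] :\: vs e2 \subset [set w].
    apply/subsetP=> v; rewrite nbU E => /setDP[vN vy].
    have : v \in [set w; y1] :|: [set w; y2].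
      case/setUP: vN => [/(subsetP (tn_N1 e2 TC))|/(subsetP (tn_N1 e2 (tricon_swap TC)))] h1;
      by rewrite in_setU h1 ?orbT.
    move: vy; rewrite !inE negb_or => /andP[/negPf-> /negPf->]; by rewrite !orbF orbb.
  by move/subset_leq_card; rewrite cards1; clear; lia.
case: (nbr _ ap) => Ep; case: (nbr _ aq) => Eq; rewrite Ep Eq ?eqxx // in jh jhC pq.
- by case: (case12 _ jh).
- exact: case13 jh.
- by case: (case12 _ jhC).
- exact: case23 jh.
- exact: case13 jhC.
- exact: case23 jhC.
Qed.

End AscentStep.

(** The bound is proved for all [A], [e1], [e2], since a splicing does not provide them. A triangle
    is odd, so one of its edges is [e1] or [e2]; rotation places that edge opposite the third
    vertex. *)
Theorem triladder_upper G : triladder G -> forall A e1 e2, @nbs G A e1 e2 ->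
  2 * #|removables G| + 6 <= #|vert G|.
Proof.
elim=> {G} [G iso|G0 H u w lad IH tri /splicing_tricon sp] A e1 e2 HN.
  rewrite (prism_rem iso); case: iso => f [g [bf _]].
  by rewrite (bij_eq_card bf) card_ord.
case: sp => phi [psi [a1 [a2 [a3 [y1 [y2 [y3 [s1 [s2 [s3 [x1 [x2 [x3 TC]]]]]]]]]]]]].
have c0 := triladder_card lad.
have go b1 b2 b3 z1 z2 z3 r1 r2 r3 w1 w2 w3 :
    tricon phi psi u b1 b2 b3 z1 z2 z3 r1 r2 r3 w1 w2 w3 -> r3 \in [set e1; e2] ->
    2 * #|removables H| + 6 <= #|vert H|.
  move=> TC' /set2P[] E; rewrite E in TC'.
    exact: (ascent_step IH TC' HN tri c0).
  exact: (ascent_step IH TC' (nbs_sym HN) tri c0).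
have [d3|d3] := boolP (s3 \in [set e1; e2]); first exact: go TC d3.
have [d1|d1] := boolP (s1 \in [set e1; e2]); first exact: go (tricon_rot TC) d1.
have [d2|d2] := boolP (s2 \in [set e1; e2]).
  exact: go (tricon_rot (tricon_rot TC)) d2.
have cj := cross_joins (nbs_cross HN).
have := cj _ _ _ d1 (tc_s1 TC); have := cj _ _ _ d2 (tc_s2 TC); have := cj _ _ _ d3 (tc_s3 TC).
by move=> ->->; case: (a1 \in A).
Qed.

Unset Implicit Arguments.

Theorem theorem1p2 (G : mgraph) :
  loopless G -> brick G -> near_bipartite G -> ~ isomorphic G K4 ->
  #|vert G| <= 2 * #|[set e : edge G | removable e]| + 6 /\
  (2 * #|[set e : edge G | removable e]| + 6 = #|vert G| <-> triladder G).
Proof.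
move=> ll [_ [_ bic]] nbp _; rewrite -/(removables G).
case: (leqP 6 #|vert G|) => [ge6|lt6].
  have [A [e1 [e2 HN]]] := nbs_of_near_bipartite_brick ll bic nbp ge6.
  have [lb _] := lower_bound HN; split=> //; split=> [|lad].
    exact: (triladder_of_equality HN).
  by apply/eqP; rewrite eqn_leq lb (triladder_upper lad HN).
split; first by move: lt6; clear; lia.
(* Both sides of the equivalence are false here: the count is at least 6, and a tri-ladder has at
   least six vertices. *)
split=> [eq|/triladder_card]; last by rewrite leqNgt lt6.
by move: lt6; rewrite -eq ltnNge leq_addl.
Qed.
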